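(* For every $a\in\mathbb{R}$ with $32-(1+3a)^2>0$, the origin of the planar system $$\dot{x}=xy^2-y^3+ax^5,\qquad \dot{y}=2x^7-x^4y+4xy^2+y^3$$ is a focus.
   Context: The parameter set $\Lambda=\{a\in\mathbb{R}:32-(1+3a)^2>0\}$ is one on which the origin is a monodromic singularity of the system, i.e. nearby orbits rotate around it, so that a Poincaré return map is defined on a small transversal section with endpoint at the origin. A monodromic singularity is a center if all nearby orbits are periodic orbits surrounding it (the Poincaré map is the identity), and a focus if nearby orbits spiral towards it in forward or in backward time. *)

(* Defs.v *)
From Stdlib Require Import Reals.
From Coquelicot Require Import Coquelicot.
Open Scope R_scope.

(* A planar system x' = P(x,y), y' = Q(x,y) is given by its two components
   P Q : R -> R -> R; all notions below concern its orbits near the origin. *)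

Definition in_interval (alpha beta : Rbar) (t : R) : Prop :=
  Rbar_lt alpha t /\ Rbar_lt t beta.

Definition is_solution (P Q : R -> R -> R) (alpha beta : Rbar)
    (x y : R -> R) : Prop :=
  forall t, in_interval alpha beta t ->
    is_derive x t (P (x t) (y t)) /\ is_derive y t (Q (x t) (y t)).

(* [theta] is a continuous determination of the polar angle along the plane
   curve (x, y), which in particular avoids the origin. *)
Definition is_polar_angle (alpha beta : Rbar) (x y theta : R -> R) : Prop :=
  forall t, in_interval alpha beta t ->
    continuous theta t /\
    exists rho, 0 < rho /\ x t = rho * cos (theta t) /\ y t = rho * sin (theta t).

(* The C^1 arc sigma(]0,eps[) has the origin as endpoint (s -> 0+) and is
   nowhere tangent to the field; Phi is its own polar angle, so that the
   section need not be straight. *)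
Definition is_transversal_section (P Q : R -> R -> R) (eps : R)
    (sigma1 sigma2 Phi : R -> R) : Prop :=
  0 < eps /\
  filterlim sigma1 (at_right 0) (locally 0) /\
  filterlim sigma2 (at_right 0) (locally 0) /\
  is_polar_angle 0 eps sigma1 sigma2 Phi /\
  (forall s u, 0 < s < eps -> 0 < u < eps ->
     sigma1 s = sigma1 u -> sigma2 s = sigma2 u -> s = u) /\
  (forall s, 0 < s < eps ->
     ex_derive sigma1 s /\ ex_derive sigma2 s /\
     continuous (Derive sigma1) s /\ continuous (Derive sigma2) s /\
     P (sigma1 s) (sigma2 s) * Derive sigma2 s
       - Q (sigma1 s) (sigma2 s) * Derive sigma1 s <> 0).

(* The orbit issued from sigma(s) makes its first return to the section at
   sigma(s'), after exactly one turn around the origin.  The turn is counted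
   by closing the orbit arc along the section, hence the comparison of
   [theta T] with [Phi s'].  Without it, the return map inside a homoclinic
   loop at the origin would also qualify. *)
Definition first_return (P Q : R -> R -> R) (eps : R)
    (sigma1 sigma2 Phi : R -> R) (s s' : R) : Prop :=
  exists (alpha beta : Rbar) (T : R) (x y theta : R -> R),
    0 < T /\ Rbar_lt alpha 0 /\ Rbar_lt T beta /\
    is_solution P Q alpha beta x y /\
    is_polar_angle alpha beta x y theta /\
    x 0 = sigma1 s /\ y 0 = sigma2 s /\ theta 0 = Phi s /\
    x T = sigma1 s' /\ y T = sigma2 s' /\
    (theta T = Phi s' + 2 * PI \/ theta T = Phi s' - 2 * PI) /\
    (forall t u, 0 < t < T -> 0 < u < eps ->
       ~ (x t = sigma1 u /\ y t = sigma2 u)).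

(* [Pi] is the Poincare return map; it extends continuously by Pi(0) = 0. *)
Definition is_monodromic (P Q : R -> R -> R) : Prop :=
  P 0 0 = 0 /\ Q 0 0 = 0 /\
  exists (eps : R) (sigma1 sigma2 Phi : R -> R),
    is_transversal_section P Q eps sigma1 sigma2 Phi /\
    exists (delta : R) (Pi : R -> R),
      0 < delta <= eps /\
      (forall s, 0 < s < delta ->
         0 < Pi s < eps /\ first_return P Q eps sigma1 sigma2 Phi s (Pi s)) /\
      filterlim Pi (at_right 0) (locally 0).

(* The orbit through (x0, y0), followed on ]alpha, beta[, tends to the origin
   and turns infinitely often around it as t -> e.  For locally Lipschitz P
   and Q the solution is unique, so that "there is a solution" speaks of the
   orbit through (x0, y0). *)
Definition spirals_to_origin (P Q : R -> R -> R) (alpha beta e : Rbar)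
    (x0 y0 : R) : Prop :=
  exists x y theta : R -> R,
    is_solution P Q alpha beta x y /\
    x 0 = x0 /\ y 0 = y0 /\
    is_polar_angle alpha beta x y theta /\
    is_lim x e 0 /\ is_lim y e 0 /\
    is_lim (fun t => Rabs (theta t)) e p_infty.

Definition spirals_forward (P Q : R -> R -> R) (x0 y0 : R) : Prop :=
  exists alpha : Rbar, Rbar_lt alpha 0 /\
    spirals_to_origin P Q alpha p_infty p_infty x0 y0.

Definition spirals_backward (P Q : R -> R -> R) (x0 y0 : R) : Prop :=
  exists beta : Rbar, Rbar_lt 0 beta /\
    spirals_to_origin P Q m_infty beta m_infty x0 y0.

Definition is_focus (P Q : R -> R -> R) : Prop :=
  is_monodromic P Q /\
  exists r : R, 0 < r /\
    ((forall x0 y0, 0 < x0 ^ 2 + y0 ^ 2 < r ^ 2 -> spirals_forward P Q x0 y0) \/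
     (forall x0 y0, 0 < x0 ^ 2 + y0 ^ 2 < r ^ 2 -> spirals_backward P Q x0 y0)).

(* Main.v *)
(* The Newton polygon of the field has two edges, of weights (1,1) and (1,3).  Along
   an orbit let [thA] and [thB] be the polar angles of (2x, y) and of
   (Delta x^3, 8y - (1+3a) x^3), where Delta^2 = 32 - (1+3a)^2.  Up to smaller terms,
     thA' = 2 y^2,   thB' = (Delta/2) x^4,   (ln sqrt(4x^2+y^2))' = y^2 + a x^4,
   and [thB - thA] is a single valued function near the origin.  Hence, for a suitable
   constant [gam], W = ln sqrt(4x^2+y^2) + gam (thB - thA) is a Lyapunov function as soon
   as a + Delta/4 <> 0.  The only remaining case is a = -31/25.  There, with gam = 1/2,
   the leading terms of W' cancel and W' ~ (1+3a)/4 x^3 y, which is compensated by a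
   multiple of (4x^2+y^2) M, where
     M = ln ((4y^2 - (1+3a) x^3 y + 2x^6) / (4x^2+y^2)^2).
   This leaves 2 (4x^2+y^2) M (y^2 + a x^4), up to a positive factor: M and y^2 + a x^4
   have the same sign except near y^2 = - a x^4, and there the derivative of a multiple
   of x^3 y / sqrt(x^4+y^2) makes up for it.
   In all cases (ln r)' is bounded by a multiple of (th + thB)', [th] being the polar
   angle.  So an orbit makes its next turn before its radius has changed by more than a
   bounded factor, and an orbit tending to the origin turns infinitely often. *)
Require Import Defs.
From Stdlib Require Import Reals Lra Lia ClassicalEpsilon.
From Coquelicot Require Import Coquelicot.
Open Scope R_scope.

(** * Global solutions of bounded Lipschitz systems *)

(** The two angles come from the leading parts on the two edges. On the edge (1,1) the field is
    [y^2 (x - y, 4 x + y)], which in the coordinates [(2x, y)] is, up to the factor [y^2], a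
    rotation at speed 2 with expansion at speed 1. On the edge (1,3) the ratio [u = y / x^3] obeys
    [u' = x^4 (4 u^2 - (1+3a) u + 2)], a quadratic of discriminant [-Delta^2]. Heuristically, each
    angle gains [2 PI] per turn while [ln r] gains 1/2 per radian of [thA] and [2 a / Delta] per
    radian of [thB], so a turn multiplies the radius by about
    [exp (4 PI / Delta * (a + Delta / 4))]; this is the origin of the case distinction. In the
    remaining case the sign is decided at the next order, where the sectors [y ~ x^2] between the
    two edges come into play. A focus is a statement about orbits, so these must be produced: the
    field is cut off to a bounded Lipschitz one, solved on the whole line, and the angle is obtained
    by integrating the angular velocity. *)

Lemma derive_dominated (h k : R -> R) (s t : R) :
  s <= t ->
  (forall u, s <= u <= t -> exists dh dk : R,
     is_derive h u dh /\ is_derive k u dk /\ Rabs dh <= dk) ->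
  Rabs (h t - h s) <= k t - k s.
Proof.
  intros hst hd.
  (* The mean value theorem for [k - e h], whose derivative is nonnegative for both signs [e],
     replaces any integration. *)
  assert (aux : forall e : R, e = 1 \/ e = -1 -> e * (h t - h s) <= k t - k s).
  { intros e he.
    destruct (Req_dec s t) as [<- | hne]; [lra |].
    destruct (MVT_gen (fun u => k u - e * h u) s t
                (fun u => Derive k u - e * Derive h u)) as [c [hc hm]].
    - intros u hu. rewrite Rmin_left, Rmax_right in hu by lra.
      destruct (hd u) as [dh [dk [h1 [h2 _]]]]; [lra |].
      rewrite (is_derive_unique _ _ _ h1), (is_derive_unique _ _ _ h2).
      apply (@is_derive_minus R_AbsRing R_NormedModule k (fun v => e * h v));
        [exact h2 | exact (is_derive_scal h u e dh h1)].
    - intros u hu. rewrite Rmin_left, Rmax_right in hu by lra.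
      destruct (hd u) as [dh [dk [h1 [h2 _]]]]; [lra |].
      apply continuity_pt_filterlim.
      apply (@ex_derive_continuous R_AbsRing R_NormedModule (fun u => k u - e * h u) u).
      exists (dk - e * dh).
      apply (@is_derive_minus R_AbsRing R_NormedModule k (fun v => e * h v));
        [exact h2 | exact (is_derive_scal h u e dh h1)].
    - rewrite Rmin_left, Rmax_right in hc by lra.
      destruct (hd c hc) as [dh [dk [h1 [h2 h3]]]].
      rewrite (is_derive_unique _ _ _ h1), (is_derive_unique _ _ _ h2) in hm.
      assert (0 <= dk - e * dh).
      { apply Rabs_le_between in h3. destruct he as [-> | ->]; lra. }
      assert (0 <= (dk - e * dh) * (t - s)) by (apply Rmult_le_pos; lra).
      lra. }
  apply Rabs_le. pose proof (aux 1 (or_introl eq_refl)).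
  pose proof (aux (-1) (or_intror eq_refl)). lra.
Qed.

Definition lipschitz (K : R) (f : R -> R) : Prop :=
  forall s t, Rabs (f s - f t) <= K * Rabs (s - t).

Lemma lipschitz_continuous (K : R) (f : R -> R) (t : R) :
  lipschitz K f -> continuous f t.
Proof.
  intros hf. apply filterlim_locally. intros eps.
  assert (hK : 0 < Rabs K + 1) by (pose proof (Rabs_pos K); lra).
  assert (hd : 0 < eps / (Rabs K + 1)) by (apply Rdiv_lt_0_compat; [apply cond_pos | lra]).
  exists (mkposreal _ hd). intros s hs.
  change (Rabs (s - t) < eps / (Rabs K + 1)) in hs.
  change (Rabs (f s - f t) < eps).
  apply Rle_lt_trans with (1 := hf s t).
  apply Rle_lt_trans with ((Rabs K + 1) * Rabs (s - t)).
  - apply Rmult_le_compat_r; [apply Rabs_pos |]. pose proof (Rle_abs K); lra.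
  - apply (Rmult_lt_compat_l _ _ _ hK) in hs.
    replace ((Rabs K + 1) * (eps / (Rabs K + 1))) with (eps : R) in hs by (field; lra).
    exact hs.
Qed.

Lemma derive_bounded_lipschitz (K : R) (f f' : R -> R) :
  (forall t, is_derive f t (f' t)) -> (forall t, Rabs (f' t) <= K) -> lipschitz K f.
Proof.
  intros hf hK.
  assert (aux : forall s t, s <= t -> Rabs (f t - f s) <= K * (t - s)).
  { intros s t hst. replace (K * (t - s)) with (K * t - K * s) by ring.
    apply (derive_dominated f (fun u => K * u)); [exact hst |].
    intros u _. exists (f' u), K. split; [apply hf | split; [| apply hK]].
    auto_derive; [trivial | ring]. }
  intros s t. destruct (Rle_dec s t) as [h | h].
  - rewrite Rabs_minus_sym, (Rabs_minus_sym s t), (Rabs_right (t - s)) by lra. apply aux; lra.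
  - rewrite (Rabs_right (s - t)) by lra. apply aux; lra.
Qed.

Lemma is_derive_primitive (f : R -> R) (c t : R) :
  (forall s, continuous f s) -> is_derive (fun u => c + RInt f 0 u) t (f t).
Proof.
  intros hf.
  replace (f t) with (0 + f t) by ring.
  apply (@is_derive_plus R_AbsRing R_NormedModule (fun _ => c) (RInt f 0)).
  - apply (@is_derive_const R_AbsRing R_NormedModule).
  - apply (is_derive_RInt f (RInt f 0) 0 t).
    + apply filter_forall. intros u. apply (@RInt_correct R_CompleteNormedModule),
        ex_RInt_continuous.
      intros; apply hf.
    + apply hf.
Qed.

Section Picard.

Variables (F G : R -> R -> R) (L B x0 y0 : R).
Hypothesis L_gt0 : 0 < L.
Hypothesis F_lip : forall x y x' y',
  Rabs (F x y - F x' y') <= L * (Rabs (x - x') + Rabs (y - y')).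
Hypothesis G_lip : forall x y x' y',
  Rabs (G x y - G x' y') <= L * (Rabs (x - x') + Rabs (y - y')).
Hypothesis F_bd : forall x y, Rabs (F x y) <= B.
Hypothesis G_bd : forall x y, Rabs (G x y) <= B.

Fixpoint picard (n : nat) : (R -> R) * (R -> R) :=
  match n with
  | O => (fun _ => x0, fun _ => y0)
  | S n => let (x, y) := picard n in
           (fun t => x0 + RInt (fun s => F (x s) (y s)) 0 t,
            fun t => y0 + RInt (fun s => G (x s) (y s)) 0 t)
  end.

Lemma lipschitz_comp2_continuous (H : R -> R -> R) (K : R) (x y : R -> R) (t : R) :
  (forall x y x' y', Rabs (H x y - H x' y') <= L * (Rabs (x - x') + Rabs (y - y'))) ->
  lipschitz K x -> lipschitz K y -> continuous (fun s => H (x s) (y s)) t.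
Proof.
  intros hH hx hy. apply lipschitz_continuous with (L * (K + K)).
  intros s u. apply Rle_trans with (1 := hH _ _ _ _).
  rewrite Rmult_assoc. apply Rmult_le_compat_l; [lra |].
  rewrite Rmult_plus_distr_r. apply Rplus_le_compat; auto.
Qed.

(** The bound on the field makes every iterate Lipschitz with the same constant [B]. This gives the
    continuity of the integrands at each stage, and it survives the passage to the limit. *)
Lemma picard_lipschitz (n : nat) :
  lipschitz B (fst (picard n)) /\ lipschitz B (snd (picard n)).
Proof.
  assert (hB : 0 <= B) by (apply Rle_trans with (2 := F_bd 0 0), Rabs_pos).
  induction n as [| n IH]; simpl.
  - split; intros s t; unfold Rminus at 1; rewrite Rplus_opp_r, Rabs_R0;
      apply Rmult_le_pos; auto using Rabs_pos.
  - destruct (picard n) as [x y]; simpl in *. destruct IH as [hx hy]. split.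
    + apply derive_bounded_lipschitz with (fun s => F (x s) (y s)); auto.
      intros t. apply (is_derive_primitive (fun s => F (x s) (y s))). intros s.
      apply (lipschitz_comp2_continuous F B); auto.
    + apply derive_bounded_lipschitz with (fun s => G (x s) (y s)); auto.
      intros t. apply (is_derive_primitive (fun s => G (x s) (y s))). intros s.
      apply (lipschitz_comp2_continuous G B); auto.
Qed.

Lemma picard_derive (n : nat) (t : R) :
  is_derive (fst (picard (S n))) t (F (fst (picard n) t) (snd (picard n) t)) /\
  is_derive (snd (picard (S n))) t (G (fst (picard n) t) (snd (picard n) t)).
Proof.
  pose proof (picard_lipschitz n) as h. simpl.
  destruct (picard n) as [x y]; simpl in *. destruct h as [hx hy]. split.
  - apply (is_derive_primitive (fun s => F (x s) (y s))). intros s.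
    apply (lipschitz_comp2_continuous F B); auto.
  - apply (is_derive_primitive (fun s => G (x s) (y s))). intros s.
    apply (lipschitz_comp2_continuous G B); auto.
Qed.

Lemma picard_0 (n : nat) : fst (picard n) 0 = x0 /\ snd (picard n) 0 = y0.
Proof.
  destruct n as [| n]; simpl; [auto |].
  destruct (picard n) as [x y]; simpl.
  rewrite !RInt_point. split; apply Rplus_0_r.
Qed.

(* Since [|w'| <= 4 L w], one integration of a function bounded by [w] gains the
   factor [1 / (4 L)]: in the norm weighted by [w], the Picard operator is a
   contraction on the whole line. *)
Let w (t : R) : R := exp (4 * L * t) + exp (- (4 * L * t)).

Lemma weight_ge1 (t : R) : 1 <= w t.
Proof.
  unfold w. destruct (Rle_dec 0 t) as [h | h].
  - assert (0 <= 4 * L * t) by (apply Rmult_le_pos; lra).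
    pose proof (exp_ineq1_le (4 * L * t)). pose proof (exp_pos (- (4 * L * t))). lra.
  - assert (0 <= 4 * L * - t) by (apply Rmult_le_pos; lra).
    pose proof (exp_ineq1_le (- (4 * L * t))). pose proof (exp_pos (4 * L * t)). lra.
Qed.

Lemma weight_contraction (h h' : R -> R) (C t : R) :
  0 <= C -> h 0 = 0 -> (forall s, is_derive h s (h' s)) ->
  (forall s, Rabs (h' s) <= 4 * L * C * w s) -> Rabs (h t) <= C * w t.
Proof.
  intros hC h0 hd hb.
  (* [k] is a hyperbolic sine with [k' = 4 L C w] and [k 0 = 0]; the weight [w] is the matching
     hyperbolic cosine, whence [|k| <= C w]. *)
  set (k := fun s => C * (exp (4 * L * s) - exp (- (4 * L * s)))).
  assert (hk : forall s, is_derive k s (4 * L * C * w s)).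
  { intros s. unfold k, w. auto_derive; [trivial | ring]. }
  assert (k0 : k 0 = 0) by (unfold k; rewrite Rmult_0_r, Ropp_0; ring).
  assert (hkw : Rabs (k t) <= C * w t).
  { unfold k, w. rewrite Rabs_mult, (Rabs_right C) by lra.
    apply Rmult_le_compat_l; [lra |].
    pose proof (exp_pos (4 * L * t)). pose proof (exp_pos (- (4 * L * t))).
    apply Rabs_le; lra. }
  apply Rle_trans with (2 := hkw).
  destruct (Rle_dec 0 t) as [ht | ht].
  - replace (h t) with (h t - h 0) by lra.
    apply Rle_trans with (k t - k 0); [| rewrite k0, Rminus_0_r; apply Rle_abs].
    apply derive_dominated; [lra |]. intros u _. exists (h' u), (4 * L * C * w u). auto.
  - replace (h t) with (- (h 0 - h t)) by lra. rewrite Rabs_Ropp.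
    apply Rle_trans with (k 0 - k t);
      [| rewrite k0; unfold Rminus; rewrite Rplus_0_l, <- Rabs_Ropp; apply Rle_abs].
    apply derive_dominated; [lra |]. intros u _. exists (h' u), (4 * L * C * w u). auto.
Qed.

Let dist (x y x' y' : R -> R) (t : R) := Rabs (x t - x' t) + Rabs (y t - y' t).

(** A distance [C w] gives derivatives within [L C w] of each other, one integration divides by
    [4 L], and the two components add up to the factor 1/2. Arbitrary primitives [X], [Y] are
    allowed because the estimate serves twice: between consecutive iterates, and between an iterate
    and the integral of the limit. *)
Lemma picard_step_close (C : R) (x y x' y' X Y X' Y' : R -> R) :
  0 <= C ->
  (forall t, is_derive X t (F (x t) (y t)) /\ is_derive Y t (G (x t) (y t))) ->
  (forall t, is_derive X' t (F (x' t) (y' t)) /\ is_derive Y' t (G (x' t) (y' t))) ->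
  X 0 = X' 0 -> Y 0 = Y' 0 ->
  (forall t, dist x y x' y' t <= C * w t) ->
  forall t, dist X Y X' Y' t <= C / 2 * w t.
Proof.
  intros hC h h' hX0 hY0 hd t. unfold dist in *.
  replace (C / 2 * w t) with (C / 4 * w t + C / 4 * w t) by field.
  apply Rplus_le_compat.
  - apply (weight_contraction (fun s => X s - X' s)
             (fun s => F (x s) (y s) - F (x' s) (y' s))); [lra | lra | |].
    + intros s. apply (@is_derive_minus R_AbsRing R_NormedModule X X'); [apply h | apply h'].
    + intros s. apply Rle_trans with (1 := F_lip _ _ _ _).
      replace (4 * L * (C / 4) * w s) with (L * (C * w s)) by field.
      apply Rmult_le_compat_l; [lra | apply hd].
  - apply (weight_contraction (fun s => Y s - Y' s)
             (fun s => G (x s) (y s) - G (x' s) (y' s))); [lra | lra | |].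
    + intros s. apply (@is_derive_minus R_AbsRing R_NormedModule Y Y'); [apply h | apply h'].
    + intros s. apply Rle_trans with (1 := G_lip _ _ _ _).
      replace (4 * L * (C / 4) * w s) with (L * (C * w s)) by field.
      apply Rmult_le_compat_l; [lra | apply hd].
Qed.

Lemma picard_close : exists C, 0 <= C /\ forall n m t, (n <= m)%nat ->
  dist (fst (picard n)) (snd (picard n)) (fst (picard m)) (snd (picard m)) t
    <= C * (1 / 2) ^ n * w t.
Proof.
  assert (hB : 0 <= B) by (apply Rle_trans with (2 := F_bd 0 0), Rabs_pos).
  (* The first step has derivatives bounded by [B <= B w], so each of its components is at most
     [B / (4 L) w], which is half of [c w]. *)
  set (c := B / (2 * L)).
  assert (hc : 0 <= c) by (apply Rmult_le_pos; [lra | left; apply Rinv_0_lt_compat; lra]).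
  assert (h1 : forall n t, dist (fst (picard n)) (snd (picard n))
                 (fst (picard (S n))) (snd (picard (S n))) t <= c * (1 / 2) ^ n * w t).
  { induction n as [| n IH]; intros t.
    - unfold dist. replace (c * (1 / 2) ^ 0 * w t) with (c / 2 * w t + c / 2 * w t)
        by (simpl; field).
      apply Rplus_le_compat.
      + apply (weight_contraction (fun s => x0 - fst (picard 1) s) (fun s => 0 - F x0 y0));
          [lra | rewrite (proj1 (picard_0 1)); ring | |].
        * intros s. apply (@is_derive_minus R_AbsRing R_NormedModule (fun _ => x0) (fst (picard
            1))).
          -- apply (@is_derive_const R_AbsRing R_NormedModule).
          -- apply (picard_derive 0).
        * intros s. unfold c. replace (4 * L * (B / (2 * L) / 2) * w s) with (B * w s)
            by (field; lra).
          rewrite Rminus_0_l, Rabs_Ropp. apply Rle_trans with (B * 1).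
          -- rewrite Rmult_1_r; apply F_bd.
          -- apply Rmult_le_compat_l; [lra | apply weight_ge1].
      + apply (weight_contraction (fun s => y0 - snd (picard 1) s) (fun s => 0 - G x0 y0));
          [lra | rewrite (proj2 (picard_0 1)); ring | |].
        * intros s. apply (@is_derive_minus R_AbsRing R_NormedModule (fun _ => y0) (snd (picard
            1))).
          -- apply (@is_derive_const R_AbsRing R_NormedModule).
          -- apply (picard_derive 0).
        * intros s. unfold c. replace (4 * L * (B / (2 * L) / 2) * w s) with (B * w s)
            by (field; lra).
          rewrite Rminus_0_l, Rabs_Ropp. apply Rle_trans with (B * 1).
          -- rewrite Rmult_1_r; apply G_bd.
          -- apply Rmult_le_compat_l; [lra | apply weight_ge1].
    - replace (c * (1 / 2) ^ S n) with (c * (1 / 2) ^ n / 2) by (simpl; field).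
      apply picard_step_close with (fst (picard n)) (snd (picard n))
        (fst (picard (S n))) (snd (picard (S n))).
      + apply Rmult_le_pos; [exact hc | apply pow_le; lra].
      + intros s; apply picard_derive.
      + intros s; apply picard_derive.
      + rewrite !(fun n => proj1 (picard_0 n)); reflexivity.
      + rewrite !(fun n => proj2 (picard_0 n)); reflexivity.
      + exact IH. }
  exists (2 * c). split; [lra |]. intros n m t hnm.
  replace m with (n + (m - n))%nat by lia. generalize (m - n)%nat as k.
  intros k. apply Rle_trans with (2 * c * ((1 / 2) ^ n - (1 / 2) ^ (n + k)) * w t).
  - induction k as [| k IH].
    + rewrite Nat.add_0_r. unfold dist.
      unfold Rminus. rewrite !Rplus_opp_r, Rabs_R0. lra.
    + replace (n + S k)%nat with (S (n + k)) by lia.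
      replace (2 * c * ((1 / 2) ^ n - (1 / 2) ^ S (n + k)) * w t) with
        (2 * c * ((1 / 2) ^ n - (1 / 2) ^ (n + k)) * w t + c * (1 / 2) ^ (n + k) * w t)
        by (simpl; field).
      apply Rle_trans with (2 := Rplus_le_compat _ _ _ _ IH (h1 (n + k)%nat t)).
      unfold dist.
      pose proof (Rabs_triang (fst (picard n) t - fst (picard (n + k)) t)
        (fst (picard (n + k)) t - fst (picard (S (n + k))) t)) as e1.
      pose proof (Rabs_triang (snd (picard n) t - snd (picard (n + k)) t)
        (snd (picard (n + k)) t - snd (picard (S (n + k))) t)) as e2.
      replace (fst (picard n) t - fst (picard (n + k)) t +
        (fst (picard (n + k)) t - fst (picard (S (n + k))) t)) with
        (fst (picard n) t - fst (picard (S (n + k))) t) in e1 by ring.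
      replace (snd (picard n) t - snd (picard (n + k)) t +
        (snd (picard (n + k)) t - snd (picard (S (n + k))) t)) with
        (snd (picard n) t - snd (picard (S (n + k))) t) in e2 by ring.
      lra.
  - apply Rmult_le_compat_r; [pose proof (weight_ge1 t); lra |].
    apply Rmult_le_compat_l; [lra |].
    assert (0 <= (1 / 2) ^ (n + k)) by (apply pow_le; lra). lra.
Qed.

Lemma geometric_small (C e : R) : 0 < e -> exists N, forall n, (N <= n)%nat -> C * (1 / 2) ^ n <
  e.
Proof.
  intros he.
  destruct (pow_lt_1_zero (1 / 2)) with (y := e / (Rabs C + 1)) as [N hN].
  - rewrite Rabs_right; lra.
  - apply Rdiv_lt_0_compat; [lra |]. pose proof (Rabs_pos C); lra.
  - exists N. intros n hn. specialize (hN n hn).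
    assert (hp : 0 < (1 / 2) ^ n) by (apply pow_lt; lra).
    rewrite Rabs_right in hN by lra.
    assert (hC : 0 < Rabs C + 1) by (pose proof (Rabs_pos C); lra).
    apply (Rmult_lt_compat_l _ _ _ hC) in hN.
    replace ((Rabs C + 1) * (e / (Rabs C + 1))) with e in hN by (field; lra).
    apply Rle_lt_trans with (2 := hN). apply Rmult_le_compat_r; [lra |].
    pose proof (Rle_abs C); lra.
Qed.

Lemma picard_limit : exists x y : R -> R, exists C : R, 0 <= C /\
  (forall n t, dist (fst (picard n)) (snd (picard n)) x y t <= C * (1 / 2) ^ n * w t).
Proof.
  destruct picard_close as [C [hC hc]].
  assert (cv : forall p : (R -> R) * (R -> R) -> R -> R,
    (forall n m t, (n <= m)%nat ->
       Rabs (p (picard n) t - p (picard m) t) <= C * (1 / 2) ^ n * w t) ->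
    forall t, exists l : R, is_lim_seq (fun n => p (picard n) t) l).
  { intros p hp t. apply ex_lim_seq_cauchy_corr. intros eps.
    destruct (geometric_small (C * w t) eps (cond_pos eps)) as [N hN].
    exists N.
    assert (aux : forall n m, (N <= n)%nat -> (n <= m)%nat ->
      Rabs (p (picard n) t - p (picard m) t) < eps).
    { intros n m hn hm. apply Rle_lt_trans with (1 := hp n m t hm).
      specialize (hN n hn). lra. }
    intros n m hn hm. destruct (Nat.le_ge_cases n m) as [h | h].
    - apply aux; assumption.
    - rewrite Rabs_minus_sym. apply aux; assumption. }
  assert (hx : forall n m t, (n <= m)%nat ->
    Rabs (fst (picard n) t - fst (picard m) t) <= C * (1 / 2) ^ n * w t).
  { intros n m t h. apply Rle_trans with (2 := hc n m t h). unfold dist.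
    pose proof (Rabs_pos (snd (picard n) t - snd (picard m) t)). lra. }
  assert (hy : forall n m t, (n <= m)%nat ->
    Rabs (snd (picard n) t - snd (picard m) t) <= C * (1 / 2) ^ n * w t).
  { intros n m t h. apply Rle_trans with (2 := hc n m t h). unfold dist.
    pose proof (Rabs_pos (fst (picard n) t - fst (picard m) t)). lra. }
  pose proof (cv fst hx) as cx. pose proof (cv snd hy) as cy.
  exists (fun t => real (Lim_seq (fun n => fst (picard n) t))).
  exists (fun t => real (Lim_seq (fun n => snd (picard n) t))).
  exists C. split; [exact hC |]. intros n t.
  destruct (cx t) as [lx hlx]. destruct (cy t) as [ly hly]. unfold dist.
  rewrite (is_lim_seq_unique _ _ hlx), (is_lim_seq_unique _ _ hly). simpl.
  apply (is_lim_seq_le_loc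
    (fun m => dist (fst (picard n)) (snd (picard n)) (fst (picard m)) (snd (picard m)) t)
    (fun _ => C * (1 / 2) ^ n * w t)
    (Rabs (fst (picard n) t - lx) + Rabs (snd (picard n) t - ly)) (C * (1 / 2) ^ n * w t)).
  - exists n. intros m hm. apply hc; exact hm.
  - unfold dist. apply is_lim_seq_plus'.
    + apply (is_lim_seq_abs _ (Finite _)). apply is_lim_seq_minus'; [apply is_lim_seq_const |
        exact hlx].
    + apply (is_lim_seq_abs _ (Finite _)). apply is_lim_seq_minus'; [apply is_lim_seq_const |
        exact hly].
  - apply is_lim_seq_const.
Qed.

(** The limit of the iterates is a priori only Lipschitz, but that suffices to integrate the field
    along it. The resulting [X], [Y] are differentiable, and since they too are within a multiple of
    [(1/2)^n] of the iterates, they coincide with the limit. *)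
Lemma global_solution : exists x y : R -> R, x 0 = x0 /\ y 0 = y0 /\
  forall t, is_derive x t (F (x t) (y t)) /\ is_derive y t (G (x t) (y t)).
Proof.
  destruct picard_limit as [x [y [C [hC hd]]]].
  assert (dx : forall n t, Rabs (fst (picard n) t - x t) <= C * w t * (1 / 2) ^ n).
  { intros n t. pose proof (hd n t) as h. unfold dist in h.
    pose proof (Rabs_pos (snd (picard n) t - y t)). lra. }
  assert (dy : forall n t, Rabs (snd (picard n) t - y t) <= C * w t * (1 / 2) ^ n).
  { intros n t. pose proof (hd n t) as h. unfold dist in h.
    pose proof (Rabs_pos (fst (picard n) t - x t)). lra. }
  assert (eq0 : forall u C', (forall n, Rabs u <= C' * (1 / 2) ^ n) -> u = 0).
  { intros u C' hu. destruct (Req_dec u 0) as [| hne]; [assumption |].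
    destruct (geometric_small C' (Rabs u) (Rabs_pos_lt _ hne)) as [N hN].
    specialize (hu N). specialize (hN N (Nat.le_refl N)). lra. }
  assert (lip : forall (p : (R -> R) * (R -> R) -> R -> R) (z : R -> R),
    (forall n, lipschitz B (p (picard n))) ->
    (forall n t, Rabs (p (picard n) t - z t) <= C * w t * (1 / 2) ^ n) -> lipschitz B z).
  { intros p z hp hz s t.
    destruct (Rle_dec (Rabs (z s - z t)) (B * Rabs (s - t))) as [h | h]; [exact h |].
    exfalso. set (e := Rabs (z s - z t) - B * Rabs (s - t)).
    destruct (geometric_small (C * w s + C * w t) e) as [N hN]; [unfold e; lra |].
    specialize (hN N (Nat.le_refl N)). unfold e in hN.
    pose proof (hp N s t) as h1. pose proof (hz N s) as h2. pose proof (hz N t) as h3.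
    rewrite Rabs_minus_sym in h2.
    pose proof (Rabs_triang (z s - p (picard N) s) (p (picard N) s - z t)) as t1.
    pose proof (Rabs_triang (p (picard N) s - p (picard N) t) (p (picard N) t - z t)) as t2.
    replace (z s - p (picard N) s + (p (picard N) s - z t)) with (z s - z t) in t1 by ring.
    replace (p (picard N) s - p (picard N) t + (p (picard N) t - z t)) with
      (p (picard N) s - z t) in t2 by ring.
    lra. }
  assert (lx : lipschitz B x) by (apply (lip fst); [intros n; apply picard_lipschitz | exact dx]).
  assert (ly : lipschitz B y) by (apply (lip snd); [intros n; apply picard_lipschitz | exact dy]).
  set (X := fun t => x0 + RInt (fun s => F (x s) (y s)) 0 t).
  set (Y := fun t => y0 + RInt (fun s => G (x s) (y s)) 0 t).
  assert (dXY : forall t, is_derive X t (F (x t) (y t)) /\ is_derive Y t (G (x t) (y t))).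
  { intros t. split.
    - apply (is_derive_primitive (fun s => F (x s) (y s))). intros s.
      apply (lipschitz_comp2_continuous F B); auto.
    - apply (is_derive_primitive (fun s => G (x s) (y s))). intros s.
      apply (lipschitz_comp2_continuous G B); auto. }
  assert (X0 : X 0 = x0) by (unfold X; rewrite RInt_point; apply Rplus_0_r).
  assert (Y0 : Y 0 = y0) by (unfold Y; rewrite RInt_point; apply Rplus_0_r).
  assert (fix_pt : forall n t, dist (fst (picard (S n))) (snd (picard (S n))) X Y t
                     <= C * (1 / 2) ^ n / 2 * w t).
  { intros n. apply picard_step_close with (fst (picard n)) (snd (picard n)) x y.
    - apply Rmult_le_pos; [exact hC | apply pow_le; lra].
    - intros s; apply picard_derive.
    - exact dXY.
    - rewrite (proj1 (picard_0 (S n))); congruence.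
    - rewrite (proj2 (picard_0 (S n))); congruence.
    - apply hd. }
  assert (xX : forall t, x t = X t).
  { intros t. apply Rminus_diag_uniq, eq0 with (C * w t). intros n.
    pose proof (dx (S n) t) as h1. pose proof (fix_pt n t) as h2. unfold dist in h2.
    pose proof (Rabs_pos (snd (picard (S n)) t - Y t)).
    rewrite Rabs_minus_sym in h1.
    pose proof (Rabs_triang (x t - fst (picard (S n)) t) (fst (picard (S n)) t - X t)) as h3.
    replace (x t - fst (picard (S n)) t + (fst (picard (S n)) t - X t)) with (x t - X t)
      in h3 by ring.
    replace (C * w t * (1 / 2) ^ S n) with (C * (1 / 2) ^ n / 2 * w t) in h1 by (simpl; field).
    lra. }
  assert (yY : forall t, y t = Y t).
  { intros t. apply Rminus_diag_uniq, eq0 with (C * w t). intros n.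
    pose proof (dy (S n) t) as h1. pose proof (fix_pt n t) as h2. unfold dist in h2.
    pose proof (Rabs_pos (fst (picard (S n)) t - X t)).
    rewrite Rabs_minus_sym in h1.
    pose proof (Rabs_triang (y t - snd (picard (S n)) t) (snd (picard (S n)) t - Y t)) as h3.
    replace (y t - snd (picard (S n)) t + (snd (picard (S n)) t - Y t)) with (y t - Y t)
      in h3 by ring.
    replace (C * w t * (1 / 2) ^ S n) with (C * (1 / 2) ^ n / 2 * w t) in h1 by (simpl; field).
    lra. }
  exists x, y. split; [| split]; [rewrite xX; exact X0 | rewrite yY; exact Y0 |].
  intros t. split.
  - apply is_derive_ext with (2 := proj1 (dXY t)). intros s; symmetry; apply xX.
  - apply is_derive_ext with (2 := proj2 (dXY t)). intros s; symmetry; apply yY.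
Qed.

End Picard.

(** * Trajectories and their polar angle *)

Lemma is_derive_continuous (f : R -> R) (t l : R) : is_derive f t l -> continuous f t.
Proof.
  intros h. apply (@ex_derive_continuous R_AbsRing R_NormedModule f t). exists l; exact h.
Qed.

Lemma continuous_delta (h : R -> R) (t e : R) :
  continuous h t -> 0 < e ->
  exists d, 0 < d /\ forall s, Rabs (s - t) < d -> Rabs (h s - h t) < e.
Proof.
  intros hc he.
  destruct (proj1 (filterlim_locally h (h t)) hc (mkposreal e he)) as [d hd].
  exists d. split; [apply cond_pos |]. intros s hs. apply (hd s hs).
Qed.

(** The exit time is the supremum of the times up to which [h] stays below [c]; continuity rules out
    [h > c] there, and [h < c] is possible only at [T] itself. *)
Lemma first_exit (h : R -> R) (c T : R) :
  (forall t, continuous h t) -> h 0 < c -> 0 <= T ->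
  (forall t, 0 <= t <= T -> h t < c) \/
  exists t1, 0 < t1 <= T /\ h t1 = c /\ forall u, 0 <= u < t1 -> h u < c.
Proof.
  intros hc h0 hT.
  set (A := fun t => 0 <= t <= T /\ forall u, 0 <= u <= t -> h u < c).
  assert (A0 : A 0).
  { split; [lra |]. intros u hu. replace u with 0 by lra. exact h0. }
  destruct (completeness A) as [m [hub hlub]].
  - exists T. intros t [ht _]; lra.
  - exists 0; exact A0.
  - assert (hm0 : 0 <= m) by (apply hub; exact A0).
    assert (hmT : m <= T) by (apply hlub; intros t [ht _]; lra).
    assert (below : forall u, 0 <= u < m -> h u < c).
    { intros u hu. destruct (Rlt_dec (h u) c) as [| hn]; [assumption | exfalso].
      assert (m <= u); [| lra]. apply hlub. intros t [ht hAt].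
      destruct (Rle_dec t u); [assumption |]. exfalso. apply hn, hAt; lra. }
    destruct (Rtotal_order (h m) c) as [hlt | [heq | hgt]].
    + left. destruct (continuous_delta h m (c - h m) (hc m)) as [d [hd hdm]]; [lra |].
      assert (near : forall u, 0 <= u < m + d -> h u < c).
      { intros u hu. destruct (Rlt_dec u m) as [hum | hum]; [apply below; lra |].
        assert (hu' : Rabs (u - m) < d) by (rewrite Rabs_right; lra).
        specialize (hdm u hu'). apply Rabs_def2 in hdm. lra. }
      destruct (Rlt_dec T (m + d)) as [hTd | hTd].
      * intros t ht. apply near; lra.
      * exfalso. assert (A (m + d / 2)).
        { split; [lra |]. intros u hu. apply near; lra. }
        pose proof (hub _ H). lra.
    + right. exists m. split; [| split; [exact heq | exact below]].
      destruct (Req_dec m 0) as [h1 | h1]; [| lra]. rewrite h1 in heq; lra.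
    + exfalso. destruct (continuous_delta h m (h m - c) (hc m)) as [d [hd hdm]]; [lra |].
      assert (hm : 0 < m).
      { destruct (Req_dec m 0) as [h1 | h1]; [| lra]. rewrite h1 in hgt; lra. }
      set (u := Rmax 0 (m - d / 2)).
      assert (hu : 0 <= u < m /\ m - u < d).
      { unfold u. apply Rmax_case_strong; lra. }
      pose proof (below u (proj1 hu)).
      assert (hu' : Rabs (u - m) < d) by (rewrite Rabs_left; lra).
      specialize (hdm u hu'). apply Rabs_def2 in hdm. lra.
Qed.

Lemma derive_nonneg_le (k k' : R -> R) (s t : R) :
  s <= t -> (forall u, s <= u <= t -> is_derive k u (k' u) /\ 0 <= k' u) -> k s <= k t.
Proof.
  intros hst hk.
  assert (h : Rabs (0 - 0) <= k t - k s).
  { apply (derive_dominated (fun _ => 0)); [exact hst |]. intros u hu.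
    exists 0, (k' u). split; [| split].
    - apply (@is_derive_const R_AbsRing R_NormedModule).
    - apply hk; exact hu.
    - rewrite Rabs_R0. apply hk; exact hu. }
  pose proof (Rabs_pos (0 - 0)). lra.
Qed.

Lemma derive_zero_const (f : R -> R) :
  (forall t, is_derive f t 0) -> forall t, f t = f 0.
Proof.
  intros hf.
  assert (aux : forall s t, s <= t -> f t = f s).
  { intros s t hst.
    assert (h : Rabs (f t - f s) <= 0 - 0).
    { apply (derive_dominated f (fun _ => 0)); [exact hst |]. intros u _.
      exists 0, 0. split; [apply hf | split].
      - apply (@is_derive_const R_AbsRing R_NormedModule).
      - rewrite Rabs_R0; lra. }
    pose proof (Rabs_pos (f t - f s)).
    destruct (Req_dec (f t - f s) 0) as [| hne]; [lra |].
    pose proof (Rabs_pos_lt _ hne). lra. }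
  intros t. destruct (Rle_dec 0 t); [apply aux; assumption | symmetry; apply aux; lra].
Qed.

Lemma polar_angle_exists (x y : R) : 0 < x ^ 2 + y ^ 2 ->
  exists theta, x = sqrt (x ^ 2 + y ^ 2) * cos theta /\ y = sqrt (x ^ 2 + y ^ 2) * sin theta.
Proof.
  intros hg. set (r := sqrt (x ^ 2 + y ^ 2)).
  assert (hr : 0 < r) by (apply sqrt_lt_R0; exact hg).
  assert (hr2 : r * r = x ^ 2 + y ^ 2) by (apply sqrt_sqrt; lra).
  assert (hc : -1 <= x / r <= 1).
  { assert (-r <= x <= r) by (split; nra). split.
    - apply Rmult_le_reg_r with r; [lra |]. unfold Rdiv.
      rewrite Rmult_assoc, Rinv_l; lra.
    - apply Rmult_le_reg_r with r; [lra |]. unfold Rdiv.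
      rewrite Rmult_assoc, Rinv_l; lra. }
  assert (hs : r * sqrt (1 - Rsqr (x / r)) = Rabs y).
  { rewrite <- (Rabs_right r) at 1 by lra. rewrite <- sqrt_Rsqr_abs.
    rewrite <- sqrt_mult_alt by apply Rle_0_sqr. rewrite <- sqrt_Rsqr_abs. f_equal.
    unfold Rsqr. field_simplify; [| lra]. nra. }
  destruct (Rle_dec 0 y) as [hy | hy].
  - exists (acos (x / r)). rewrite cos_acos, sin_acos by exact hc. split.
    + field; lra.
    + rewrite hs, Rabs_right; lra.
  - exists (- acos (x / r)). rewrite cos_neg, sin_neg, cos_acos, sin_acos by exact hc. split.
    + field; lra.
    + rewrite <- Ropp_mult_distr_r, hs, Rabs_left; lra.
Qed.

(** The angle is defined as the integral of the angular velocity, which makes it differentiable for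
    free. That it is a polar angle follows by turning the unit vector back by [theta]: the result
    [(u, v)] has zero derivative and starts at [(1, 0)]. *)
Lemma polar_angle_along (x y x' y' : R -> R) (theta0 : R) :
  (forall t, is_derive x t (x' t)) -> (forall t, is_derive y t (y' t)) ->
  (forall t, continuous x' t) -> (forall t, continuous y' t) ->
  (forall t, 0 < x t ^ 2 + y t ^ 2) ->
  x 0 = sqrt (x 0 ^ 2 + y 0 ^ 2) * cos theta0 ->
  y 0 = sqrt (x 0 ^ 2 + y 0 ^ 2) * sin theta0 ->
  exists theta : R -> R, theta 0 = theta0 /\
    (forall t, is_derive theta t ((x t * y' t - y t * x' t) / (x t ^ 2 + y t ^ 2))) /\
    (forall t, x t = sqrt (x t ^ 2 + y t ^ 2) * cos (theta t) /\
               y t = sqrt (x t ^ 2 + y t ^ 2) * sin (theta t)).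
Proof.
  intros hx hy cx' cy' hg x0 y0.
  set (om := fun t => (x t * y' t - y t * x' t) / (x t ^ 2 + y t ^ 2)).
  assert (cx : forall t, continuous x t) by (intros t; apply is_derive_continuous with (x' t),
    hx).
  assert (cy : forall t, continuous y t) by (intros t; apply is_derive_continuous with (y' t),
    hy).
  assert (com : forall t, continuous om t).
  { intros t. unfold om, Rdiv. apply (continuous_mult (K := R_AbsRing)).
    - apply (continuous_minus (fun t => x t * y' t) (fun t => y t * x' t));
        apply (continuous_mult (K := R_AbsRing)); auto.
    - apply continuous_Rinv_comp; [| apply Rgt_not_eq, hg].
      apply (continuous_plus (fun t => x t ^ 2) (fun t => y t ^ 2)).
      + apply (continuous_ext (fun t => x t * x t)); [intros; simpl; ring |].
        apply (continuous_mult (K := R_AbsRing)); auto.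
      + apply (continuous_ext (fun t => y t * y t)); [intros; simpl; ring |].
        apply (continuous_mult (K := R_AbsRing)); auto. }
  set (theta := fun t => theta0 + RInt om 0 t).
  assert (hth : forall t, is_derive theta t (om t)).
  { intros t. apply (is_derive_primitive om); exact com. }
  assert (th0 : theta 0 = theta0) by (unfold theta; rewrite RInt_point; apply Rplus_0_r).
  exists theta. split; [exact th0 | split; [exact hth |]].
  set (u := fun t => (x t * cos (theta t) + y t * sin (theta t)) / sqrt (x t ^ 2 + y t ^ 2)).
  set (v := fun t => (y t * cos (theta t) - x t * sin (theta t)) / sqrt (x t ^ 2 + y t ^ 2)).
  assert (hsq : forall t, sqrt (x t ^ 2 + y t ^ 2) <> 0).
  { intros t. apply Rgt_not_eq, sqrt_lt_R0, hg. }
  assert (hsq2 : forall t, sqrt (x t ^ 2 + y t ^ 2) ^ 2 = x t ^ 2 + y t ^ 2).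
  { intros t. apply pow2_sqrt. left; apply hg. }
  assert (du : forall t, is_derive u t 0).
  { intros t. pose proof (hx t) as h1; pose proof (hy t) as h2; pose proof (hth t) as h3.
    unfold u. auto_derive.
    - repeat split; try (eexists; eassumption); try apply hsq.
      simpl; rewrite !Rmult_1_r. specialize (hg t). simpl in hg; rewrite !Rmult_1_r in hg; exact
        hg.
    - change (fun s => x s) with x. change (fun s => y s) with y. change (fun s => theta s) with
        theta.
      rewrite (is_derive_unique _ _ _ h1), (is_derive_unique _ _ _ h2), (is_derive_unique _ _ _
        h3).
      unfold om.
      replace (x t * (x t * 1) + y t * (y t * 1)) with (x t ^ 2 + y t ^ 2) by ring.
      pose proof (hsq t) as hs. pose proof (hsq2 t) as hs2.
      set (s := sqrt (x t ^ 2 + y t ^ 2)) in *.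
      rewrite <- hs2.
      transitivity (((x' t * cos (theta t) + y' t * sin (theta t)) * s ^ 2
        + (x t * y' t - y t * x' t) * (y t * cos (theta t) - x t * sin (theta t))
        - (x t * cos (theta t) + y t * sin (theta t)) * (x t * x' t + y t * y' t)) / s ^ 3).
      + field; exact hs.
      + rewrite hs2. field; exact hs. }
  assert (dv : forall t, is_derive v t 0).
  { intros t. pose proof (hx t) as h1; pose proof (hy t) as h2; pose proof (hth t) as h3.
    unfold v. auto_derive.
    - repeat split; try (eexists; eassumption); try apply hsq.
      simpl; rewrite !Rmult_1_r. specialize (hg t). simpl in hg; rewrite !Rmult_1_r in hg; exact
        hg.
    - change (fun s => x s) with x. change (fun s => y s) with y. change (fun s => theta s) with
        theta.
      rewrite (is_derive_unique _ _ _ h1), (is_derive_unique _ _ _ h2), (is_derive_unique _ _ _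
        h3).
      unfold om.
      replace (x t * (x t * 1) + y t * (y t * 1)) with (x t ^ 2 + y t ^ 2) by ring.
      pose proof (hsq t) as hs. pose proof (hsq2 t) as hs2.
      set (s := sqrt (x t ^ 2 + y t ^ 2)) in *.
      rewrite <- hs2.
      transitivity (((y' t * cos (theta t) - x' t * sin (theta t)) * s ^ 2
        - (x t * y' t - y t * x' t) * (x t * cos (theta t) + y t * sin (theta t))
        - (y t * cos (theta t) - x t * sin (theta t)) * (x t * x' t + y t * y' t)) / s ^ 3).
      + field; exact hs.
      + rewrite hs2. field; exact hs. }
  assert (cs : forall z, cos z * cos z + sin z * sin z = 1).
  { intros z. pose proof (sin2_cos2 z) as h. unfold Rsqr in h. lra. }
  assert (hu : forall t, u t = 1).
  { intros t. rewrite (derive_zero_const u du t). unfold u. rewrite th0.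
    pose proof (hsq 0) as hs.
    set (s := sqrt (x 0 ^ 2 + y 0 ^ 2)) in *. rewrite x0, y0.
    transitivity (cos theta0 * cos theta0 + sin theta0 * sin theta0); [field; exact hs | apply
      cs]. }
  assert (hv : forall t, v t = 0).
  { intros t. rewrite (derive_zero_const v dv t). unfold v. rewrite th0.
    pose proof (hsq 0) as hs.
    set (s := sqrt (x 0 ^ 2 + y 0 ^ 2)) in *. rewrite x0, y0. field; exact hs. }
  intros t. specialize (hu t). specialize (hv t). unfold u in hu. unfold v in hv.
  pose proof (hsq t) as hs. set (s := sqrt (x t ^ 2 + y t ^ 2)) in *.
  assert (hu' : x t * cos (theta t) + y t * sin (theta t) = s).
  { rewrite <- (Rmult_1_l s), <- hu. field; exact hs. }
  assert (hv' : y t * cos (theta t) - x t * sin (theta t) = 0).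
  { rewrite <- (Rmult_0_l s), <- hv. field; exact hs. }
  pose proof (cs (theta t)) as hcs.
  split.
  - rewrite <- hu'. transitivity (x t * (cos (theta t) * cos (theta t) + sin (theta t) * sin
      (theta t))
      + (y t * cos (theta t) - x t * sin (theta t)) * sin (theta t)).
    + rewrite hcs, hv'; ring.
    + ring.
  - rewrite <- hu'. transitivity (y t * (cos (theta t) * cos (theta t) + sin (theta t) * sin
      (theta t))
      - (y t * cos (theta t) - x t * sin (theta t)) * cos (theta t)).
    + rewrite hcs, hv'; ring.
    + ring.
Qed.

Definition clip (u : R) : R := Rmax (-1) (Rmin u 1).

Lemma clip_bound (u : R) : -1 <= clip u <= 1.
Proof. unfold clip, Rmax, Rmin. repeat destruct Rle_dec; lra. Qed.

Lemma clip_id (u : R) : -1 <= u <= 1 -> clip u = u.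
Proof. intros h. unfold clip, Rmax, Rmin. repeat destruct Rle_dec; lra. Qed.

Lemma clip_lipschitz (u v : R) : Rabs (clip u - clip v) <= Rabs (u - v).
Proof.
  unfold clip, Rmax, Rmin. unfold Rabs.
  repeat destruct Rle_dec; repeat destruct Rcase_abs; lra.
Qed.

Definition box_lipschitz (L : R) (P : R -> R -> R) : Prop :=
  forall x y x' y', -1 <= x <= 1 -> -1 <= y <= 1 -> -1 <= x' <= 1 -> -1 <= y' <= 1 ->
  Rabs (P x y - P x' y') <= L * (Rabs (x - x') + Rabs (y - y')).

(** Gronwall in both time directions: the squared norm times [exp (K t)] is nondecreasing, and times
    [exp (- K t)] nonincreasing. So an orbit never reaches the origin in finite time and its polar
    angle is always defined. *)
Lemma norm2_lower_bound (x y x' y' : R -> R) (K : R) :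
  (forall t, is_derive x t (x' t)) -> (forall t, is_derive y t (y' t)) ->
  (forall t, Rabs (2 * (x t * x' t + y t * y' t)) <= K * (x t ^ 2 + y t ^ 2)) ->
  0 < x 0 ^ 2 + y 0 ^ 2 -> forall t, 0 < x t ^ 2 + y t ^ 2.
Proof.
  intros hx hy hK h0.
  set (k := fun e t => (x t ^ 2 + y t ^ 2) * exp (e * K * t)).
  assert (hd : forall e t, is_derive (k e) t
    ((2 * (x t * x' t + y t * y' t) + e * (K * (x t ^ 2 + y t ^ 2))) * exp (e * K * t))).
  { intros e t. pose proof (hx t) as h1; pose proof (hy t) as h2. unfold k. auto_derive.
    - repeat split; eexists; eassumption.
    - change (fun s => x s) with x. change (fun s => y s) with y.
      rewrite (is_derive_unique _ _ _ h1), (is_derive_unique _ _ _ h2). ring. }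
  intros t. destruct (Rle_dec 0 t) as [ht | ht].
  - assert (h : k 1 0 <= k 1 t).
    { eapply derive_nonneg_le; [exact ht |]. intros u _. split; [apply hd |].
      apply Rmult_le_pos; [| left; apply exp_pos].
      specialize (hK u). apply Rabs_le_between in hK. lra. }
    unfold k in h. rewrite Rmult_0_r, exp_0, Rmult_1_r in h.
    pose proof (exp_pos (1 * K * t)). nra.
  - assert (h : - k (-1) t <= - k (-1) 0).
    { eapply (derive_nonneg_le (fun s => - k (-1) s)); [lra |]. intros u _. split.
      - apply (@is_derive_opp R_AbsRing R_NormedModule), hd.
      - change (0 <= - ((2 * (x u * x' u + y u * y' u) + -1 * (K * (x u ^ 2 + y u ^ 2)))
                        * exp (-1 * K * u))).
        rewrite Ropp_mult_distr_l.
        apply Rmult_le_pos; [| left; apply exp_pos].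
        specialize (hK u). apply Rabs_le_between in hK. lra. }
    unfold k in h. rewrite Rmult_0_r, exp_0, Rmult_1_r in h.
    pose proof (exp_pos (-1 * K * t)). nra.
Qed.

Definition norm2 (x y : R) : R := x ^ 2 + y ^ 2.

(* A solution that is followed for all times by cutting the field off outside the
   box [-1, 1]^2; it obeys [P] and [Q] as long as it stays in the unit disc. *)
Definition trajectory (P Q : R -> R -> R) (x y theta : R -> R) : Prop :=
  forall t, 0 < norm2 (x t) (y t) /\
    continuous x t /\ continuous y t /\ continuous theta t /\
    x t = sqrt (norm2 (x t) (y t)) * cos (theta t) /\
    y t = sqrt (norm2 (x t) (y t)) * sin (theta t) /\
    (norm2 (x t) (y t) <= 1 ->
       is_derive x t (P (x t) (y t)) /\ is_derive y t (Q (x t) (y t)) /\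
       is_derive theta t
         ((x t * Q (x t) (y t) - y t * P (x t) (y t)) / norm2 (x t) (y t))).

Lemma trajectory_exists (P Q : R -> R -> R) (L x0 y0 theta0 : R) :
  0 < L -> box_lipschitz L P -> box_lipschitz L Q -> P 0 0 = 0 -> Q 0 0 = 0 ->
  0 < norm2 x0 y0 ->
  x0 = sqrt (norm2 x0 y0) * cos theta0 -> y0 = sqrt (norm2 x0 y0) * sin theta0 ->
  exists x y theta, x 0 = x0 /\ y 0 = y0 /\ theta 0 = theta0 /\ trajectory P Q x y theta.
Proof.
  intros hL lP lQ P0 Q0 h0 hx0 hy0.
  set (cut := fun (H : R -> R -> R) x y => H (clip x) (clip y)).
  assert (lip : forall H, box_lipschitz L H -> forall x y x' y',
    Rabs (cut H x y - cut H x' y') <= L * (Rabs (x - x') + Rabs (y - y'))).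
  { intros H hH x y x' y'. unfold cut.
    apply Rle_trans with (1 := hH _ _ _ _ (clip_bound x) (clip_bound y) (clip_bound x')
      (clip_bound y')).
    apply Rmult_le_compat_l; [lra |]. apply Rplus_le_compat; apply clip_lipschitz. }
  assert (lin : forall H, box_lipschitz L H -> H 0 0 = 0 -> forall x y,
    Rabs (cut H x y) <= L * (Rabs x + Rabs y)).
  { intros H hH H0 x y. pose proof (lip H hH x y 0 0) as h.
    replace (cut H x y) with (cut H x y - cut H 0 0) by (unfold cut; rewrite !(clip_id 0) by
      lra; lra).
    rewrite !Rminus_0_r in h. exact h. }
  assert (bd : forall H, box_lipschitz L H -> H 0 0 = 0 -> forall x y, Rabs (cut H x y) <= 2 * L).
  { intros H hH H0 x y. pose proof (lin H hH H0 (clip x) (clip y)) as h.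
    unfold cut in *. rewrite !(clip_id (clip _)) in h by apply clip_bound.
    apply Rle_trans with (1 := h). replace (2 * L) with (L * (1 + 1)) by ring.
    apply Rmult_le_compat_l; [lra |].
    pose proof (clip_bound x); pose proof (clip_bound y).
    apply Rplus_le_compat; apply Rabs_le; lra. }
  destruct (global_solution (cut P) (cut Q) L (2 * L) x0 y0) as [x [y [ex [ey hd]]]]; auto.
  assert (cx : forall t, continuous x t).
  { intros t; apply is_derive_continuous with (1 := proj1 (hd t)). }
  assert (cy : forall t, continuous y t).
  { intros t; apply is_derive_continuous with (1 := proj2 (hd t)). }
  assert (hg : forall t, 0 < norm2 (x t) (y t)).
  (* The cut-off field is at most [L (|x| + |y|)], and [2 L (|x| + |y|)^2 <= 4 L (x^2 + y^2)]. *)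
  { apply (norm2_lower_bound x y (fun t => cut P (x t) (y t)) (fun t => cut Q (x t) (y t)) (4 *
      L)).
    - intros t; apply hd.
    - intros t; apply hd.
    - intros t. rewrite Rabs_mult, (Rabs_right 2) by lra.
      pose proof (Rabs_triang (x t * cut P (x t) (y t)) (y t * cut Q (x t) (y t))) as h1.
      rewrite !Rabs_mult in h1.
      pose proof (lin P lP P0 (x t) (y t)) as h2. pose proof (lin Q lQ Q0 (x t) (y t)) as h3.
      rewrite <- (pow2_abs (x t)), <- (pow2_abs (y t)).
      pose proof (Rabs_pos (x t)) as px. pose proof (Rabs_pos (y t)) as py.
      pose proof (Rmult_le_compat_l _ _ _ px h2). pose proof (Rmult_le_compat_l _ _ _ py h3).
      set (u := Rabs (x t)) in *. set (v := Rabs (y t)) in *.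
      assert (0 <= L * (u - v) ^ 2) by (apply Rmult_le_pos; [lra | apply pow2_ge_0]).
      lra.
    - rewrite ex, ey; exact h0. }
  assert (cont : forall H, box_lipschitz L H -> forall t, continuous (fun s => cut H (x s) (y
    s)) t).
  { intros H hH t. apply (lipschitz_comp2_continuous L hL (cut H) (2 * L)); [apply lip, hH | |].
    - apply derive_bounded_lipschitz with (fun s => cut P (x s) (y s)).
      + intros s; apply hd.
      + intros s; apply bd; assumption.
    - apply derive_bounded_lipschitz with (fun s => cut Q (x s) (y s)).
      + intros s; apply hd.
      + intros s; apply bd; assumption. }
  destruct (polar_angle_along x y (fun t => cut P (x t) (y t)) (fun t => cut Q (x t) (y t))
    theta0)
    as [theta [th0 [hth hpol]]].
  - intros t; apply hd.
  - intros t; apply hd.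
  - apply cont; exact lP.
  - apply cont; exact lQ.
  - exact hg.
  - rewrite ex, ey; exact hx0.
  - rewrite ex, ey; exact hy0.
  - exists x, y, theta. do 3 (split; [assumption |]). intros t.
    split; [apply hg |]. split; [apply cx |]. split; [apply cy |].
    split; [apply is_derive_continuous with (1 := hth t) |].
    split; [apply hpol |]. split; [apply hpol |]. intros hle. unfold norm2 in hle.
    assert (hxb : -1 <= x t <= 1) by (split; nra).
    assert (hyb : -1 <= y t <= 1) by (split; nra).
    pose proof (hd t) as [h1 h2]. pose proof (hth t) as h3. unfold cut in h1, h2, h3.
    rewrite (clip_id _ hxb), (clip_id _ hyb) in h1, h2, h3. auto.
Qed.

(** * Lyapunov functions and foci *)

(** [U'] is the derivative of [U] along the field, expressed through curves so that no partial
    derivatives or two-variable chain rule are involved. The factor [s] lets the same fact serve the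
    time-reversed field. *)
Definition orbital_derivative (P Q : R -> R -> R) (rho : R) (U U' : R -> R -> R) : Prop :=
  forall s x y t,
    is_derive x t (s * P (x t) (y t)) -> is_derive y t (s * Q (x t) (y t)) ->
    0 < norm2 (x t) (y t) < rho ->
    is_derive (fun u => U (x u) (y u)) t (s * U' (x t) (y t)).

Lemma continuous_norm2 (x y : R -> R) (t : R) :
  continuous x t -> continuous y t -> continuous (fun u => norm2 (x u) (y u)) t.
Proof.
  intros hx hy.
  apply (continuous_ext (fun u => plus (mult (x u) (x u)) (mult (y u) (y u)))).
  - intros u. unfold plus, mult; simpl. unfold norm2. ring.
  - apply (continuous_plus (fun u => mult (x u) (x u))); apply (continuous_mult (K :=
      R_AbsRing)); auto.
Qed.

Lemma orbital_derivative_ln_norm2 (P Q : R -> R -> R) (rho : R) :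
  orbital_derivative P Q rho (fun x y => ln (norm2 x y))
    (fun x y => 2 * (x * P x y + y * Q x y) / norm2 x y).
Proof.
  intros s x y t hx hy [hg _]. unfold norm2 in *.
  apply (is_derive_ext (fun u => ln (x u * x u + y u * y u))).
  { intros u; f_equal; ring. }
  auto_derive.
  - repeat split; try (eexists; eassumption). simpl in hg; lra.
  - change (fun u => x u) with x. change (fun u => y u) with y.
    rewrite (is_derive_unique _ _ _ hx), (is_derive_unique _ _ _ hy). field. lra.
Qed.

Lemma is_derive_eq (f : R -> R) (t l l' : R) : is_derive f t l -> l = l' -> is_derive f t l'.
Proof. intros h <-; exact h. Qed.

Lemma exp_gt_1 (z : R) : 0 < z -> 1 < exp z.
Proof. intros hz. pose proof (exp_ineq1_le z). lra. Qed.

Lemma ln_le_exp (u z : R) : 0 < u -> ln u <= z -> u <= exp z.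
Proof.
  intros hu h. rewrite <- (exp_ln u hu).
  destruct h as [h | ->]; [left; apply exp_increasing; exact h | lra].
Qed.

Lemma ln_ge_exp (u z : R) : 0 < u -> z <= ln u -> exp z <= u.
Proof.
  intros hu h. rewrite <- (exp_ln u hu).
  destruct h as [h | ->]; [left; apply exp_increasing; exact h | lra].
Qed.

Section Focus.

Variables (P Q D D' W W' : R -> R -> R) (L rho kappa c C CD CW : R).
Hypothesis L_gt0 : 0 < L.
Hypothesis P_lip : box_lipschitz L P.
Hypothesis Q_lip : box_lipschitz L Q.
Hypothesis P_0 : P 0 0 = 0.
Hypothesis Q_0 : Q 0 0 = 0.
Hypothesis rho_bounds : 0 < rho <= 1.
Hypothesis kappa_gt0 : 0 < kappa.
Hypothesis rotation : forall x y, 0 < norm2 x y < rho ->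
  kappa * norm2 x y ^ 4 <= x * Q x y - y * P x y.
Hypothesis D_bounded : forall x y, 0 < norm2 x y < rho -> Rabs (D x y) <= CD.
Hypothesis D_orbital : orbital_derivative P Q rho D D'.
Hypothesis C_gt0 : 0 < C.
Hypothesis radial_le : forall x y, 0 < norm2 x y < rho ->
  Rabs (2 * (x * P x y + y * Q x y) / norm2 x y) <=
    C * (2 * ((x * Q x y - y * P x y) / norm2 x y) + D' x y).

(** [2 theta + D] stands for the sum of the two angles [theta] and [theta + D], whose speed
    dominates the radial speed. As [D] is bounded, the logarithm of the radius cannot move much
    without the orbit turning. For [s = -1] the orbit turns the other way, hence the sign in front
    of the angles. *)
Lemma log_norm2_control (s : R) (x y theta : R -> R) (t : R) :
  s * s = 1 -> trajectory (fun x y => s * P x y) (fun x y => s * Q x y) x y theta -> 0 <= t ->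
  (forall u, 0 <= u <= t -> norm2 (x u) (y u) < rho) ->
  Rabs (ln (norm2 (x t) (y t)) - ln (norm2 (x 0) (y 0))) <=
    C * (s * (2 * theta t + D (x t) (y t)) - s * (2 * theta 0 + D (x 0) (y 0))).
Proof.
  intros hs htr ht hin.
  replace (C * (s * (2 * theta t + D (x t) (y t)) - s * (2 * theta 0 + D (x 0) (y 0)))) with
    (C * (s * (2 * theta t + D (x t) (y t))) - C * (s * (2 * theta 0 + D (x 0) (y 0)))) by ring.
  apply (derive_dominated (fun u => ln (norm2 (x u) (y u)))
    (fun u => C * (s * (2 * theta u + D (x u) (y u))))); [exact ht |].
  intros u hu. specialize (hin u hu).
  destruct (htr u) as (hg & _ & _ & _ & _ & _ & hd).
  destruct hd as (hx & hy & hth); [lra |].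
  pose proof (D_orbital s x y u hx hy (conj hg hin)) as hD.
  pose proof (orbital_derivative_ln_norm2 P Q rho s x y u hx hy (conj hg hin)) as hl.
  pose proof (radial_le _ _ (conj hg hin)) as hr. cbv beta in hl.
  set (X := x u) in *. set (Y := y u) in *.
  eexists; eexists; split; [exact hl | split].
  - apply (is_derive_scal (fun u => s * (2 * theta u + D (x u) (y u)))).
    apply (is_derive_scal (fun u => 2 * theta u + D (x u) (y u))).
    apply (@is_derive_plus R_AbsRing R_NormedModule (fun u => 2 * theta u)); [| exact hD].
    apply (is_derive_scal theta). exact hth.
  - unfold plus; simpl. rewrite Rabs_mult.
    assert (hs1 : Rabs s = 1).
    { assert (h : Rabs s * Rabs s = 1) by (rewrite <- Rabs_mult, hs; apply Rabs_R1).
      pose proof (Rabs_pos s). nra. }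
    rewrite hs1, Rmult_1_l. apply Rle_trans with (1 := hr). apply Req_le.
    transitivity (C * ((s * s) * (2 * ((X * Q X Y - Y * P X Y) / norm2 X Y) + D' X Y))).
    + rewrite hs; ring.
    + field. lra.
Qed.

Lemma trajectory_scal1 (x y theta : R -> R) :
  trajectory P Q x y theta ->
  trajectory (fun x y => 1 * P x y) (fun x y => 1 * Q x y) x y theta.
Proof.
  intros h t. destruct (h t) as (h1 & h2 & h3 & h4 & h5 & h6 & h7).
  repeat (split; [assumption |]). intros hle. specialize (h7 hle).
  rewrite !Rmult_1_l. exact h7.
Qed.

(** During one turn [2 theta] gains [4 PI] and [D] varies by at most [2 CD], so [ln norm2] varies by
    at most this constant minus 1. The extra 1 gives the strict inequality which forbids leaving the
    annulus before the turn is complete. *)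
Definition return_constant : R := C * (4 * PI + 2 * CD) + 1.

Lemma return_constant_gt0 : 0 < return_constant.
Proof.
  assert (0 <= CD).
  { apply Rle_trans with (1 := Rabs_pos (D (rho / 2) 0)). apply D_bounded. unfold norm2. nra. }
  unfold return_constant. pose proof PI_RGT_0.
  assert (0 <= C * (4 * PI + 2 * CD)) by (apply Rmult_le_pos; lra). lra.
Qed.

(** While [ln norm2] has moved by at most [K], the angle grows at a rate of at least [om]. Either
    this lasts for the time [2 PI / om], enough for a full turn, or the orbit leaves the annulus
    earlier, and then [log_norm2_control] shows that it had already turned by [2 PI]. The return
    time is an intermediate value of [theta]. *)
Lemma first_return_exists (eps s : R) :
  0 < s < rho * exp (- return_constant) ->
  exists s', 0 < s' <= s * exp return_constant /\
    first_return P Q eps (fun u => u) (fun _ => 0) (fun _ => 0) s s'.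
Proof.
  intros [hs hsd]. set (K := return_constant) in *.
  pose proof return_constant_gt0 as hK. fold K in hK.
  pose proof (exp_gt_1 K hK) as heK.
  assert (hsK : s * exp K < rho).
  { apply (Rmult_lt_compat_r (exp K)) in hsd; [| lra].
    rewrite Rmult_assoc, <- exp_plus, Rplus_opp_l, exp_0 in hsd. lra. }
  assert (hs1 : s < 1) by nra.
  assert (hn0 : norm2 s 0 = s ^ 2) by (unfold norm2; ring).
  assert (hsq : sqrt (norm2 s 0) = s) by (rewrite hn0; apply sqrt_pow2; lra).
  destruct (trajectory_exists P Q L s 0 0) as (x & y & theta & x0 & y0 & th0 & htr); auto.
  { rewrite hn0. apply pow_lt; lra. }
  { rewrite hsq, cos_0; ring. }
  { rewrite hsq, sin_0; ring. }
  set (g := fun t => norm2 (x t) (y t)).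
  assert (g0 : g 0 = s ^ 2) by (unfold g; rewrite x0, y0; exact hn0).
  assert (gpos : forall t, 0 < g t) by (intros t; apply htr).
  assert (gcont : forall t, continuous g t).
  { intros t. apply continuous_norm2; apply htr. }
  set (h := fun t => Rabs (ln (g t) - ln (g 0))).
  assert (hcont : forall t, continuous h t).
  { intros t. apply (continuous_comp (fun u => ln (g u) - ln (g 0)) Rabs).
    - apply (continuous_minus (fun u => ln (g u)) (fun _ => ln (g 0))).
      + apply (continuous_comp g ln); [apply gcont |].
        apply is_derive_continuous with (/ g t). apply is_derive_ln, gpos.
      + apply continuous_const.
    - apply continuous_Rabs. }
  assert (hg : forall t, h t <= K -> exp (- K) * s ^ 2 <= g t <= exp K * s ^ 2).
  { intros t ht. unfold h in ht. apply Rabs_le_between in ht. rewrite g0 in ht.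
    assert (hs2 : 0 < s ^ 2) by (apply pow_lt; lra).
    rewrite <- (exp_ln (s ^ 2) hs2) at 1 2. rewrite <- !exp_plus. split.
    - apply ln_ge_exp; [apply gpos | lra].
    - apply ln_le_exp; [apply gpos | lra]. }
  assert (hdisc : forall t, h t <= K -> g t < rho).
  { intros t ht. apply Rle_lt_trans with (1 := proj2 (hg t ht)). nra. }
  set (m := exp (- K) * s ^ 2) in hg.
  assert (hm : 0 < m) by (apply Rmult_lt_0_compat; [apply exp_pos | apply pow_lt; lra]).
  (* [theta'] is the rotation divided by [norm2], so the power 4 in the hypothesis on the rotation
     becomes 3. *)
  set (om := kappa * m ^ 3).
  assert (hom : 0 < om) by (apply Rmult_lt_0_compat; [assumption | apply pow_lt; assumption]).
  assert (turn : forall u v, 0 <= u <= v -> (forall w, u <= w <= v -> h w <= K) ->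
            om * (v - u) <= theta v - theta u).
  { intros u v huv hw.
    assert (hle : theta u - om * u <= theta v - om * v); [| lra].
    apply (derive_nonneg_le (fun w => theta w - om * w)
      (fun w => (x w * Q (x w) (y w) - y w * P (x w) (y w)) / norm2 (x w) (y w) - om)); [lra |].
    intros w hwb. specialize (hw w hwb). pose proof (hdisc w hw) as hd. unfold g in hd.
    destruct (htr w) as (hgw & _ & _ & _ & _ & _ & hder).
    destruct hder as (_ & _ & hth); [lra |]. split.
    - apply (@is_derive_minus R_AbsRing R_NormedModule theta (fun w => om * w)); [exact hth |].
      auto_derive; [trivial | ring].
    - pose proof (rotation _ _ (conj hgw hd)) as hrot.
      pose proof (proj1 (hg w hw)) as hmw. unfold g in hmw.
      set (G := norm2 (x w) (y w)) in *.
      assert (hm3 : m ^ 3 <= G ^ 3) by (apply pow_incr; lra).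
      assert (om <= (x w * Q (x w) (y w) - y w * P (x w) (y w)) / G); [| lra].
      apply Rle_trans with (kappa * G ^ 3).
      + apply Rmult_le_compat_l; lra.
      + apply Rmult_le_reg_r with G; [lra |]. unfold Rdiv. rewrite (Rmult_assoc _ (/ G)), Rinv_l
          by lra.
        simpl in hrot |- *. lra. }
  assert (h0 : h 0 = 0) by (unfold h; unfold Rminus; rewrite Rplus_opp_r; apply Rabs_R0).
  assert (ht1 : exists t1, 0 < t1 /\ (forall u, 0 <= u <= t1 -> h u <= K) /\ 2 * PI <= theta t1).
  { pose proof PI_RGT_0 as hpi.
    set (T0 := 2 * PI / om).
    assert (hT0 : 0 < T0) by (apply Rdiv_lt_0_compat; lra).
    destruct (first_exit h K T0) as [hin | (t1 & ht1 & heq & hlt)]; [exact hcont | lra | lra | |].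
    - assert (hin' : forall u, 0 <= u <= T0 -> h u <= K) by (intros u hu; left; apply hin; exact
        hu).
      exists T0. split; [exact hT0 | split; [exact hin' |]].
      pose proof (turn 0 T0 (conj (Rle_refl 0) (Rlt_le _ _ hT0)) hin') as htu.
      rewrite th0 in htu. unfold T0 at 1 in htu.
      replace (om * (2 * PI / om - 0)) with (2 * PI) in htu by (field; lra). lra.
    - assert (hin' : forall u, 0 <= u <= t1 -> h u <= K).
      { intros u hu. destruct (Rlt_dec u t1); [left; apply hlt; lra |].
        replace u with t1 by lra. lra. }
      exists t1. split; [lra | split; [exact hin' |]].
      destruct (Rle_dec (2 * PI) (theta t1)) as [| hn]; [assumption | exfalso].
      assert (hc : h t1 <= C * (1 * (2 * theta t1 + D (x t1) (y t1))
                      - 1 * (2 * theta 0 + D (x 0) (y 0)))).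
      { apply (log_norm2_control 1).
        - ring.
        - apply trajectory_scal1; exact htr.
        - lra.
        - intros u hu. apply hdisc, hin'; exact hu. }
      assert (b1 : Rabs (D (x t1) (y t1)) <= CD).
      { apply D_bounded. split; [apply gpos | apply hdisc; lra]. }
      assert (b0 : Rabs (D (x 0) (y 0)) <= CD).
      { apply D_bounded. split; [apply gpos | apply hdisc; lra]. }
      apply Rabs_le_between in b0. apply Rabs_le_between in b1.
      assert (C * (1 * (2 * theta t1 + D (x t1) (y t1)) - 1 * (2 * theta 0 + D (x 0) (y 0)))
                <= C * (4 * PI + 2 * CD)) by (apply Rmult_le_compat_l; lra).
      unfold K, return_constant in heq. lra. }
  destruct ht1 as (t1 & ht1 & hin & hfull).
  destruct (IVT_gen theta 0 t1 (2 * PI)) as [T [hT hTth]].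
  { intros t. apply continuity_pt_filterlim. apply htr. }
  { rewrite th0. pose proof PI_RGT_0. rewrite Rmin_left, Rmax_right by lra. lra. }
  rewrite Rmin_left, Rmax_right in hT by lra.
  assert (hT0 : 0 < T).
  { destruct (Req_dec T 0) as [e | e]; [| lra]. rewrite e, th0 in hTth. pose proof PI_RGT_0;
      lra. }
  assert (inc : forall u v, 0 <= u < v -> v <= T -> theta u < theta v).
  { intros u v huv hv. assert (om * (v - u) <= theta v - theta u).
    { apply turn; [lra |]. intros w hw. apply hin; lra. }
    assert (0 < om * (v - u)) by (apply Rmult_lt_0_compat; lra). lra. }
  assert (gT : g T <= exp K * s ^ 2) by (apply hg, hin; lra).
  exists (sqrt (g T)). split.
  { split; [apply sqrt_lt_R0, gpos |].
    rewrite <- (sqrt_pow2 (s * exp K)) by (apply Rmult_le_pos; lra).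
    apply sqrt_le_1_alt. apply Rle_trans with (1 := gT).
    rewrite Rpow_mult_distr, Rmult_comm. apply Rmult_le_compat_l; [apply pow2_ge_0 |]. nra. }
  (* A solution is required on an open interval around [[0, T]]; continuity keeps the orbit in the
     disc slightly beyond both ends. *)
  destruct (continuous_delta g 0 (rho - g 0) (gcont 0)) as [d0 [hd0 near0]].
  { pose proof (hdisc 0); lra. }
  assert (hrT : g T < rho) by (apply hdisc, hin; lra).
  destruct (continuous_delta g T (rho - g T) (gcont T)) as [dT [hdT nearT]]; [lra |].
  assert (hnear : forall t, - d0 < t < T + dT -> g t < rho).
  { intros t ht. destruct (Rlt_dec t 0) as [h1 | h1].
    - assert (h2 : Rabs (t - 0) < d0) by (apply Rabs_def1; lra).
      specialize (near0 t h2). apply Rabs_def2 in near0. lra.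
    - destruct (Rle_dec t T) as [h2 | h2]; [apply hdisc, hin; lra |].
      assert (h3 : Rabs (t - T) < dT) by (apply Rabs_def1; lra).
      specialize (nearT t h3). apply Rabs_def2 in nearT. lra. }
  exists (- d0), (T + dT), T, x, y, theta.
  split; [exact hT0 |]. split; [simpl; lra |]. split; [simpl; lra |].
  split; [| split; [| split; [exact x0 | split; [exact y0 | split; [exact th0 | split; [| split;
    [| split]]]]]]].
  - intros t ht. destruct ht as [ha hb]; simpl in ha, hb.
    assert (hgt : g t < rho) by (apply hnear; lra). unfold g in hgt.
    destruct (htr t) as (_ & _ & _ & _ & _ & _ & hd). destruct hd as (hx & hy & _); [lra |]. auto.
  - intros t _. destruct (htr t) as (hgt & _ & _ & hc & hx & hy & _). split; [exact hc |].
    exists (sqrt (norm2 (x t) (y t))). split; [apply sqrt_lt_R0; exact hgt | auto].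
  - destruct (htr T) as (_ & _ & _ & _ & hx & _). rewrite hx at 1. rewrite hTth, cos_2PI.
    unfold g; ring.
  - destruct (htr T) as (_ & _ & _ & _ & _ & hy & _). rewrite hy at 1. rewrite hTth, sin_2PI;
      ring.
  - left. rewrite hTth; ring.
  (* The section lies on the positive half-axis. Before time [T] the angle is strictly between 0 and
     [2 PI], where a vanishing sine comes with a negative cosine. *)
  - intros t u ht hu [ex ey]. destruct (htr t) as (hgt & _ & _ & _ & hx & hy & _).
    pose proof (sqrt_lt_R0 _ hgt) as hr. set (r := sqrt (norm2 (x t) (y t))) in *.
    assert (ht0 : 0 < theta t) by (rewrite <- th0; apply inc; lra).
    assert (ht2 : theta t < 2 * PI) by (rewrite <- hTth; apply inc; lra).
    assert (hsin : sin (theta t) = 0) by (apply Rmult_eq_reg_l with r; lra).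
    assert (hcos : 0 < cos (theta t)) by (apply Rmult_lt_reg_l with r; lra).
    destruct (Rtotal_order (theta t) PI) as [h1 | [h1 | h1]].
    + pose proof (sin_gt_0 _ ht0 h1); lra.
    + rewrite h1, cos_PI in hcos; lra.
    + pose proof (sin_lt_0 _ h1 ht2); lra.
Qed.

Lemma monodromic : is_monodromic P Q.
Proof.
  split; [exact P_0 | split; [exact Q_0 |]].
  exists rho, (fun u => u), (fun _ => 0), (fun _ => 0).
  pose proof return_constant_gt0 as hK. set (K := return_constant) in *.
  assert (hd : 0 < rho * exp (- K)) by (apply Rmult_lt_0_compat; [lra | apply exp_pos]).
  assert (heK : exp (- K) < 1).
  { rewrite exp_Ropp. rewrite <- Rinv_1. apply Rinv_lt_contravar; [| apply exp_gt_1; exact hK].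
    pose proof (exp_pos K); lra. }
  split.
  - split; [lra |]. split; [| split; [| split; [| split]]].
    + apply (filterlim_filter_le_1 (F := locally 0) (G := at_right 0)); [| apply filterlim_id].
      apply filter_le_within.
    + apply filterlim_const.
    + intros s [hs _]. simpl in hs. split; [apply continuous_const |].
      exists s. rewrite cos_0, sin_0. repeat split; lra.
    + intros s u _ _ e _; exact e.
    + intros s hs. assert (d1 : forall s, is_derive (fun u : R => u) s 1).
      { intros u. apply (@is_derive_id R_AbsRing). }
      assert (d2 : forall s : R, is_derive (fun _ : R => 0) s 0).
      { intros u. apply (@is_derive_const R_AbsRing R_NormedModule). }
      split; [exists 1; apply d1 |]. split; [exists 0; apply d2 |].
      split; [| split].
      * apply continuous_ext with (fun _ => 1); [| apply continuous_const].
        intros u; symmetry; apply is_derive_unique, d1.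
      * apply continuous_ext with (fun _ => 0); [| apply continuous_const].
        intros u; symmetry; apply is_derive_unique, d2.
      * rewrite (is_derive_unique _ _ _ (d1 s)), (is_derive_unique _ _ _ (d2 s)).
        assert (hn : norm2 s 0 = s ^ 2) by (unfold norm2; ring).
        assert (hr : 0 < norm2 s 0 < rho) by (rewrite hn; nra).
        pose proof (rotation s 0 hr) as h.
        assert (0 < kappa * norm2 s 0 ^ 4).
        { apply Rmult_lt_0_compat; [assumption | apply pow_lt; lra]. }
        (* On the horizontal section, transversality amounts to [Q s 0 <> 0], which the positive
           rotation at [(s, 0)] provides. *)
        intros e. assert (hq : Q s 0 = 0) by lra. rewrite hq in h. lra.
  - exists (rho * exp (- K)).
    (* The return map is picked point by point. No continuity of it is needed beyond its limit at 0,
       which follows from the bound [s' <= s exp K]. *)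
    destruct (choice (fun s s' => 0 < s < rho * exp (- K) ->
      0 < s' <= s * exp K /\ first_return P Q rho (fun u => u) (fun _ => 0) (fun _ => 0) s s'))
      as [Pi hPi].
    { intros s. destruct (excluded_middle_informative (0 < s < rho * exp (- K))) as [h | h].
      - destruct (first_return_exists rho s h) as [s' hs']. exists s'. intros _; exact hs'.
      - exists 0. intros h'; contradiction. }
    exists Pi. split; [split; [exact hd | nra] |]. split.
    + intros s hs. destruct (hPi s hs) as [[h1 h2] h3]. split; [| exact h3]. split; [exact h1 |].
      apply Rle_lt_trans with (1 := h2).
      destruct hs as [_ hs]. apply (Rmult_lt_compat_r (exp K)) in hs; [| apply exp_pos].
      rewrite Rmult_assoc, <- exp_plus, Rplus_opp_l, exp_0 in hs. lra.
    + apply filterlim_locally. intros e.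
      assert (hmin : 0 < Rmin (rho * exp (- K)) (e * exp (- K))).
      { apply Rmin_pos; [exact hd |]. apply Rmult_lt_0_compat; [apply cond_pos | apply exp_pos]. }
      exists (mkposreal _ hmin). intros s hs hs0.
      change (Rabs (s - 0) < Rmin (rho * exp (- K)) (e * exp (- K))) in hs.
      rewrite Rminus_0_r, Rabs_right in hs by lra.
      pose proof (Rlt_le_trans _ _ _ hs (Rmin_l _ _)) as hs1.
      pose proof (Rlt_le_trans _ _ _ hs (Rmin_r _ _)) as hs2.
      destruct (hPi s (conj hs0 hs1)) as [[h1 h2] _].
      change (Rabs (Pi s - 0) < e). rewrite Rminus_0_r, Rabs_right by lra.
      apply Rle_lt_trans with (1 := h2).
      apply (Rmult_lt_compat_r (exp K)) in hs2; [| apply exp_pos].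
      rewrite Rmult_assoc, <- exp_plus, Rplus_opp_l, exp_0 in hs2. lra.
Qed.

Hypothesis c_gt0 : 0 < c.
Hypothesis W_bounded : forall x y, 0 < norm2 x y < rho ->
  Rabs (W x y - ln (norm2 x y) / 2) <= CW.
Hypothesis W_orbital : orbital_derivative P Q rho W W'.

(** [W] is [ln r] up to a bounded error. Its decrease therefore confines the orbit to a small disc,
    its quantitative decrease forces the radius to 0, and then [log_norm2_control] turns
    [ln norm2 -> -oo] into infinitely many turns. *)
Lemma lyapunov_spirals_forward (s : R) :
  s * s = 1 ->
  (forall x y, 0 < norm2 x y < rho -> s * W' x y <= - (c * norm2 x y ^ 3)) ->
  exists r, 0 < r /\ forall x0 y0, 0 < x0 ^ 2 + y0 ^ 2 < r ^ 2 ->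
    spirals_forward (fun x y => s * P x y) (fun x y => s * Q x y) x0 y0.
Proof.
  intros hs W_decreasing.
  assert (hs1 : Rabs s = 1).
  { assert (h : Rabs s * Rabs s = 1) by (rewrite <- Rabs_mult, hs; apply Rabs_R1).
    pose proof (Rabs_pos s). nra. }
  assert (hCW : 0 <= CW).
  { apply Rle_trans with (2 := W_bounded (rho / 2) 0 ltac:(unfold norm2; nra)). apply Rabs_pos. }
  (* A decrease of [W] allows [ln norm2 / 2] to grow by at most [2 CW], hence [norm2] by at most the
     factor [M]. *)
  set (M := exp (4 * CW)).
  assert (hM : 1 <= M) by (unfold M; pose proof (exp_ineq1_le (4 * CW)); lra).
  exists (rho / (2 * M)).
  assert (hr : 0 < rho / (2 * M)) by (apply Rdiv_lt_0_compat; lra).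
  split; [exact hr |]. intros x0 y0 h0.
  assert (hr1 : rho / (2 * M) * M = rho / 2) by (field; lra).
  assert (hr2 : (rho / (2 * M)) ^ 2 <= rho / (2 * M)) by (simpl; nra).
  assert (hstart : norm2 x0 y0 * M < rho / 2) by (unfold norm2; nra).
  destruct (polar_angle_exists x0 y0 (proj1 h0)) as [theta0 [px py]].
  assert (lip : forall H, box_lipschitz L H -> box_lipschitz L (fun x y => s * H x y)).
  { intros H hH x y x' y' b1 b2 b3 b4. rewrite <- Rmult_minus_distr_l, Rabs_mult, hs1, Rmult_1_l.
    apply hH; assumption. }
  destruct (trajectory_exists (fun x y => s * P x y) (fun x y => s * Q x y) L x0 y0 theta0)
    as (x & y & theta & ex & ey & eth & htr); auto.
  { rewrite P_0; ring. }
  { rewrite Q_0; ring. }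
  { exact (proj1 h0). }
  set (g := fun t => norm2 (x t) (y t)).
  assert (g0 : g 0 * M < rho / 2) by (unfold g; rewrite ex, ey; exact hstart).
  assert (gpos : forall t, 0 < g t) by (intros t; apply htr).
  assert (gcont : forall t, continuous g t).
  { intros t. apply continuous_norm2; apply htr. }
  (* With [m = 0] this is plain monotonicity, used for [decay]; with [m > 0] it is the linear
     decrease used in [conv]. *)
  assert (drop : forall m u v, 0 <= m -> u <= v -> (forall w, u <= w <= v -> m <= g w < rho) ->
            W (x v) (y v) <= W (x u) (y u) - c * m ^ 3 * (v - u)).
  { intros m u v hm huv hw.
    assert (hle : - W (x u) (y u) - c * m ^ 3 * u <= - W (x v) (y v) - c * m ^ 3 * v); [| lra].
    apply (derive_nonneg_le (fun w => - W (x w) (y w) - c * m ^ 3 * w)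
      (fun w => - (s * W' (x w) (y w)) - c * m ^ 3)); [exact huv |].
    intros w hwb. destruct (hw w hwb) as [hmw hgw]. unfold g in hmw, hgw.
    destruct (htr w) as (hgp & _ & _ & _ & _ & _ & hd). destruct hd as (hx & hy & _); [lra |].
    split.
    - apply (@is_derive_minus R_AbsRing R_NormedModule (fun w => - W (x w) (y w))
        (fun w => c * m ^ 3 * w)).
      + apply (@is_derive_opp R_AbsRing R_NormedModule (fun w => W (x w) (y w))).
        apply (W_orbital s x y w hx hy). lra.
      + auto_derive; [trivial | ring].
    - pose proof (W_decreasing _ _ (conj hgp hgw)) as h.
      assert (c * m ^ 3 <= c * norm2 (x w) (y w) ^ 3).
      { apply Rmult_le_compat_l; [lra |]. apply pow_incr; lra. }
      lra. }
  assert (decay : forall u v, u <= v -> (forall w, u <= w <= v -> g w < rho) -> g v <= g u * M).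
  { intros u v huv hw.
    assert (hW : W (x v) (y v) <= W (x u) (y u) - c * 0 ^ 3 * (v - u)).
    { apply drop; [lra | exact huv |]. intros w hwb. split; [left; apply gpos | apply hw; exact
        hwb]. }
    assert (bu := W_bounded (x u) (y u) (conj (gpos u) (hw u (conj (Rle_refl u) huv)))).
    assert (bv := W_bounded (x v) (y v) (conj (gpos v) (hw v (conj huv (Rle_refl v))))).
    apply Rabs_le_between in bu. apply Rabs_le_between in bv.
    fold (g u) in bu. fold (g v) in bv. rewrite (pow_i 3), Rmult_0_r, Rmult_0_l in hW by lia.
    rewrite <- (exp_ln (g u) (gpos u)). unfold M. rewrite <- exp_plus.
    apply ln_le_exp; [apply gpos | lra]. }
  assert (inside : forall t, 0 <= t -> g t < rho / 2).
  { intros t ht. destruct (first_exit g (rho / 2) t gcont) as [h | (t1 & ht1 & heq & hlt)].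
    - pose proof (gpos 0). nra.
    - exact ht.
    - apply h; lra.
    - exfalso. assert (g t1 <= g 0 * M); [| lra].
      apply decay; [lra |]. intros w hw. destruct (Rlt_dec w t1).
      + apply Rlt_trans with (rho / 2); [apply hlt; lra | lra].
      + replace w with t1 by lra. lra. }
  assert (inside' : forall t, 0 <= t -> g t < rho) by (intros t ht; pose proof (inside t ht);
    lra).
  (* If [norm2] stayed above [m = e / (2 M)], then [W] would be bounded below and yet decrease
     linearly. Once below [m], [decay] keeps it below [m M < e]. *)
  assert (conv : forall e, 0 < e -> exists T, 0 <= T /\ forall t, T <= t -> g t < e).
  { intros e he.
    assert (hm : 0 < e / (2 * M)) by (apply Rdiv_lt_0_compat; lra).
    set (m := e / (2 * M)) in *.
    destruct (excluded_middle_informative (exists t, 0 <= t /\ g t < m)) as [(T & hT & hgT) |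
      hno].
    - exists T. split; [exact hT |]. intros t ht.
      apply Rle_lt_trans with (g T * M).
      + apply decay; [exact ht |]. intros w hw. apply inside'; lra.
      + apply Rlt_trans with (m * M); [apply Rmult_lt_compat_r; lra |].
        unfold m. replace (e / (2 * M) * M) with (e / 2) by (field; lra). lra.
    - exfalso.
      assert (hge : forall t, 0 <= t -> m <= g t).
      { intros t ht. destruct (Rle_dec m (g t)); [assumption |].
        exfalso; apply hno. exists t. split; [exact ht | lra]. }
      assert (low : forall t, 0 <= t -> ln m / 2 - CW <= W (x t) (y t)).
      { intros t ht. pose proof (W_bounded _ _ (conj (gpos t) (inside' t ht))) as h.
        apply Rabs_le_between in h. fold (g t) in h.
        pose proof (ln_le m (g t) hm (hge t ht)). lra. }
      assert (hcm : 0 < c * m ^ 3) by (apply Rmult_lt_0_compat; [lra | apply pow_lt; exact hm]).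
      set (t := (W (x 0) (y 0) - (ln m / 2 - CW) + 1) / (c * m ^ 3)).
      assert (ht : 0 < t).
      { apply Rdiv_lt_0_compat; [| exact hcm]. pose proof (low 0 (Rle_refl 0)). lra. }
      assert (hd : W (x t) (y t) <= W (x 0) (y 0) - c * m ^ 3 * (t - 0)).
      { apply drop; [lra | lra |]. intros w hw. split; [apply hge; lra | apply inside'; lra]. }
      replace (c * m ^ 3 * (t - 0)) with (W (x 0) (y 0) - (ln m / 2 - CW) + 1) in hd
        by (unfold t; field; split; lra).
      pose proof (low t (Rlt_le _ _ ht)). lra. }
  destruct (continuous_delta g 0 (rho - g 0) (gcont 0)) as [d [hd near0]].
  { pose proof (inside' 0 (Rle_refl 0)); lra. }
  assert (hnear : forall t, - d < t -> g t < rho).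
  { intros t ht. destruct (Rlt_dec t 0) as [h1 | h1]; [| apply inside'; lra].
    assert (h2 : Rabs (t - 0) < d) by (apply Rabs_def1; lra).
    specialize (near0 t h2). apply Rabs_def2 in near0. lra. }
  exists (- d). split; [simpl; lra |]. exists x, y, theta.
  split; [| split; [exact ex | split; [exact ey | split; [| split; [| split]]]]].
  - intros t [ht _]. simpl in ht. pose proof (hnear t ht) as hg. unfold g in hg.
    destruct (htr t) as (_ & _ & _ & _ & _ & _ & hder). destruct hder as (hx & hy & _); [lra |].
    split; assumption.
  - intros t _. destruct (htr t) as (hgt & _ & _ & hc & hx & hy & _). split; [exact hc |].
    exists (sqrt (norm2 (x t) (y t))). split; [apply sqrt_lt_R0; exact hgt | auto].
  - apply is_lim_spec. intros e. destruct (conv (e ^ 2)) as (T & _ & hT).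
    { apply pow_lt, cond_pos. }
    exists T. intros t ht. rewrite Rminus_0_r.
    specialize (hT t (Rlt_le _ _ ht)). unfold g, norm2 in hT. pose proof (cond_pos e).
    pose proof (pow2_ge_0 (y t)). apply Rabs_def1; nra.
  - apply is_lim_spec. intros e. destruct (conv (e ^ 2)) as (T & _ & hT).
    { apply pow_lt, cond_pos. }
    exists T. intros t ht. rewrite Rminus_0_r.
    specialize (hT t (Rlt_le _ _ ht)). unfold g, norm2 in hT. pose proof (cond_pos e).
    pose proof (pow2_ge_0 (x t)). apply Rabs_def1; nra.
  - apply is_lim_spec. intros B.
    (* A drop of [ln norm2] by more than [B'] forces [|theta| > B], after allowing for both values
       of [D] and for the initial angle. *)
    set (B' := C * (2 * B + 2 * CD + 2 * Rabs (theta 0))).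
    destruct (conv (exp (ln (g 0) - B'))) as (T & hT0 & hT); [apply exp_pos |].
    exists T. intros t ht. assert (ht0 : 0 <= t) by lra.
    specialize (hT t (Rlt_le _ _ ht)).
    assert (hl : ln (g t) < ln (g 0) - B').
    { rewrite <- (ln_exp (ln (g 0) - B')). apply ln_increasing; [apply gpos | exact hT]. }
    pose proof (log_norm2_control s x y theta t hs htr ht0
      (fun u hu => inside' u (proj1 hu))) as hc.
    fold (g t) (g 0) in hc.
    apply Rabs_le_between in hc.
    assert (bt := D_bounded _ _ (conj (gpos t) (inside' t ht0))).
    assert (b0 := D_bounded _ _ (conj (gpos 0) (inside' 0 (Rle_refl 0)))).
    assert (hlt : B' < C * (s * (2 * theta t + D (x t) (y t)) - s * (2 * theta 0 + D (x 0) (y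
      0))))
      by lra.
    apply Rmult_lt_reg_l in hlt; [| exact C_gt0].
    assert (sb : forall z, s * z <= Rabs z).
    { intros z. rewrite <- (Rmult_1_l (Rabs z)), <- hs1, <- Rabs_mult. apply Rle_abs. }
    pose proof (sb (theta t)). pose proof (sb (D (x t) (y t))).
    pose proof (sb (- theta 0)) as h1. pose proof (sb (- D (x 0) (y 0))) as h2.
    rewrite Rabs_Ropp in h1, h2. lra.
Qed.

(** When [W] increases along the orbits, it decreases along those of the reversed field. The forward
    spirals of [-P], [-Q], read in the time [-t], are backward spirals of [P], [Q]. *)
Lemma lyapunov_focus (sg : R) :
  sg = 1 \/ sg = -1 ->
  (forall x y, 0 < norm2 x y < rho -> c * norm2 x y ^ 3 <= sg * W' x y) -> is_focus P Q.
Proof.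
  intros hsg hW. split; [exact monodromic |].
  destruct (lyapunov_spirals_forward (- sg)) as [r [hr hsp]].
  { destruct hsg as [-> | ->]; ring. }
  { intros x y hxy. specialize (hW x y hxy). lra. }
  exists r. split; [exact hr |].
  destruct hsg as [-> | ->].
  - right. intros x0 y0 h0.
    destruct (hsp x0 y0 h0) as (al & hal & x & y & theta & hsol & ex & ey & hpol & lx & ly & lth).
    exists (Rbar_opp al). split.
    { destruct al; simpl in *; try tauto; lra. }
    assert (rev : forall t, in_interval m_infty (Rbar_opp al) t -> in_interval al p_infty (- t)).
    { intros t [_ ht]. split; [| exact I]. destruct al; simpl in *; try tauto; lra. }
    exists (fun t => x (- t)), (fun t => y (- t)), (fun t => theta (- t)).
    rewrite Ropp_0. split; [| split; [exact ex | split; [exact ey | split; [| split; [|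
      split]]]]].
    + intros t ht. destruct (hsol (- t) (rev t ht)) as [hx hy].
      split; [apply is_derive_eq with (-1 * (- (1) * P (x (- t)) (y (- t))))
             | apply is_derive_eq with (-1 * (- (1) * Q (x (- t)) (y (- t))))]; try ring.
      * apply (@is_derive_comp R_AbsRing R_NormedModule x (fun t => - t)); [exact hx |].
        auto_derive; [trivial | ring].
      * apply (@is_derive_comp R_AbsRing R_NormedModule y (fun t => - t)); [exact hy |].
        auto_derive; [trivial | ring].
    + intros t ht. destruct (hpol (- t) (rev t ht)) as [hc hex]. split; [| exact hex].
      apply (continuous_comp (fun t => - t) theta); [| exact hc].
      apply (continuous_opp (fun t : R => t)), continuous_id.
    + apply is_lim_comp with (f := x) (g := fun t => - t) (l := p_infty); [exact lx | |].
      * apply (is_lim_opp (fun t => t) m_infty m_infty), is_lim_id.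
      * exists 0. intros; discriminate.
    + apply is_lim_comp with (f := y) (g := fun t => - t) (l := p_infty); [exact ly | |].
      * apply (is_lim_opp (fun t => t) m_infty m_infty), is_lim_id.
      * exists 0. intros; discriminate.
    + apply is_lim_comp with (f := fun t => Rabs (theta t)) (g := fun t => - t) (l := p_infty);
        [exact lth | |].
      * apply (is_lim_opp (fun t => t) m_infty m_infty), is_lim_id.
      * exists 0. intros; discriminate.
  - left. intros x0 y0 h0.
    destruct (hsp x0 y0 h0) as (al & hal & x & y & theta & hsol & rest).
    exists al. split; [exact hal |]. exists x, y, theta. split; [| exact rest].
    intros t ht. destruct (hsol t ht) as [hx hy].
    replace (- -1) with 1 in hx, hy by ring. rewrite Rmult_1_l in hx, hy. split; assumption.
Qed.

End Focus.

(** * Orders of magnitude at the origin *)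

Definition near_origin (H : R -> R -> Prop) : Prop :=
  exists rho, 0 < rho /\ forall x y, 0 < norm2 x y < rho -> H x y.

Lemma near_and (H1 H2 : R -> R -> Prop) :
  near_origin H1 -> near_origin H2 -> near_origin (fun x y => H1 x y /\ H2 x y).
Proof.
  intros (r1 & hr1 & h1) (r2 & hr2 & h2). exists (Rmin r1 r2).
  split; [apply Rmin_pos; assumption |]. intros x y [hn hr].
  split; [apply h1 | apply h2]; split; try exact hn; eapply Rlt_le_trans;
    try exact hr; [apply Rmin_l | apply Rmin_r].
Qed.

Lemma near_impl (H1 H2 : R -> R -> Prop) :
  (forall x y, 0 < norm2 x y -> H1 x y -> H2 x y) -> near_origin H1 -> near_origin H2.
Proof.
  intros h (r & hr & h1). exists r. split; [exact hr |]. intros x y hn.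
  apply h; [apply hn | apply h1, hn].
Qed.

Definition radius (x y : R) : R := sqrt (norm2 x y).

Lemma radius_sq (x y : R) : radius x y * radius x y = norm2 x y.
Proof.
  apply sqrt_sqrt. unfold norm2. pose proof (pow2_ge_0 x); pose proof (pow2_ge_0 y); lra.
Qed.

Lemma radius_ge0 (x y : R) : 0 <= radius x y.
Proof. apply sqrt_pos. Qed.

Lemma abs_le_radius (x y : R) : Rabs x <= radius x y /\ Rabs y <= radius x y.
Proof.
  pose proof (radius_sq x y) as h. pose proof (radius_ge0 x y). unfold norm2 in h.
  pose proof (pow2_ge_0 x); pose proof (pow2_ge_0 y).
  split; apply Rabs_le; nra.
Qed.

Lemma near_radius (k : R) : 0 < k -> near_origin (fun x y => radius x y < k).
Proof.
  intros hk. exists (k ^ 2). split; [apply pow_lt; exact hk |]. intros x y [_ h].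
  rewrite <- radius_sq in h. pose proof (radius_ge0 x y). nra.
Qed.

Definition bigO (u z : R -> R -> R) : Prop :=
  exists K, 0 <= K /\ near_origin (fun x y => Rabs (u x y) <= K * z x y).

Lemma bigO_le (u z : R -> R -> R) (K : R) :
  near_origin (fun x y => 0 <= z x y /\ Rabs (u x y) <= K * z x y) -> bigO u z.
Proof.
  intros h. exists (Rabs K). split; [apply Rabs_pos |].
  apply near_impl with (2 := h). intros x y _ [hz hu].
  apply Rle_trans with (1 := hu). apply Rmult_le_compat_r; [exact hz | apply Rle_abs].
Qed.

Lemma bigO_global (u z : R -> R -> R) (K : R) :
  0 <= K -> (forall x y, 0 < norm2 x y -> Rabs (u x y) <= K * z x y) -> bigO u z.
Proof.
  intros hK h. exists K. split; [exact hK |]. exists 1. split; [lra |].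
  intros x y [hn _]; auto.
Qed.

Lemma bigO_ext (u v z : R -> R -> R) :
  near_origin (fun x y => u x y = v x y) -> bigO u z -> bigO v z.
Proof.
  intros h (K & hK & hu). exists K. split; [exact hK |].
  apply near_impl with (2 := near_and _ _ h hu). intros x y _ [e h']. rewrite <- e; exact h'.
Qed.

Lemma bigO_plus (u v z : R -> R -> R) :
  bigO u z -> bigO v z -> bigO (fun x y => u x y + v x y) z.
Proof.
  intros (K & hK & hu) (K' & hK' & hv). exists (K + K'). split; [lra |].
  apply near_impl with (2 := near_and _ _ hu hv). intros x y _ [h1 h2].
  apply Rle_trans with (1 := Rabs_triang _ _). lra.
Qed.

Lemma bigO_mult (u v z1 z2 : R -> R -> R) :
  bigO u z1 -> bigO v z2 -> bigO (fun x y => u x y * v x y) (fun x y => z1 x y * z2 x y).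
Proof.
  intros (K & hK & hu) (K' & hK' & hv). exists (K * K'). split; [apply Rmult_le_pos; lra |].
  apply near_impl with (2 := near_and _ _ hu hv). intros x y _ [h1 h2].
  rewrite Rabs_mult. replace (K * K' * (z1 x y * z2 x y)) with ((K * z1 x y) * (K' * z2 x y)) by
    ring.
  apply Rmult_le_compat; auto using Rabs_pos.
Qed.

Lemma bigO_scale (u v z : R -> R -> R) :
  bigO u (fun _ _ => 1) -> bigO v z -> bigO (fun x y => u x y * v x y) z.
Proof.
  intros hu hv. destruct (bigO_mult _ _ _ _ hu hv) as (K & hK & h). exists K. split; [exact hK |].
  apply near_impl with (2 := h). intros x y _. rewrite Rmult_1_l. auto.
Qed.

Lemma bigO_const (k : R) : bigO (fun _ _ => k) (fun _ _ => 1).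
Proof.
  apply bigO_global with (Rabs k); [apply Rabs_pos |]. intros; lra.
Qed.

Lemma bigO_minus (u v z : R -> R -> R) :
  bigO u z -> bigO v z -> bigO (fun x y => u x y - v x y) z.
Proof.
  intros hu hv.
  apply bigO_ext with (fun x y => u x y + (-1) * v x y).
  - exists 1. split; [lra |]. intros; ring.
  - apply bigO_plus; [exact hu |]. apply bigO_scale; [apply bigO_const | exact hv].
Qed.

(** This is how terms of higher order get absorbed: one additional factor [radius] beats any
    constant on a small enough disc. The denominator [K + 1] covers [K = 0]. *)
Lemma bigO_small (u z : R -> R -> R) (k : R) :
  0 < k -> (forall x y, 0 <= z x y) -> bigO u (fun x y => radius x y * z x y) ->
  near_origin (fun x y => Rabs (u x y) <= k * z x y).
Proof.
  intros hk hz (K & hK & hu).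
  assert (hk' : 0 < k / (K + 1)) by (apply Rdiv_lt_0_compat; lra).
  apply near_impl with (2 := near_and _ _ hu (near_radius _ hk')). intros x y _ [h1 h2].
  apply Rle_trans with (1 := h1). rewrite <- Rmult_assoc. apply Rmult_le_compat_r; [apply hz |].
  apply Rle_trans with ((K + 1) * (k / (K + 1))).
  - apply Rmult_le_compat; try lra. apply radius_ge0.
  - right; field; lra.
Qed.

Lemma bigO_radius (u z : R -> R -> R) :
  (forall x y, 0 <= z x y) ->
  bigO u (fun x y => norm2 x y * z x y) -> bigO u (fun x y => radius x y * z x y).
Proof.
  intros hz (K & hK & hu). exists K. split; [exact hK |].
  apply near_impl with (2 := near_and _ _ hu (near_radius 1 Rlt_0_1)). intros x y _ [h1 h2].
  apply Rle_trans with (1 := h1). apply Rmult_le_compat_l; [exact hK |].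
  apply Rmult_le_compat_r; [apply hz |]. rewrite <- radius_sq.
  pose proof (radius_ge0 x y). nra.
Qed.

(** * Derivatives along orbits and angles between moving vectors *)

Lemma orbital_derivative_le (P Q U U' : R -> R -> R) (rho rho' : R) :
  rho' <= rho -> orbital_derivative P Q rho U U' -> orbital_derivative P Q rho' U U'.
Proof. intros hr h s x y t hx hy hn. apply h; auto. lra. Qed.

Lemma orbital_derivative_plus (P Q U U' V V' : R -> R -> R) (rho : R) :
  orbital_derivative P Q rho U U' -> orbital_derivative P Q rho V V' ->
  orbital_derivative P Q rho (fun x y => U x y + V x y) (fun x y => U' x y + V' x y).
Proof.
  intros hU hV s x y t hx hy hn. rewrite Rmult_plus_distr_l.
  apply (@is_derive_plus R_AbsRing R_NormedModule (fun u => U (x u) (y u)) (fun u => V (x u) (y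
    u)));
    [apply hU | apply hV]; assumption.
Qed.

Lemma orbital_derivative_mult (P Q U U' V V' : R -> R -> R) (rho : R) :
  orbital_derivative P Q rho U U' -> orbital_derivative P Q rho V V' ->
  orbital_derivative P Q rho (fun x y => U x y * V x y)
    (fun x y => U' x y * V x y + U x y * V' x y).
Proof.
  intros hU hV s x y t hx hy hn.
  apply is_derive_eq with
    (s * U' (x t) (y t) * V (x t) (y t) + U (x t) (y t) * (s * V' (x t) (y t))); [| ring].
  apply (@is_derive_mult R_AbsRing (fun u => U (x u) (y u)) (fun u => V (x u) (y u)));
    [apply hU | apply hV | intros; apply Rmult_comm]; assumption.
Qed.

Lemma orbital_derivative_scal (P Q U U' : R -> R -> R) (rho k : R) :
  orbital_derivative P Q rho U U' ->
  orbital_derivative P Q rho (fun x y => k * U x y) (fun x y => k * U' x y).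
Proof.
  intros hU s x y t hx hy hn.
  apply is_derive_eq with (k * (s * U' (x t) (y t))); [| ring].
  apply (is_derive_scal (fun u => U (x u) (y u))). apply hU; assumption.
Qed.

Lemma orbital_derivative_ln (P Q U U' : R -> R -> R) (rho : R) :
  (forall x y, 0 < norm2 x y < rho -> 0 < U x y) ->
  orbital_derivative P Q rho U U' ->
  orbital_derivative P Q rho (fun x y => ln (U x y)) (fun x y => U' x y / U x y).
Proof.
  intros hpos hU s x y t hx hy hn.
  apply is_derive_eq with (scal (s * U' (x t) (y t)) (/ U (x t) (y t))).
  - apply (@is_derive_comp R_AbsRing R_NormedModule ln (fun u => U (x u) (y u))).
    + apply is_derive_ln, hpos; exact hn.
    + apply hU; assumption.
  - unfold scal; simpl; unfold mult; simpl. unfold Rdiv. ring.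
Qed.

(** The determination in []-PI/2, PI/2[] of the angle from [u] to [v], meaningful while their dot
    product is positive. It realises a difference of two multivalued polar angles as a single valued
    bounded function. *)
Definition angle_between (u1 u2 v1 v2 : R) : R := atan ((u1 * v2 - u2 * v1) / (u1 * v1 + u2 *
  v2)).

Lemma angle_between_bound (u1 u2 v1 v2 : R) : Rabs (angle_between u1 u2 v1 v2) <= PI / 2.
Proof.
  unfold angle_between. pose proof (atan_bound ((u1 * v2 - u2 * v1) / (u1 * v1 + u2 * v2))).
  apply Rabs_le; lra.
Qed.

Lemma is_derive_angle_between (u1 u2 v1 v2 : R -> R) (t du1 du2 dv1 dv2 : R) :
  is_derive u1 t du1 -> is_derive u2 t du2 -> is_derive v1 t dv1 -> is_derive v2 t dv2 ->
  0 < u1 t * v1 t + u2 t * v2 t ->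
  is_derive (fun s => angle_between (u1 s) (u2 s) (v1 s) (v2 s)) t
    ((v1 t * dv2 - v2 t * dv1) / (v1 t ^ 2 + v2 t ^ 2)
     - (u1 t * du2 - u2 t * du1) / (u1 t ^ 2 + u2 t ^ 2)).
Proof.
  intros h1 h2 h3 h4 hpos. unfold angle_between.
  set (N := fun s => u1 s * v2 s - u2 s * v1 s). set (M := fun s => u1 s * v1 s + u2 s * v2 s).
  assert (hN : is_derive N t (du1 * v2 t + u1 t * dv2 - (du2 * v1 t + u2 t * dv1))).
  { unfold N. auto_derive; [repeat split; eexists; eassumption |].
    change (fun x => u1 x) with u1. change (fun x => u2 x) with u2.
    change (fun x => v1 x) with v1. change (fun x => v2 x) with v2.
    rewrite (is_derive_unique _ _ _ h1), (is_derive_unique _ _ _ h2),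
      (is_derive_unique _ _ _ h3), (is_derive_unique _ _ _ h4). ring. }
  assert (hM : is_derive M t (du1 * v1 t + u1 t * dv1 + (du2 * v2 t + u2 t * dv2))).
  { unfold M. auto_derive; [repeat split; eexists; eassumption |].
    change (fun x => u1 x) with u1. change (fun x => u2 x) with u2.
    change (fun x => v1 x) with v1. change (fun x => v2 x) with v2.
    rewrite (is_derive_unique _ _ _ h1), (is_derive_unique _ _ _ h2),
      (is_derive_unique _ _ _ h3), (is_derive_unique _ _ _ h4). ring. }
  assert (hMt : M t <> 0) by (apply Rgt_not_eq; exact hpos).
  pose proof (is_derive_div N M t _ _ hN hM hMt) as hd.
  pose proof (@is_derive_comp R_AbsRing R_NormedModule atan (fun s => N s / M s) t _ _
    (is_derive_atan (N t / M t)) hd) as hc.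
  apply is_derive_eq with (1 := hc). clear hc hd hN hM.
  unfold scal; simpl; unfold mult; simpl.
  assert (hu : 0 < u1 t ^ 2 + u2 t ^ 2).
  { destruct (Req_dec (u1 t) 0) as [e | e]; [destruct (Req_dec (u2 t) 0) as [e' | e'] |].
    - rewrite e, e' in hpos; lra.
    - pose proof (pow2_ge_0 (u1 t)). pose proof (pow2_gt_0 _ e'). lra.
    - pose proof (pow2_ge_0 (u2 t)). pose proof (pow2_gt_0 _ e). lra. }
  assert (hv : 0 < v1 t ^ 2 + v2 t ^ 2).
  { destruct (Req_dec (v1 t) 0) as [e | e]; [destruct (Req_dec (v2 t) 0) as [e' | e'] |].
    - rewrite e, e' in hpos; lra.
    - pose proof (pow2_ge_0 (v1 t)). pose proof (pow2_gt_0 _ e'). lra.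
    - pose proof (pow2_ge_0 (v2 t)). pose proof (pow2_gt_0 _ e). lra. }
  (* Lagrange's identity: it splits the derivative of [atan (N / M)], whose denominator is
     [N^2 + M^2], into the difference of the two angular velocities. *)
  assert (hNM : N t ^ 2 + M t ^ 2 = (u1 t ^ 2 + u2 t ^ 2) * (v1 t ^ 2 + v2 t ^ 2)).
  { unfold N, M. ring. }
  unfold Rsqr.
  transitivity (((du1 * v2 t + u1 t * dv2 - (du2 * v1 t + u2 t * dv1)) * M t
     - N t * (du1 * v1 t + u1 t * dv1 + (du2 * v2 t + u2 t * dv2))) / (N t ^ 2 + M t ^ 2)).
  - field. split; [| exact hMt].
    rewrite hNM. apply Rgt_not_eq, Rmult_lt_0_compat; assumption.
  - rewrite hNM. unfold N, M. field. split; apply Rgt_not_eq; lra.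
Qed.

(** * Lipschitz bounds for polynomials on the unit box *)

Definition box_regular (f : R -> R -> R) : Prop :=
  exists M L, 0 <= M /\ 0 <= L /\ box_lipschitz L f /\
    forall x y, -1 <= x <= 1 -> -1 <= y <= 1 -> Rabs (f x y) <= M.

Lemma box_regular_const (k : R) : box_regular (fun _ _ => k).
Proof.
  exists (Rabs k), 0. split; [apply Rabs_pos |]. split; [lra |]. split; [| intros; lra].
  intros x y x' y' _ _ _ _. rewrite Rminus_diag, Rabs_R0. lra.
Qed.

Lemma box_regular_fst : box_regular (fun x _ => x).
Proof.
  exists 1, 1. split; [lra |]. split; [lra |]. split.
  - intros x y x' y' _ _ _ _. pose proof (Rabs_pos (y - y')). lra.
  - intros x y hx _. apply Rabs_le; lra.
Qed.

Lemma box_regular_snd : box_regular (fun _ y => y).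
Proof.
  exists 1, 1. split; [lra |]. split; [lra |]. split.
  - intros x y x' y' _ _ _ _. pose proof (Rabs_pos (x - x')). lra.
  - intros x y _ hy. apply Rabs_le; lra.
Qed.

Lemma box_regular_plus (f g : R -> R -> R) :
  box_regular f -> box_regular g -> box_regular (fun x y => f x y + g x y).
Proof.
  intros (M & L & hM & hL & lf & bf) (M' & L' & hM' & hL' & lg & bg).
  exists (M + M'), (L + L'). split; [lra |]. split; [lra |]. split.
  - intros x y x' y' h1 h2 h3 h4.
    replace (f x y + g x y - (f x' y' + g x' y')) with
      ((f x y - f x' y') + (g x y - g x' y')) by ring.
    apply Rle_trans with (1 := Rabs_triang _ _). rewrite Rmult_plus_distr_r.
    apply Rplus_le_compat; [apply lf | apply lg]; assumption.
  - intros x y h1 h2. apply Rle_trans with (1 := Rabs_triang _ _).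
    apply Rplus_le_compat; auto.
Qed.

(** Products are the reason why [box_regular] carries a bound besides the Lipschitz constant. *)
Lemma box_regular_mult (f g : R -> R -> R) :
  box_regular f -> box_regular g -> box_regular (fun x y => f x y * g x y).
Proof.
  intros (M & L & hM & hL & lf & bf) (M' & L' & hM' & hL' & lg & bg).
  exists (M * M'), (L * M' + M * L').
  split; [apply Rmult_le_pos; assumption |].
  split; [apply Rplus_le_le_0_compat; apply Rmult_le_pos; assumption |]. split.
  - intros x y x' y' h1 h2 h3 h4.
    replace (f x y * g x y - f x' y' * g x' y') with
      ((f x y - f x' y') * g x y + f x' y' * (g x y - g x' y')) by ring.
    apply Rle_trans with (1 := Rabs_triang _ _). rewrite !Rabs_mult.
    set (d := Rabs (x - x') + Rabs (y - y')).
    replace ((L * M' + M * L') * d) with ((L * d) * M' + M * (L' * d)) by ring.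
    apply Rplus_le_compat; apply Rmult_le_compat; try apply Rabs_pos;
      [apply lf | apply bg | apply bf | apply lg]; assumption.
  - intros x y h1 h2. rewrite Rabs_mult. apply Rmult_le_compat; auto using Rabs_pos.
Qed.

Lemma box_regular_minus (f g : R -> R -> R) :
  box_regular f -> box_regular g -> box_regular (fun x y => f x y - g x y).
Proof.
  intros hf hg.
  destruct (box_regular_plus f _ hf (box_regular_mult _ _ (box_regular_const (-1)) hg))
    as (M & L & hM & hL & l & bd).
  exists M, L. split; [exact hM |]. split; [exact hL |]. split.
  - intros x y x' y' h1 h2 h3 h4. specialize (l x y x' y' h1 h2 h3 h4). cbv beta in l.
    replace (f x y - g x y - (f x' y' - g x' y')) with
      (f x y + -1 * g x y - (f x' y' + -1 * g x' y')) by ring. exact l.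
  - intros x y h1 h2. specialize (bd x y h1 h2). cbv beta in bd.
    replace (f x y - g x y) with (f x y + -1 * g x y) by ring. exact bd.
Qed.

Lemma box_regular_pow (f : R -> R -> R) (n : nat) :
  box_regular f -> box_regular (fun x y => f x y ^ n).
Proof.
  intros hf. induction n as [| n IH]; simpl.
  - apply box_regular_const.
  - apply box_regular_mult; assumption.
Qed.

(** * The system *)

Definition field_x (a x y : R) : R := x * y ^ 2 - y ^ 3 + a * x ^ 5.
Definition field_y (x y : R) : R := 2 * x ^ 7 - x ^ 4 * y + 4 * x * y ^ 2 + y ^ 3.

(* [energy] is the common size of [thA'] and [thB'].  The prefix [outer] refers to the
   edge of weights (1,1), where y ~ x, and [inner] to the edge of weights (1,3), where
   y ~ x^3. *)
Definition energy (x y : R) : R := x ^ 4 + y ^ 2.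
Definition outer_form (x y : R) : R := 4 * x ^ 2 + y ^ 2.
Definition inner_form (a x y : R) : R := 4 * y ^ 2 - (1 + 3 * a) * x ^ 3 * y + 2 * x ^ 6.

Lemma norm2_ge0 (x y : R) : 0 <= norm2 x y.
Proof. unfold norm2. pose proof (pow2_ge_0 x); pose proof (pow2_ge_0 y); lra. Qed.

Lemma pow4_ge0 (x : R) : 0 <= x ^ 4.
Proof. replace (x ^ 4) with ((x ^ 2) ^ 2) by ring. apply pow2_ge_0. Qed.

Lemma energy_ge0 (x y : R) : 0 <= energy x y.
Proof. unfold energy. pose proof (pow4_ge0 x); pose proof (pow2_ge_0 y); lra. Qed.

Lemma outer_form_bounds (x y : R) : norm2 x y <= outer_form x y <= 4 * norm2 x y.
Proof. unfold norm2, outer_form. pose proof (pow2_ge_0 x); pose proof (pow2_ge_0 y); lra. Qed.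

Lemma nonzero_cases (x y : R) : 0 < norm2 x y -> x <> 0 \/ y <> 0.
Proof.
  intros h. destruct (Req_dec x 0) as [-> |]; [| auto].
  destruct (Req_dec y 0) as [-> |]; [| auto]. unfold norm2 in h. lra.
Qed.

Lemma energy_gt0 (x y : R) : 0 < norm2 x y -> 0 < energy x y.
Proof.
  intros h. unfold energy. pose proof (pow4_ge0 x); pose proof (pow2_ge_0 y).
  destruct (nonzero_cases x y h) as [hx | hy].
  - assert (0 < x ^ 4); [| lra]. replace (x ^ 4) with ((x ^ 2) ^ 2) by ring.
    apply pow2_gt_0, pow_nonzero, hx.
  - pose proof (pow2_gt_0 y hy). lra.
Qed.

Lemma x2y_le_energy (x y : R) : 2 * Rabs (x ^ 2 * y) <= energy x y.
Proof.
  unfold energy. pose proof (pow2_ge_0 (x ^ 2 - y)). pose proof (pow2_ge_0 (x ^ 2 + y)).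
  assert (Rabs (x ^ 2 * y) <= energy x y / 2); [| unfold energy in *; lra].
  unfold energy. apply Rabs_le. split; nra.
Qed.

Lemma xy_le_norm2 (x y : R) : 2 * Rabs (x * y) <= norm2 x y.
Proof.
  assert (Rabs (x * y) <= norm2 x y / 2); [| lra].
  pose proof (pow2_ge_0 (x - y)). pose proof (pow2_ge_0 (x + y)).
  unfold norm2. apply Rabs_le. split; nra.
Qed.

Lemma near_le_1 : near_origin (fun x y => Rabs x <= 1 /\ Rabs y <= 1).
Proof.
  apply near_impl with (2 := near_radius 1 Rlt_0_1). intros x y _ h.
  destruct (abs_le_radius x y). lra.
Qed.

(** A scale of orders, smaller than [energy] by one, two and three powers of the radius. Remainders
    of order [z1] are negligible against the leading rates; when these cancel, the comparison is
    made at order [z2] and terms of order [z3] become negligible. *)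
Definition z1 (x y : R) : R := radius x y * energy x y.
Definition z2 (x y : R) : R := norm2 x y * energy x y.
Definition z3 (x y : R) : R := radius x y * z2 x y.

Lemma z2_ge0 (x y : R) : 0 <= z2 x y.
Proof. apply Rmult_le_pos; [apply norm2_ge0 | apply energy_ge0]. Qed.

Lemma bigO_x3y : bigO (fun x y => x ^ 3 * y) z1.
Proof.
  apply bigO_global with 1; [lra |]. intros x y _. rewrite Rmult_1_l.
  replace (x ^ 3 * y) with (x * (x ^ 2 * y)) by ring. rewrite Rabs_mult.
  apply Rmult_le_compat; auto using Rabs_pos.
  - apply abs_le_radius.
  - pose proof (x2y_le_energy x y). pose proof (Rabs_pos (x ^ 2 * y)). lra.
Qed.

Lemma x2_le_norm2 (x y : R) : Rabs (x ^ 2) <= norm2 x y.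
Proof.
  rewrite Rabs_right by (apply Rle_ge, pow2_ge_0).
  unfold norm2. pose proof (pow2_ge_0 y). lra.
Qed.

Lemma bigO_x5y_z3 : bigO (fun x y => x ^ 5 * y) z3.
Proof.
  apply bigO_global with 1; [lra |]. intros x y _. rewrite Rmult_1_l.
  replace (x ^ 5 * y) with (x * (x ^ 2 * (x ^ 2 * y))) by ring. rewrite !(Rabs_mult x),
    (Rabs_mult (x ^ 2) (x ^ 2 * y)).
  repeat apply Rmult_le_compat; auto using Rabs_pos.
  - apply Rmult_le_pos; apply Rabs_pos.
  - apply abs_le_radius.
  - apply x2_le_norm2.
  - pose proof (x2y_le_energy x y). pose proof (Rabs_pos (x ^ 2 * y)). lra.
Qed.

Lemma bigO_z3_z2 (u : R -> R -> R) : bigO u z3 -> bigO u z2.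
Proof.
  intros (K & hK & h). exists K. split; [exact hK |].
  apply near_impl with (2 := near_and _ _ h (near_radius 1 Rlt_0_1)).
  intros x y _ [h1 h2]. apply Rle_trans with (1 := h1).
  apply Rmult_le_compat_l; [exact hK |]. unfold z3.
  rewrite <- (Rmult_1_l (z2 x y)) at 2. apply Rmult_le_compat_r; [apply z2_ge0 | lra].
Qed.

Lemma bigO_z2_z1 (u : R -> R -> R) : bigO u z2 -> bigO u z1.
Proof. apply bigO_radius, energy_ge0. Qed.

Lemma bigO_x5y : bigO (fun x y => x ^ 5 * y) z2.
Proof. apply bigO_z3_z2, bigO_x5y_z3. Qed.

Lemma abs_le_energy (x y : R) : Rabs (x ^ 4) <= energy x y /\ Rabs (y ^ 2) <= energy x y.
Proof.
  pose proof (pow4_ge0 x); pose proof (pow2_ge_0 y). unfold energy.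
  rewrite !Rabs_right by lra. lra.
Qed.

Lemma bigO_x2y2 : bigO (fun x y => x ^ 2 * y ^ 2) z2.
Proof.
  apply bigO_global with 1; [lra |]. intros x y _. rewrite Rmult_1_l, Rabs_mult.
  apply Rmult_le_compat; auto using Rabs_pos; [apply x2_le_norm2 | apply abs_le_energy].
Qed.

Lemma bigO_x6 : bigO (fun x y => x ^ 6) z2.
Proof.
  apply bigO_global with 1; [lra |]. intros x y _. rewrite Rmult_1_l.
  replace (x ^ 6) with (x ^ 2 * x ^ 4) by ring. rewrite Rabs_mult.
  apply Rmult_le_compat; auto using Rabs_pos; [apply x2_le_norm2 | apply abs_le_energy].
Qed.

Lemma bigO_xy3 : bigO (fun x y => x * y ^ 3) z2.
Proof.
  apply bigO_global with 1; [lra |]. intros x y _. rewrite Rmult_1_l.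
  replace (x * y ^ 3) with (x * y * y ^ 2) by ring. rewrite Rabs_mult.
  apply Rmult_le_compat; auto using Rabs_pos; [| apply abs_le_energy].
  pose proof (xy_le_norm2 x y). pose proof (Rabs_pos (x * y)). lra.
Qed.

Lemma bigO_outer_ratio : bigO (fun x y => x ^ 2 / outer_form x y) (fun _ _ => 1).
Proof.
  apply bigO_global with 1; [lra |]. intros x y h. pose proof (outer_form_bounds x y).
  pose proof (x2_le_norm2 x y) as hx. unfold Rdiv. rewrite Rabs_mult, Rabs_inv.
  rewrite (Rabs_right (outer_form x y)) by lra.
  apply Rmult_le_reg_r with (outer_form x y); [lra |].
  rewrite Rmult_assoc, Rinv_l by lra. lra.
Qed.

Section System.

Variables a Delta : R.
Hypothesis Delta_gt0 : 0 < Delta.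
Hypothesis Delta_sq : Delta ^ 2 = 32 - (1 + 3 * a) ^ 2.

Let P := field_x a.
Let Q := field_y.
Let S := inner_form a.

(** Completing the square with [b = 1 + 3a] gives [8 S = Delta^2 y^2 + (b y - 4 x^3)^2], and
    likewise [16 S = Delta^2 x^6 + (8 y - b x^3)^2]: as a quadratic form in [y] and [x^3], [S] is
    definite because [Delta^2 > 0]. *)
Lemma inner_form_ge_y (x y : R) : Delta ^ 2 * y ^ 2 <= 8 * S x y.
Proof.
  unfold S, inner_form. rewrite Delta_sq.
  pose proof (pow2_ge_0 ((1 + 3 * a) * y - 4 * x ^ 3)). nra.
Qed.

Lemma inner_form_ge_x (x y : R) : Delta ^ 2 * x ^ 6 <= 16 * S x y.
Proof.
  unfold S, inner_form. rewrite Delta_sq.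
  pose proof (pow2_ge_0 (8 * y - (1 + 3 * a) * x ^ 3)). nra.
Qed.

Lemma Delta_sq_gt0 : 0 < Delta ^ 2.
Proof. apply pow_lt; exact Delta_gt0. Qed.

Lemma inner_form_gt0 (x y : R) : 0 < norm2 x y -> 0 < S x y.
Proof.
  intros h. pose proof (inner_form_ge_x x y) as hx. pose proof (inner_form_ge_y x y) as hy.
  pose proof Delta_sq_gt0.
  destruct (nonzero_cases x y h) as [e | e].
  - assert (0 < x ^ 6).
    { replace (x ^ 6) with ((x ^ 3) ^ 2) by ring. apply pow2_gt_0, pow_nonzero, e. }
    nra.
  - pose proof (pow2_gt_0 y e). nra.
Qed.

Lemma bigO_y2_inner : bigO (fun x y => y ^ 2 / S x y) (fun _ _ => 1).
Proof.
  pose proof Delta_sq_gt0 as hD.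
  apply bigO_global with (8 / Delta ^ 2); [apply Rlt_le, Rdiv_lt_0_compat; lra |].
  intros x y h. pose proof (inner_form_gt0 x y h) as hS. pose proof (inner_form_ge_y x y).
  rewrite Rabs_right.
  - apply Rmult_le_reg_r with (S x y * Delta ^ 2); [apply Rmult_lt_0_compat; lra |].
    replace (y ^ 2 / S x y * (S x y * Delta ^ 2)) with (Delta ^ 2 * y ^ 2) by (field; lra).
    replace (8 / Delta ^ 2 * 1 * (S x y * Delta ^ 2)) with (8 * S x y) by (field; lra). lra.
  - apply Rle_ge, Rmult_le_pos; [apply pow2_ge_0 | left; apply Rinv_0_lt_compat; lra].
Qed.

Lemma bigO_x6_inner : bigO (fun x y => x ^ 6 / S x y) (fun _ _ => 1).
Proof.
  pose proof Delta_sq_gt0 as hD.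
  apply bigO_global with (16 / Delta ^ 2); [apply Rlt_le, Rdiv_lt_0_compat; lra |].
  intros x y h. pose proof (inner_form_gt0 x y h) as hS. pose proof (inner_form_ge_x x y).
  rewrite Rabs_right.
  - apply Rmult_le_reg_r with (S x y * Delta ^ 2); [apply Rmult_lt_0_compat; lra |].
    replace (x ^ 6 / S x y * (S x y * Delta ^ 2)) with (Delta ^ 2 * x ^ 6) by (field; lra).
    replace (16 / Delta ^ 2 * 1 * (S x y * Delta ^ 2)) with (16 * S x y) by (field; lra). lra.
  - apply Rle_ge, Rmult_le_pos; [| left; apply Rinv_0_lt_compat; lra].
    replace (x ^ 6) with ((x ^ 3) ^ 2) by ring. apply pow2_ge_0.
Qed.

Lemma bigO_x3y_inner : bigO (fun x y => x ^ 3 * y / S x y) (fun _ _ => 1).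
Proof.
  destruct (bigO_plus _ _ _ bigO_y2_inner bigO_x6_inner) as (K & hK & h).
  exists K. split; [exact hK |]. apply near_impl with (2 := h). intros x y hn hle.
  pose proof (inner_form_gt0 x y hn) as hS. apply Rle_trans with (2 := hle).
  apply Rle_trans with (2 := Rle_abs _).
  rewrite <- Rdiv_plus_distr. unfold Rdiv. rewrite Rabs_mult, Rabs_inv, (Rabs_right (S x y)) by
    lra.
  apply Rmult_le_compat_r; [left; apply Rinv_0_lt_compat; lra |].
  pose proof (pow2_ge_0 (x ^ 3 - y)). pose proof (pow2_ge_0 (x ^ 3 + y)).
  pose proof (pow2_ge_0 (x ^ 3)). pose proof (pow2_ge_0 y).
  apply Rabs_le. split; nra.
Qed.

Definition rot (x y : R) : R := x * field_y x y - y * field_x a x y.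
(** The exact value of [thB']; only its first term is of leading order. *)
Definition inner_rate (x y : R) : R :=
  Delta / 2 * (x ^ 4 + x ^ 2 * (3 * y ^ 4 - 2 * x * y ^ 3) / inner_form a x y).
Definition outer_radial (x y : R) : R := 4 * x * field_x a x y + y * field_y x y.

(** The dot product of [(x, y)] with the vector that defines [thB] is [Delta x^4 + 8 y^2] up to a
    multiple of [x^3 y], which is smaller by a factor [radius]. The two vectors thus form an acute
    angle, so their angles differ by a single valued function. *)
Lemma near_dot_pos : near_origin (fun x y =>
  0 < x * (Delta * x ^ 3) + y * (8 * y - (1 + 3 * a) * x ^ 3)).
Proof.
  set (k := Rmin Delta 8). assert (hk : 0 < k) by (apply Rmin_pos; lra).
  assert (h : bigO (fun x y => (1 + 3 * a) * (x ^ 3 * y)) z1).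
  { apply (bigO_scale (fun _ _ => 1 + 3 * a)); [apply bigO_const | apply bigO_x3y]. }
  apply bigO_small with (k := k / 2) in h; [| lra | apply energy_ge0].
  apply near_impl with (2 := h). intros x y hn hb.
  pose proof (energy_gt0 x y hn). apply Rabs_le_between in hb.
  assert (k * energy x y <= Delta * x ^ 4 + 8 * y ^ 2).
  { unfold energy. pose proof (pow4_ge0 x); pose proof (pow2_ge_0 y).
    pose proof (Rmin_l Delta 8 : k <= Delta). pose proof (Rmin_r Delta 8 : k <= 8). nra. }
  assert (0 < k * energy x y) by (apply Rmult_lt_0_compat; lra).
  replace (x * (Delta * x ^ 3) + y * (8 * y - (1 + 3 * a) * x ^ 3)) with
    (Delta * x ^ 4 + 8 * y ^ 2 - (1 + 3 * a) * (x ^ 3 * y)) by ring.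
  lra.
Qed.

(** For [lam = 1] this is [thB] minus the ordinary polar angle, which serves to count turns; for
    [lam = 2] it is [thB - thA], which enters the Lyapunov functions. *)
Definition inner_angle (lam x y : R) : R :=
  angle_between (lam * x) y (Delta * x ^ 3) (8 * y - (1 + 3 * a) * x ^ 3).

Lemma inner_angle_orbital (lam rho : R) :
  1 <= lam ->
  (forall x y, 0 < norm2 x y < rho ->
     0 < x * (Delta * x ^ 3) + y * (8 * y - (1 + 3 * a) * x ^ 3)) ->
  orbital_derivative P Q rho (inner_angle lam)
    (fun x y => inner_rate x y - lam * rot x y / (lam ^ 2 * x ^ 2 + y ^ 2)).
Proof.
  intros hlam hdot s x y t hx hy hn. specialize (hdot _ _ hn).
  assert (dxl : is_derive (fun u => lam * x u) t (lam * (s * P (x t) (y t)))).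
  { apply (is_derive_scal x); exact hx. }
  assert (d3 : is_derive (fun u => Delta * x u ^ 3) t (Delta * (3 * x t ^ 2 * (s * P (x t) (y
    t))))).
  { auto_derive; [eexists; eassumption |]. change (fun x0 => x x0) with x.
    rewrite (is_derive_unique _ _ _ hx). ring. }
  assert (d4 : is_derive (fun u => 8 * y u - (1 + 3 * a) * x u ^ 3) t
    (8 * (s * Q (x t) (y t)) - (1 + 3 * a) * (3 * x t ^ 2 * (s * P (x t) (y t))))).
  { auto_derive; [repeat split; eexists; eassumption |].
    change (fun x0 => x x0) with x. change (fun x0 => y x0) with y.
    rewrite (is_derive_unique _ _ _ hx), (is_derive_unique _ _ _ hy). ring. }
  assert (hpos : 0 < lam * x t * (Delta * x t ^ 3) + y t * (8 * y t - (1 + 3 * a) * x t ^ 3)).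
  { pose proof (pow4_ge0 (x t)).
    assert (0 <= (lam - 1) * (Delta * x t ^ 4)) by (apply Rmult_le_pos; [lra | apply
      Rmult_le_pos; lra]). lra. }
  apply is_derive_eq with (1 := is_derive_angle_between _ _ _ _ t _ _ _ _ dxl hy d3 d4 hpos).
  cbv beta. set (X := x t) in *. set (Y := y t) in *.
  replace ((Delta * X ^ 3) ^ 2 + (8 * Y - (1 + 3 * a) * X ^ 3) ^ 2) with (16 * inner_form a X Y).
  2: { unfold inner_form. rewrite Rpow_mult_distr, Delta_sq. ring. }
  pose proof (inner_form_gt0 X Y (proj1 hn)) as hS. unfold S in hS.
  assert (hl : 0 < lam ^ 2 * X ^ 2 + Y ^ 2).
  { pose proof (proj1 hn) as h. unfold norm2 in h. pose proof (pow2_ge_0 X).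
    assert (1 <= lam ^ 2) by nra. nra. }
  replace (8 * (s * Q X Y) - (1 + 3 * a) * (3 * X ^ 2 * (s * P X Y))) with
    (s * (8 * Q X Y - (1 + 3 * a) * (3 * X ^ 2 * P X Y))) by ring.
  unfold inner_rate, rot, P, Q.
  replace (Delta * X ^ 3 * (s * (8 * field_y X Y - (1 + 3 * a) * (3 * X ^ 2 * field_x a X Y))) -
    (8 * Y - (1 + 3 * a) * X ^ 3) * (Delta * (3 * X ^ 2 * (s * field_x a X Y)))) with
    (s * (8 * Delta * X ^ 2 * (X ^ 2 * inner_form a X Y - 2 * X * Y ^ 3 + 3 * Y ^ 4))).
  2: { unfold field_x, field_y, inner_form. ring. }
  rewrite Rpow_mult_distr.
  set (p := field_x a X Y). set (q := field_y X Y). set (SS := inner_form a X Y) in *.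
  field. split; lra.
Qed.

Lemma inner_angle_bound (lam x y : R) : Rabs (inner_angle lam x y) <= PI / 2.
Proof. apply angle_between_bound. Qed.

Lemma abs_1a_le : Rabs (1 + a) <= 3.
Proof. pose proof Delta_sq_gt0. apply Rabs_le. split; nra. Qed.

(** The square of [x^4 - (1+a)/2 * x y] absorbs the cross term at the cost of
    [(1+a)^2/4 * x^2 y^2 <= 9/4 * x^2 y^2], which the available [4 x^2 y^2] covers. What remains is
    at least [x^8 + y^4], and 1/8 comes from two applications of the inequality between power means
    together with [y^8 <= y^4]. *)
Lemma rotation_lower_bound (x y : R) : 0 < norm2 x y < 1 -> 1 / 8 * norm2 x y ^ 4 <= rot x y.
Proof.
  intros [_ hn].
  assert (hr : rot x y = y ^ 2 * (4 * x ^ 2 + y ^ 2) + 2 * x ^ 8 - (1 + a) * x ^ 5 * y).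
  { unfold rot, field_x, field_y. ring. }
  pose proof (pow2_ge_0 (x ^ 4 - (1 + a) / 2 * (x * y))) as h1.
  pose proof abs_1a_le as ha. apply Rabs_le_between in ha.
  assert (h2 : (1 + a) ^ 2 * (x * y) ^ 2 <= 9 * (x * y) ^ 2).
  { apply Rmult_le_compat_r; [apply pow2_ge_0 | nra]. }
  assert (h3 : 0 <= (x * y) ^ 2) by apply pow2_ge_0.
  assert (h4 : y ^ 4 + x ^ 8 <= rot x y) by (rewrite hr; nra).
  unfold norm2 in *. pose proof (pow2_ge_0 x). pose proof (pow2_ge_0 y).
  assert (h5 : (x ^ 2 + y ^ 2) ^ 2 <= 2 * (x ^ 4 + y ^ 4)).
  { pose proof (pow2_ge_0 (x ^ 2 - y ^ 2)). nra. }
  assert (h6 : (x ^ 2 + y ^ 2) ^ 4 <= (2 * (x ^ 4 + y ^ 4)) ^ 2).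
  { replace ((x ^ 2 + y ^ 2) ^ 4) with (((x ^ 2 + y ^ 2) ^ 2) ^ 2) by ring.
    apply pow_incr. split; [apply pow2_ge_0 | exact h5]. }
  assert (h7 : (x ^ 4 + y ^ 4) ^ 2 <= 2 * (x ^ 8 + y ^ 8)).
  { pose proof (pow2_ge_0 (x ^ 4 - y ^ 4)). nra. }
  assert (h8 : y ^ 8 <= y ^ 4).
  { replace (y ^ 8) with (y ^ 4 * y ^ 4) by ring. pose proof (pow4_ge0 y).
    assert (y ^ 4 <= 1); [| nra]. replace (y ^ 4) with ((y ^ 2) ^ 2) by ring.
    rewrite <- (pow1 2). apply pow_incr; lra. }
  lra.
Qed.

Lemma inner_rate_expansion : bigO (fun x y => inner_rate x y - Delta / 2 * x ^ 4) z1.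
Proof.
  apply bigO_ext with (fun x y => Delta / 2 * (y ^ 2 / S x y * (3 * (x ^ 2 * y ^ 2) - 2 * (x ^ 3
    * y)))).
  - exists 1. split; [lra |]. intros x y [hn _]. pose proof (inner_form_gt0 x y hn) as hS.
    unfold inner_rate, S in *. field. lra.
  - apply (bigO_scale (fun _ _ => _)); [apply bigO_const |].
    apply (bigO_scale (fun x y => y ^ 2 / S x y)); [apply bigO_y2_inner |].
    apply bigO_minus; apply (bigO_scale (fun _ _ => _)); try apply bigO_const.
    + apply bigO_z2_z1, bigO_x2y2.
    + apply bigO_x3y.
Qed.

(** Neither angle alone keeps pace with [energy]: the polar angle accounts for the part [y^2], and
    [thB] for the part [x^4], which takes over near the x-axis. Everything else is a multiple of
    [x^3 y] or smaller. *)
Lemma rotation_rate_lower_bound : exists mu, 0 < mu /\ near_origin (fun x y =>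
  mu * energy x y <= rot x y / norm2 x y + inner_rate x y).
Proof.
  set (mu := Rmin 1 (Delta / 2)). assert (hmu : 0 < mu) by (apply Rmin_pos; lra).
  exists (mu / 2). split; [lra |].
  assert (h : bigO (fun x y => inner_rate x y - Delta / 2 * x ^ 4 - 3 * Rabs (x ^ 3 * y)) z1).
  { apply bigO_minus; [apply inner_rate_expansion |].
    apply (bigO_scale (fun _ _ => 3)); [apply bigO_const |].
    destruct bigO_x3y as (K & hK & h). exists K. split; [exact hK |].
    apply near_impl with (2 := h). intros x y _. rewrite Rabs_Rabsolu. auto. }
  apply bigO_small with (k := mu / 2) in h; [| lra | apply energy_ge0].
  apply near_impl with (2 := h). intros x y hn hb. apply Rabs_le_between in hb.
  assert (hrot : y ^ 2 - 3 * Rabs (x ^ 3 * y) <= rot x y / norm2 x y).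
  { apply Rmult_le_reg_r with (norm2 x y); [exact hn |].
    unfold Rdiv. rewrite (Rmult_assoc (rot x y)), Rinv_l, Rmult_1_r by lra.
    assert (hr : rot x y = y ^ 2 * (4 * x ^ 2 + y ^ 2) + 2 * x ^ 8 - x ^ 2 * ((1 + a) * (x ^ 3 *
      y))).
    { unfold rot, field_x, field_y. ring. }
    rewrite hr. unfold norm2.
    assert (hab : (1 + a) * (x ^ 3 * y) <= 3 * Rabs (x ^ 3 * y)).
    { apply Rle_trans with (1 := Rle_abs _). rewrite Rabs_mult.
      apply Rmult_le_compat_r; [apply Rabs_pos | apply abs_1a_le]. }
    pose proof (pow2_ge_0 x) as p1. pose proof (pow2_ge_0 y) as p2.
    pose proof (Rabs_pos (x ^ 3 * y)) as p3.
    set (A := Rabs (x ^ 3 * y)) in *.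
    pose proof (Rmult_le_compat_l _ _ _ p1 hab).
    pose proof (Rmult_le_pos _ _ p1 p2). pose proof (Rmult_le_pos _ _ p2 p3).
    pose proof (pow2_ge_0 (x ^ 4)). nra. }
  assert (mu * energy x y <= y ^ 2 + Delta / 2 * x ^ 4).
  { unfold energy. pose proof (pow4_ge0 x); pose proof (pow2_ge_0 y).
    pose proof (Rmin_l 1 (Delta / 2) : mu <= 1).
    pose proof (Rmin_r 1 (Delta / 2) : mu <= Delta / 2). nra. }
  lra.
Qed.

(** In [x P + y Q] both [y^2] and [x^4] come with a cofactor of size [norm2], which the division
    removes. The constant is the sum of the two coefficients obtained, 5 and [4 + 2 |a|]. *)
Lemma radial_upper_bound (x y : R) : 0 < norm2 x y < 1 ->
  Rabs (2 * (x * P x y + y * Q x y) / norm2 x y) <= (9 + 2 * Rabs a) * energy x y.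
Proof.
  intros [hn hn1].
  assert (he : x * P x y + y * Q x y =
    y ^ 2 * (norm2 x y + 3 * (x * y)) + x ^ 4 * (a * x ^ 2 + 2 * (x ^ 2 * (x * y)) - y ^ 2)).
  { unfold P, Q, field_x, field_y, norm2. ring. }
  unfold Rdiv. rewrite Rabs_mult, Rabs_inv, (Rabs_right (norm2 x y)) by lra.
  apply Rmult_le_reg_r with (norm2 x y); [exact hn |].
  rewrite Rmult_assoc, Rinv_l, Rmult_1_r by lra. rewrite he.
  pose proof (xy_le_norm2 x y) as hxy. pose proof (x2_le_norm2 x y) as hx2.
  rewrite Rabs_right in hx2 by (apply Rle_ge, pow2_ge_0).
  assert (hy2 : y ^ 2 <= norm2 x y) by (unfold norm2; pose proof (pow2_ge_0 x); lra).
  pose proof (pow2_ge_0 x) as px. pose proof (pow2_ge_0 y) as py. pose proof (pow4_ge0 x) as p4.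
  set (n := norm2 x y) in *. set (w := x * y) in *.
  assert (h1 : Rabs (n + 3 * w) <= 5 / 2 * n).
  { apply Rle_trans with (1 := Rabs_triang _ _). rewrite Rabs_mult, (Rabs_right n), (Rabs_right
      3) by lra. lra. }
  assert (h2 : Rabs (a * x ^ 2 + 2 * (x ^ 2 * w) - y ^ 2) <= (Rabs a + 2) * n).
  { unfold Rminus. apply Rle_trans with (1 := Rabs_triang _ _).
    rewrite Rabs_Ropp, (Rabs_right (y ^ 2)) by lra.
    apply Rle_trans with (Rabs (a * x ^ 2) + Rabs (2 * (x ^ 2 * w)) + y ^ 2).
    - apply Rplus_le_compat_r, Rabs_triang.
    - rewrite !Rabs_mult, (Rabs_right (x ^ 2)), (Rabs_right 2) by lra.
      pose proof (Rabs_pos a). pose proof (Rabs_pos w).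
      assert (Rabs a * x ^ 2 <= Rabs a * n) by (apply Rmult_le_compat_l; lra).
      assert (x ^ 2 * Rabs w <= 1 * (n / 2)) by (apply Rmult_le_compat; lra).
      lra. }
  rewrite Rabs_mult, (Rabs_right 2) by lra.
  apply Rle_trans with (2 * (y ^ 2 * (5 / 2 * n) + x ^ 4 * ((Rabs a + 2) * n))).
  - apply Rmult_le_compat_l; [lra |]. apply Rle_trans with (1 := Rabs_triang _ _).
    rewrite !Rabs_mult, (Rabs_right (y ^ 2)), (Rabs_right (x ^ 4)) by lra.
    apply Rplus_le_compat; apply Rmult_le_compat_l; lra.
  - unfold energy. pose proof (Rabs_pos a).
    assert (0 <= (4 + 2 * Rabs a) * (y ^ 2 * n)) by (apply Rmult_le_pos; [lra | apply
      Rmult_le_pos; lra]).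
    assert (0 <= x ^ 4 * n) by (apply Rmult_le_pos; lra).
    nra.
Qed.

Lemma norm2_sq_le_energy (x y : R) : norm2 x y < 1 -> norm2 x y ^ 2 <= 2 * energy x y.
Proof.
  intros h. unfold norm2, energy in *.
  pose proof (pow2_ge_0 x). pose proof (pow2_ge_0 y). pose proof (pow2_ge_0 (x ^ 2 - y ^ 2)).
  assert (y ^ 4 <= y ^ 2) by nra. nra.
Qed.

Lemma field_x_regular : box_regular P.
Proof.
  unfold P, field_x.
  apply (box_regular_plus (fun x y => x * y ^ 2 - y ^ 3) (fun x y => a * x ^ 5)).
  - apply (box_regular_minus (fun x y => x * y ^ 2) (fun x y => y ^ 3)).
    + apply (box_regular_mult (fun x y => x) (fun x y => y ^ 2)).
      * apply box_regular_fst.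
      * apply (box_regular_pow (fun x y => y)), box_regular_snd.
    + apply (box_regular_pow (fun x y => y)), box_regular_snd.
  - apply (box_regular_mult (fun x y => a) (fun x y => x ^ 5)); [apply box_regular_const |].
    apply (box_regular_pow (fun x y => x)), box_regular_fst.
Qed.

Lemma field_y_regular : box_regular Q.
Proof.
  unfold Q, field_y.
  apply (box_regular_plus (fun x y => 2 * x ^ 7 - x ^ 4 * y + 4 * x * y ^ 2) (fun x y => y ^ 3)).
  - apply (box_regular_plus (fun x y => 2 * x ^ 7 - x ^ 4 * y) (fun x y => 4 * x * y ^ 2)).
    + apply (box_regular_minus (fun x y => 2 * x ^ 7) (fun x y => x ^ 4 * y)).
      * apply (box_regular_mult (fun x y => 2) (fun x y => x ^ 7)); [apply box_regular_const |].
        apply (box_regular_pow (fun x y => x)), box_regular_fst.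
      * apply (box_regular_mult (fun x y => x ^ 4) (fun x y => y)); [| apply box_regular_snd].
        apply (box_regular_pow (fun x y => x)), box_regular_fst.
    + apply (box_regular_mult (fun x y => 4 * x) (fun x y => y ^ 2)).
      * apply (box_regular_mult (fun x y => 4) (fun x y => x));
          [apply box_regular_const | apply box_regular_fst].
      * apply (box_regular_pow (fun x y => y)), box_regular_snd.
  - apply (box_regular_pow (fun x y => y)), box_regular_snd.
Qed.

(** With [D = inner_angle 1], [2 theta + D] is the polar angle plus [thB]: it moves at least as fast
    as [mu * energy], and the radius at most as fast as [(9 + 2 |a|) * energy]. Only a Lyapunov
    function remains to be found. The lower bound [norm2 ^ 3] on its rate is weak enough to follow
    from [z2], as the degenerate case requires. *)
Lemma focus_criterion (W W' : R -> R -> R) (sg c : R) :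
  sg = 1 \/ sg = -1 -> 0 < c ->
  (exists rho, 0 < rho /\ orbital_derivative P Q rho W W') ->
  bigO (fun x y => W x y - ln (norm2 x y) / 2) (fun _ _ => 1) ->
  near_origin (fun x y => c * norm2 x y ^ 3 <= sg * W' x y) -> is_focus P Q.
Proof.
  intros hsg hc (r0 & hr0 & horb) (CW & hCW & (r1 & hr1 & hW)) (r2 & hr2 & hdec).
  destruct near_dot_pos as (r3 & hr3 & hdot).
  destruct rotation_rate_lower_bound as (mu & hmu & (r4 & hr4 & hrate)).
  destruct field_x_regular as (M1 & L1 & _ & hL1 & l1 & _).
  destruct field_y_regular as (M2 & L2 & _ & hL2 & l2 & _).
  assert (lip : forall H L', L' <= L1 + L2 + 1 -> box_lipschitz L' H ->
            box_lipschitz (L1 + L2 + 1) H).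
  { intros H L' hle hH x y x' y' b1 b2 b3 b4. apply Rle_trans with (1 := hH x y x' y' b1 b2 b3
      b4).
    apply Rmult_le_compat_r; [| exact hle].
    apply Rplus_le_le_0_compat; apply Rabs_pos. }
  set (rho := Rmin (1 / 2) (Rmin r0 (Rmin r1 (Rmin r2 (Rmin r3 r4))))).
  assert (hrho : 0 < rho) by (unfold rho; repeat apply Rmin_pos; lra).
  assert (le1 : rho <= 1 / 2) by apply Rmin_l.
  assert (tail : rho <= Rmin r0 (Rmin r1 (Rmin r2 (Rmin r3 r4)))) by apply Rmin_r.
  pose proof (Rmin_l r0 (Rmin r1 (Rmin r2 (Rmin r3 r4)))).
  pose proof (Rmin_r r0 (Rmin r1 (Rmin r2 (Rmin r3 r4)))).
  pose proof (Rmin_l r1 (Rmin r2 (Rmin r3 r4))). pose proof (Rmin_r r1 (Rmin r2 (Rmin r3 r4))).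
  pose proof (Rmin_l r2 (Rmin r3 r4)). pose proof (Rmin_r r2 (Rmin r3 r4)).
  pose proof (Rmin_l r3 r4). pose proof (Rmin_r r3 r4).
  apply (lyapunov_focus P Q (inner_angle 1)
    (fun x y => inner_rate x y - 1 * rot x y / (1 ^ 2 * x ^ 2 + y ^ 2)) W W' (L1 + L2 + 1) rho
      (1 / 8) c
    ((9 + 2 * Rabs a) / mu) (PI / 2) CW) with (sg := sg).
  - lra.
  - apply lip with L1; [lra | exact l1].
  - apply lip with L2; [lra | exact l2].
  - unfold P, field_x. ring.
  - unfold Q, field_y. ring.
  - lra.
  - lra.
  - intros x y hn. apply rotation_lower_bound. lra.
  - intros x y _. apply inner_angle_bound.
  - apply inner_angle_orbital; [lra |]. intros x y hn. apply hdot. lra.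
  - apply Rdiv_lt_0_compat; [pose proof (Rabs_pos a); lra | exact hmu].
  - intros x y hn. apply Rle_trans with ((9 + 2 * Rabs a) * energy x y).
    + apply radial_upper_bound. lra.
    + specialize (hrate x y ltac:(lra)).
      replace (2 * ((x * Q x y - y * P x y) / norm2 x y) +
        (inner_rate x y - 1 * rot x y / (1 ^ 2 * x ^ 2 + y ^ 2))) with
        (rot x y / norm2 x y + inner_rate x y).
      * unfold Rdiv at 1. rewrite Rmult_assoc. apply Rmult_le_compat_l.
        { pose proof (Rabs_pos a); lra. }
        apply Rmult_le_reg_l with mu; [exact hmu |].
        rewrite <- Rmult_assoc, Rinv_r, Rmult_1_l by lra. exact hrate.
      * change (x * Q x y - y * P x y) with (rot x y).
        replace (1 ^ 2 * x ^ 2 + y ^ 2) with (norm2 x y) by (unfold norm2; ring).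
        field. lra.
  - exact hc.
  - intros x y hn. specialize (hW x y ltac:(lra)). lra.
  - apply orbital_derivative_le with r0; [lra | exact horb].
  - exact hsg.
  - intros x y hn. apply hdec. lra.
Qed.

(** * The Lyapunov function built on the two angles, and the case a + Delta/4 <> 0 *)

Definition outer_rate (gam x y : R) : R :=
  outer_radial x y / outer_form x y + gam * (inner_rate x y - 2 * rot x y / outer_form x y).

Definition first_lyapunov (gam x y : R) : R :=
  1 / 2 * ln (outer_form x y) + gam * inner_angle 2 x y.

Lemma outer_form_gt0 (x y : R) : 0 < norm2 x y -> 0 < outer_form x y.
Proof. pose proof (outer_form_bounds x y). lra. Qed.

Lemma outer_form_orbital (rho : R) :
  orbital_derivative P Q rho outer_form (fun x y => 2 * outer_radial x y).
Proof.
  intros s x y t hx hy hn. unfold outer_form, outer_radial.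
  auto_derive; [repeat split; eexists; eassumption |].
  change (fun x0 => x x0) with x. change (fun x0 => y x0) with y.
  rewrite (is_derive_unique _ _ _ hx), (is_derive_unique _ _ _ hy). unfold P, Q. ring.
Qed.

Lemma orbital_derivative_ext (U U' V' : R -> R -> R) (rho : R) :
  (forall x y, 0 < norm2 x y < rho -> U' x y = V' x y) ->
  orbital_derivative P Q rho U U' -> orbital_derivative P Q rho U V'.
Proof.
  intros he h s x y t hx hy hn. rewrite <- he by exact hn. apply h; assumption.
Qed.

Lemma first_lyapunov_orbital (gam : R) :
  exists rho, 0 < rho /\ orbital_derivative P Q rho (first_lyapunov gam) (outer_rate gam).
Proof.
  destruct near_dot_pos as (r & hr & hdot). exists r. split; [exact hr |].
  apply orbital_derivative_ext with
    (fun x y => 1 / 2 * (2 * outer_radial x y / outer_form x y) +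
      gam * (inner_rate x y - 2 * rot x y / (2 ^ 2 * x ^ 2 + y ^ 2))).
  - intros x y hn. pose proof (outer_form_gt0 x y (proj1 hn)). unfold outer_rate.
    replace (2 ^ 2 * x ^ 2 + y ^ 2) with (outer_form x y) by (unfold outer_form; ring).
    field. lra.
  - unfold first_lyapunov.
    apply (orbital_derivative_plus P Q (fun x y => 1 / 2 * ln (outer_form x y)) _
      (fun x y => gam * inner_angle 2 x y)).
    + apply (orbital_derivative_scal P Q (fun x y => ln (outer_form x y))).
      apply orbital_derivative_ln; [| apply outer_form_orbital].
      intros x y hn. apply outer_form_gt0, hn.
    + apply orbital_derivative_scal. apply inner_angle_orbital; [lra | exact hdot].
Qed.

Lemma first_lyapunov_bounded (gam : R) :
  bigO (fun x y => first_lyapunov gam x y - ln (norm2 x y) / 2) (fun _ _ => 1).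
Proof.
  apply bigO_global with (ln 4 / 2 + Rabs gam * (PI / 2)).
  - pose proof PI_RGT_0. pose proof (Rabs_pos gam).
    assert (0 <= ln 4) by (rewrite <- ln_1; apply ln_le; lra).
    assert (0 <= Rabs gam * (PI / 2)) by (apply Rmult_le_pos; lra). lra.
  - intros x y hn. rewrite Rmult_1_r. unfold first_lyapunov.
    destruct (outer_form_bounds x y) as [h1 h2].
    pose proof (ln_le _ _ hn h1) as l1.
    pose proof (ln_le _ _ (outer_form_gt0 x y hn) h2) as l2.
    rewrite ln_mult in l2 by lra.
    replace (1 / 2 * ln (outer_form x y) + gam * inner_angle 2 x y - ln (norm2 x y) / 2) with
      ((ln (outer_form x y) - ln (norm2 x y)) / 2 + gam * inner_angle 2 x y) by field.
    apply Rle_trans with (1 := Rabs_triang _ _). apply Rplus_le_compat.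
    + apply Rabs_le. lra.
    + rewrite Rabs_mult. apply Rmult_le_compat_l; [apply Rabs_pos | apply inner_angle_bound].
Qed.

(** The remainder is written exactly as a sum of products of bounded ratios and monomials dominated
    by [z1], so that [field] checks the expansion and each term is estimated separately. The later
    expansions follow the same pattern. *)
Lemma outer_rate_expansion (gam : R) :
  bigO (fun x y => outer_rate gam x y - ((1 - 2 * gam) * y ^ 2 + (a + gam * Delta / 2) * x ^ 4))
    z1.
Proof.
  apply bigO_ext with (fun x y => x ^ 2 / outer_form x y *
      (2 * (x ^ 5 * y) - (1 + a) * (x ^ 2 * y ^ 2) - 4 * gam * x ^ 6
        + 2 * gam * (1 + a) * (x ^ 3 * y))
    + gam * (inner_rate x y - Delta / 2 * x ^ 4)).
  - exists 1. split; [lra |]. intros x y [hn _]. pose proof (outer_form_gt0 x y hn) as ho.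
    unfold outer_rate. set (ir := inner_rate x y).
    unfold outer_radial, rot, field_x, field_y, outer_form in *. field. lra.
  - apply bigO_plus.
    + apply (bigO_scale (fun x y => x ^ 2 / outer_form x y)); [apply bigO_outer_ratio |].
      apply bigO_plus; [apply bigO_minus; [apply bigO_minus |] |];
        apply (bigO_scale (fun _ _ => _)); try apply bigO_const.
      * apply bigO_z2_z1, bigO_x5y.
      * apply bigO_z2_z1, bigO_x2y2.
      * apply bigO_z2_z1, bigO_x6.
      * apply bigO_x3y.
    + apply (bigO_scale (fun _ _ => _)); [apply bigO_const | apply inner_rate_expansion].
Qed.

Lemma focus_nondegenerate : a + Delta / 4 <> 0 -> is_focus P Q.
Proof.
  intros hne. set (d := a + Delta / 4) in *.
  assert (hsg : exists sg, (sg = 1 \/ sg = -1) /\ sg * d = Rabs d).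
  { destruct (Rle_dec 0 d).
    - exists 1. split; [auto |]. rewrite Rabs_right; lra.
    - exists (-1). split; [auto |]. rewrite Rabs_left; lra. }
  destruct hsg as (sg & hsg & hd).
  assert (hda : 0 < Rabs d) by (apply Rabs_pos_lt; exact hne).
  (* For this [gam] the coefficients of [y^2] and [x^4] are [2 d / Delta] and [d / 2], which both
     have the sign of [d]. *)
  set (gam := 1 / 2 - d / Delta).
  set (mu := Rmin (Rabs d * (2 / Delta)) (Rabs d / 2)).
  assert (hmu : 0 < mu).
  { apply Rmin_pos; [| lra]. apply Rmult_lt_0_compat; [lra |]. apply Rdiv_lt_0_compat; lra. }
  apply (focus_criterion (first_lyapunov gam) (outer_rate gam) sg (mu / 8)).
  - exact hsg.
  - lra.
  - apply first_lyapunov_orbital.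
  - apply first_lyapunov_bounded.
  - pose proof (bigO_small _ _ (mu / 2) ltac:(lra) energy_ge0 (outer_rate_expansion gam)) as h.
    assert (h1 : near_origin (fun x y => norm2 x y < 1)).
    { exists 1. split; [lra |]. intros x y hn. apply hn. }
    apply near_impl with (2 := near_and _ _ h h1). intros x y hn [hb hn1].
    assert (hcube : norm2 x y ^ 3 <= 4 * energy x y).
    { pose proof (norm2_sq_le_energy x y hn1). pose proof (energy_ge0 x y).
      pose proof (pow2_ge_0 (norm2 x y)). nra. }
    assert (hmain : mu * energy x y <=
      sg * ((1 - 2 * gam) * y ^ 2 + (a + gam * Delta / 2) * x ^ 4)).
    { replace (sg * ((1 - 2 * gam) * y ^ 2 + (a + gam * Delta / 2) * x ^ 4)) with
        ((sg * d) * (2 / Delta) * y ^ 2 + (sg * d) / 2 * x ^ 4)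
        by (unfold gam, d; field; lra).
      rewrite hd. unfold energy. pose proof (pow4_ge0 x); pose proof (pow2_ge_0 y).
      pose proof (Rmin_l (Rabs d * (2 / Delta)) (Rabs d / 2) : mu <= _).
      pose proof (Rmin_r (Rabs d * (2 / Delta)) (Rabs d / 2) : mu <= _).
      rewrite Rmult_plus_distr_l, Rplus_comm.
      apply Rplus_le_compat; apply Rmult_le_compat_r; assumption. }
    apply Rabs_le_between in hb.
    assert (hsgb : - (mu / 2 * energy x y) <= sg * (outer_rate gam x y -
      ((1 - 2 * gam) * y ^ 2 + (a + gam * Delta / 2) * x ^ 4))).
    { destruct hsg as [-> | ->]; lra. }
    assert (mu / 8 * norm2 x y ^ 3 <= mu / 8 * (4 * energy x y)) by (apply Rmult_le_compat_l;
      lra).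
    lra.
Qed.

End System.

(** * The case a = -31/25 *)

Local Notation a0 := (-31 / 25).
Local Notation Delta0 := (124 / 25).

Lemma Delta0_gt0 : 0 < Delta0.
Proof. lra. Qed.

Lemma Delta0_sq : Delta0 ^ 2 = 32 - (1 + 3 * a0) ^ 2.
Proof. field. Qed.

Definition inner_form' (x y : R) : R :=
  8 * y * field_y x y
  - (1 + 3 * a0) * (3 * x ^ 2 * y * field_x a0 x y + x ^ 3 * field_y x y)
  + 12 * x ^ 5 * field_x a0 x y.

(* Tends to +oo in the sectors |y| >> x^2 and to -oo in the sectors |y| << x^2. *)
Definition log_ratio (x y : R) : R := ln (inner_form a0 x y) + -2 * ln (outer_form x y).

Definition log_ratio' (x y : R) : R :=
  inner_form' x y / inner_form a0 x y + -2 * (2 * outer_radial a0 x y / outer_form x y).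

(** Where [y ~ x^2], the leading relative speed is that of [y], with [y' ~ 4 x y^2]. Since
    [y / sqrt (x^4 + y^2)] increases with [y], the factor [x^3] makes the leading derivative
    [4 x^8 y^2 / sqrt (x^4 + y^2)^3]: it is nonnegative for either sign of [x], and of the full
    order [z2] in these sectors. *)
Definition transit (x y : R) : R := x ^ 3 * y / sqrt (energy x y).

Definition transit' (x y : R) : R :=
  3 * (x ^ 2 * field_x a0 x y) * (y / sqrt (energy x y))
  + x ^ 6 * (x * field_y x y - 2 * y * field_x a0 x y) / sqrt (energy x y) ^ 3.

(** The constant 17/800 cancels the monomial [x^3 y]: the first function contributes
    [(1 + 3 a0) / 4 = -17/25] of it, and [outer_form * log_ratio'] contributes 32. *)
Definition second_lyapunov (K x y : R) : R :=
  first_lyapunov a0 Delta0 (1 / 2) x y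
  + 17 / 800 * (outer_form x y * log_ratio x y) + K * transit x y.

Definition second_rate (K x y : R) : R :=
  outer_rate a0 Delta0 (1 / 2) x y
  + 17 / 800 * (2 * outer_radial a0 x y * log_ratio x y + outer_form x y * log_ratio' x y)
  + K * transit' x y.

Lemma inner_form0_gt0 (x y : R) : 0 < norm2 x y -> 0 < inner_form a0 x y.
Proof. apply (inner_form_gt0 a0 Delta0 Delta0_gt0 Delta0_sq). Qed.

Lemma inner_form0_orbital (rho : R) :
  orbital_derivative (field_x a0) field_y rho (inner_form a0) inner_form'.
Proof.
  intros s x y t hx hy hn. unfold inner_form, inner_form'.
  auto_derive; [repeat split; eexists; eassumption |].
  change (fun x0 => x x0) with x. change (fun x0 => y x0) with y.
  rewrite (is_derive_unique _ _ _ hx), (is_derive_unique _ _ _ hy). ring.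
Qed.

Lemma sqrt_energy_gt0 (x y : R) : 0 < norm2 x y -> 0 < sqrt (energy x y).
Proof. intros h. apply sqrt_lt_R0, energy_gt0, h. Qed.

Lemma transit_orbital (rho : R) :
  orbital_derivative (field_x a0) field_y rho transit transit'.
Proof.
  intros s x y t hx hy hn.
  pose proof (energy_gt0 _ _ (proj1 hn)) as he.
  pose proof (sqrt_energy_gt0 _ _ (proj1 hn)) as hw.
  assert (de : is_derive (fun u => energy (x u) (y u)) t
    (s * (4 * x t ^ 3 * field_x a0 (x t) (y t) + 2 * y t * field_y (x t) (y t)))).
  { unfold energy. auto_derive; [repeat split; eexists; eassumption |].
    change (fun x0 => x x0) with x. change (fun x0 => y x0) with y.
    rewrite (is_derive_unique _ _ _ hx), (is_derive_unique _ _ _ hy). ring. }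
  assert (dn : is_derive (fun u => x u ^ 3 * y u) t
    (s * (3 * x t ^ 2 * y t * field_x a0 (x t) (y t) + x t ^ 3 * field_y (x t) (y t)))).
  { auto_derive; [repeat split; eexists; eassumption |].
    change (fun x0 => x x0) with x. change (fun x0 => y x0) with y.
    rewrite (is_derive_unique _ _ _ hx), (is_derive_unique _ _ _ hy). ring. }
  pose proof (is_derive_sqrt _ _ _ de he) as dw.
  apply is_derive_eq with (1 := is_derive_div _ _ _ _ _ dn dw (Rgt_not_eq _ _ hw)).
  unfold transit'.
  assert (hw2 : sqrt (energy (x t) (y t)) ^ 2 = x t ^ 4 + y t ^ 2).
  { apply pow2_sqrt, energy_ge0. }
  set (X := x t) in *. set (Y := y t) in *. set (w := sqrt (energy X Y)) in *.
  set (p := field_x a0 X Y). set (q := field_y X Y).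
  (* Over the denominator [w^3], with [w^2 = x^4 + y^2], the terms [x^3 y^2 q] cancel and leave
     [x^7 q]. *)
  transitivity (s * ((3 * X ^ 2 * Y * p + X ^ 3 * q) * w ^ 2
    - X ^ 3 * Y * (2 * X ^ 3 * p + Y * q)) / w ^ 3); [field; lra |].
  transitivity (s * (3 * X ^ 2 * p * Y * w ^ 2 + X ^ 6 * (X * q - 2 * Y * p)) / w ^ 3);
    [rewrite hw2; field; lra | field; lra].
Qed.

Lemma second_lyapunov_orbital (K : R) : exists rho, 0 < rho /\
  orbital_derivative (field_x a0) field_y rho (second_lyapunov K) (second_rate K).
Proof.
  destruct (first_lyapunov_orbital a0 Delta0 Delta0_gt0 Delta0_sq (1 / 2)) as (rho & hrho & h).
  exists rho. split; [exact hrho |]. unfold second_lyapunov, second_rate.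
  apply (orbital_derivative_plus _ _ (fun x y => first_lyapunov a0 Delta0 (1 / 2) x y
    + 17 / 800 * (outer_form x y * log_ratio x y)) _ (fun x y => K * transit x y)).
  - apply (orbital_derivative_plus _ _ (first_lyapunov a0 Delta0 (1 / 2)) _
      (fun x y => 17 / 800 * (outer_form x y * log_ratio x y))); [exact h |].
    apply (orbital_derivative_scal _ _ (fun x y => outer_form x y * log_ratio x y)).
    apply (orbital_derivative_mult _ _ outer_form (fun x y => 2 * outer_radial a0 x y));
      [apply outer_form_orbital |].
    apply (orbital_derivative_plus _ _ (fun x y => ln (inner_form a0 x y)) _
      (fun x y => -2 * ln (outer_form x y))).
    + apply orbital_derivative_ln; [| apply inner_form0_orbital].
      intros x y hn. apply inner_form0_gt0, hn.
    + apply (orbital_derivative_scal _ _ (fun x y => ln (outer_form x y))).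
      apply orbital_derivative_ln; [| apply outer_form_orbital].
      intros x y hn. apply outer_form_gt0, hn.
  - apply orbital_derivative_scal, transit_orbital.
Qed.

(** * Boundedness of the corrections to the Lyapunov function *)

Lemma mult_ln_bound (z : R) : 0 < z <= 1 -> -1 <= z * ln z <= 0.
Proof.
  intros hz.
  assert (h1 : ln z <= 0) by (rewrite <- ln_1; apply ln_le; lra).
  assert (h2 : - ln z <= / z - 1).
  { rewrite <- ln_Rinv by lra. pose proof (exp_ineq1_le (ln (/ z))) as h.
    rewrite exp_ln in h by (apply Rinv_0_lt_compat; lra). lra. }
  assert (h3 : z * - ln z <= z * (/ z - 1)) by (apply Rmult_le_compat_l; lra).
  replace (z * (/ z - 1)) with (1 - z) in h3 by (field; lra). nra.
Qed.

Lemma inner_form0_bounds (x y : R) :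
  3 * y ^ 2 <= inner_form a0 x y <= 6 * y ^ 2 + 4 * x ^ 6 /\ x ^ 6 <= inner_form a0 x y.
Proof.
  unfold inner_form. pose proof (pow2_ge_0 (x ^ 3 - y)). pose proof (pow2_ge_0 (x ^ 3 + y)).
  pose proof (pow2_ge_0 y). pose proof (pow2_ge_0 (x ^ 3)).
  (* Here [1 + 3 a0 = -68/25]; this square and the next one absorb the cross term in the lower
     bounds [3 y^2] and [x^6]. *)
  pose proof (pow2_ge_0 (y + 34 / 25 * x ^ 3)).
  pose proof (pow2_ge_0 (4 * y + 34 / 25 * x ^ 3)).
  repeat split; nra.
Qed.

(** The inner form is at most 10 and vanishes no faster than [outer_form ^ 3 / 1000]. Hence
    [log_ratio] is at most of the size of [ln outer_form], and [q ln q] is bounded. *)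
Lemma bigO_outer_log_ratio : bigO (fun x y => outer_form x y * log_ratio x y) (fun _ _ => 1).
Proof.
  apply bigO_le with (5 + ln 10 + ln 1000).
  assert (hs : near_origin (fun x y => outer_form x y <= 1)).
  { exists (1 / 4). split; [lra |]. intros x y hn. pose proof (outer_form_bounds x y). lra. }
  apply near_impl with (2 := near_and _ _ hs near_le_1). intros x y hn [hq [hx hy]].
  split; [lra |]. rewrite Rmult_1_r.
  pose proof (outer_form_gt0 x y hn) as hq0. pose proof (inner_form0_gt0 x y hn) as hS0.
  destruct (inner_form0_bounds x y) as [[s1 s2] s3].
  apply Rabs_le_between in hx. apply Rabs_le_between in hy.
  assert (hx2 : 0 <= x ^ 2 <= 1) by (split; [apply pow2_ge_0 | nra]).
  assert (hy2 : 0 <= y ^ 2 <= 1) by (split; [apply pow2_ge_0 | nra]).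
  assert (hup : inner_form a0 x y <= 10).
  { assert (x ^ 6 <= 1); [| lra]. replace (x ^ 6) with ((x ^ 2) ^ 3) by ring.
    rewrite <- (pow1 3). apply pow_incr; lra. }
  assert (hlow : outer_form x y ^ 3 <= 1000 * inner_form a0 x y).
  { assert (h1 : outer_form x y ^ 3 <= 4 * ((4 * x ^ 2) ^ 3 + (y ^ 2) ^ 3)).
    { unfold outer_form. set (u := 4 * x ^ 2). set (v := y ^ 2) in *.
      assert (0 <= u) by (unfold u; lra).
      assert (0 <= 3 * (u + v) * (u - v) ^ 2).
      { apply Rmult_le_pos; [lra | apply pow2_ge_0]. }
      lra. }
    assert (h2 : (y ^ 2) ^ 3 <= y ^ 2).
    { set (v := y ^ 2) in *. assert (v * v <= 1) by nra. nra. }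
    replace ((4 * x ^ 2) ^ 3) with (64 * x ^ 6) in h1 by ring.
    assert (0 <= x ^ 6) by (replace (x ^ 6) with ((x ^ 2) ^ 3) by ring; apply pow_le; lra). lra. }
  pose proof (mult_ln_bound _ (conj hq0 hq)) as hl.
  assert (l10 : 0 <= ln 10) by (rewrite <- ln_1; apply ln_le; lra).
  assert (l1000 : 0 <= ln 1000) by (rewrite <- ln_1; apply ln_le; lra).
  pose proof (ln_le _ _ hS0 hup) as hSu.
  assert (hSl : 3 * ln (outer_form x y) - ln 1000 <= ln (inner_form a0 x y)).
  { pose proof (ln_le _ _ (pow_lt _ 3 hq0) hlow) as h.
    rewrite ln_pow, ln_mult in h by lra. simpl INR in h. lra. }
  unfold log_ratio. set (q := outer_form x y) in *. set (l := ln q) in *.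
  set (ls := ln (inner_form a0 x y)) in *.
  assert (e1 : q * ls <= q * ln 10) by (apply Rmult_le_compat_l; lra).
  assert (e2 : q * (3 * l - ln 1000) <= q * ls) by (apply Rmult_le_compat_l; lra).
  assert (e3 : q * ln 10 <= 1 * ln 10) by (apply Rmult_le_compat_r; lra).
  assert (e4 : q * ln 1000 <= 1 * ln 1000) by (apply Rmult_le_compat_r; lra).
  apply Rabs_le. lra.
Qed.

Lemma x2_le_sqrt_energy (x y : R) : x ^ 2 <= sqrt (energy x y).
Proof.
  rewrite <- (sqrt_pow2 (x ^ 2)) by apply pow2_ge_0. apply sqrt_le_1_alt.
  unfold energy. pose proof (pow2_ge_0 y). lra.
Qed.

Lemma y_le_sqrt_energy (x y : R) : Rabs y <= sqrt (energy x y).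
Proof.
  rewrite <- (sqrt_pow2 (Rabs y)) by apply Rabs_pos. apply sqrt_le_1_alt.
  rewrite pow2_abs. unfold energy. pose proof (pow4_ge0 x). lra.
Qed.

Lemma bigO_y_sqrt_energy : bigO (fun x y => y / sqrt (energy x y)) (fun _ _ => 1).
Proof.
  apply bigO_global with 1; [lra |]. intros x y hn. pose proof (sqrt_energy_gt0 x y hn).
  unfold Rdiv. rewrite Rabs_mult, Rabs_inv, (Rabs_right (sqrt _)) by lra.
  apply Rmult_le_reg_r with (sqrt (energy x y)); [lra |].
  rewrite Rmult_assoc, Rinv_l by lra. pose proof (y_le_sqrt_energy x y). lra.
Qed.

Lemma bigO_x2_sqrt_energy : bigO (fun x y => x ^ 2 / sqrt (energy x y)) (fun _ _ => 1).
Proof.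
  apply bigO_global with 1; [lra |]. intros x y hn. pose proof (sqrt_energy_gt0 x y hn).
  unfold Rdiv. rewrite Rabs_mult, Rabs_inv, (Rabs_right (sqrt _)) by lra.
  rewrite Rabs_right by (apply Rle_ge, pow2_ge_0).
  apply Rmult_le_reg_r with (sqrt (energy x y)); [lra |].
  rewrite Rmult_assoc, Rinv_l by lra. pose proof (x2_le_sqrt_energy x y). lra.
Qed.

Lemma bigO_fst : bigO (fun x _ => x) radius.
Proof. apply bigO_global with 1; [lra |]. intros x y _. rewrite Rmult_1_l. apply abs_le_radius.
  Qed.

Lemma bigO_snd : bigO (fun _ y => y) radius.
Proof. apply bigO_global with 1; [lra |]. intros x y _. rewrite Rmult_1_l. apply abs_le_radius.
  Qed.

Lemma bigO_fst_1 : bigO (fun x _ => x) (fun _ _ => 1).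
Proof.
  apply bigO_le with 1. apply near_impl with (2 := near_le_1). intros x y _ h. lra.
Qed.

Lemma second_lyapunov_bounded (K : R) :
  bigO (fun x y => second_lyapunov K x y - ln (norm2 x y) / 2) (fun _ _ => 1).
Proof.
  apply bigO_ext with (fun x y => (first_lyapunov a0 Delta0 (1 / 2) x y - ln (norm2 x y) / 2)
    + 17 / 800 * (outer_form x y * log_ratio x y) + K * (x * (x * (x * (y / sqrt (energy x
        y)))))).
  - exists 1. split; [lra |]. intros x y _. unfold second_lyapunov, transit, Rdiv. ring.
  - apply bigO_plus; [apply bigO_plus |].
    + apply first_lyapunov_bounded.
    + apply (bigO_scale (fun _ _ => _)); [apply bigO_const | apply bigO_outer_log_ratio].
    + apply (bigO_scale (fun _ _ => K)); [apply bigO_const |].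
      do 3 (apply (bigO_scale (fun x y => x)); [apply bigO_fst_1 |]).
      apply bigO_y_sqrt_energy.
Qed.

(** * Expansion of the rate of the corrected Lyapunov function *)

Lemma bigO_x3y2 : bigO (fun x y => x ^ 3 * y ^ 2) z3.
Proof.
  apply bigO_ext with (fun x y => x * (x ^ 2 * y ^ 2)).
  - exists 1. split; [lra |]. intros; ring.
  - apply (bigO_mult (fun x y => x)); [apply bigO_fst | apply bigO_x2y2].
Qed.

Lemma bigO_x2y3 : bigO (fun x y => x ^ 2 * y ^ 3) z3.
Proof.
  apply bigO_ext with (fun x y => y * (x ^ 2 * y ^ 2)).
  - exists 1. split; [lra |]. intros; ring.
  - apply (bigO_mult (fun x y => y)); [apply bigO_snd | apply bigO_x2y2].
Qed.

Lemma bigO_x7 : bigO (fun x y => x ^ 7) z3.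
Proof.
  apply bigO_ext with (fun x y => x * x ^ 6).
  - exists 1. split; [lra |]. intros; ring.
  - apply (bigO_mult (fun x y => x)); [apply bigO_fst | apply bigO_x6].
Qed.

Lemma transit_expansion :
  bigO (fun x y => transit' x y - 4 * (x ^ 8 * y ^ 2 / sqrt (energy x y) ^ 3)) z3.
Proof.
  apply bigO_ext with (fun x y =>
    3 * (y / sqrt (energy x y) * (x ^ 3 * y ^ 2 - x ^ 2 * y ^ 3 + a0 * x ^ 7))
    + x ^ 2 / sqrt (energy x y) * (x ^ 2 / sqrt (energy x y) *
       (x ^ 2 / sqrt (energy x y) * (2 * (x * x ^ 7) - (1 + 2 * a0) * (x ^ 5 * y))
        + y / sqrt (energy x y) * (2 * (x ^ 2 * y ^ 3) - x ^ 3 * y ^ 2)))).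
  - exists 1. split; [lra |]. intros x y [hn _]. pose proof (sqrt_energy_gt0 x y hn).
    unfold transit', field_x, field_y. set (w := sqrt (energy x y)) in *. field. lra.
  - apply bigO_plus.
    + apply (bigO_scale (fun _ _ => 3)); [apply bigO_const |].
      apply (bigO_scale (fun x y => y / sqrt (energy x y))); [apply bigO_y_sqrt_energy |].
      apply bigO_plus; [apply bigO_minus; [apply bigO_x3y2 | apply bigO_x2y3] |].
      apply (bigO_scale (fun _ _ => _)); [apply bigO_const | apply bigO_x7].
    + do 2 (apply (bigO_scale (fun x y => x ^ 2 / sqrt (energy x y))); [apply
        bigO_x2_sqrt_energy |]).
      apply bigO_plus.
      * apply (bigO_scale (fun x y => x ^ 2 / sqrt (energy x y))); [apply bigO_x2_sqrt_energy |].
        apply bigO_minus; apply (bigO_scale (fun _ _ => _)); try apply bigO_const.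
        -- apply (bigO_scale (fun x y => x)); [apply bigO_fst_1 | apply bigO_x7].
        -- apply bigO_x5y_z3.
      * apply (bigO_scale (fun x y => y / sqrt (energy x y))); [apply bigO_y_sqrt_energy |].
        apply bigO_minus; [| apply bigO_x3y2].
        apply (bigO_scale (fun _ _ => _)); [apply bigO_const | apply bigO_x2y3].
Qed.

Ltac bigO_linear :=
  repeat match goal with
  | |- bigO (fun x y => ?f + ?g) _ => apply (bigO_plus (fun x y => f) (fun x y => g))
  | |- bigO (fun x y => ?f - ?g) _ => apply (bigO_minus (fun x y => f) (fun x y => g))
  end.

Definition outer_remainder (x y : R) : R :=
  x ^ 2 / outer_form x y * (2 * (x ^ 5 * y) - (1 + a0) * (x ^ 2 * y ^ 2)).

Lemma bigO_outer_remainder : bigO outer_remainder z2.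
Proof.
  apply (bigO_scale (fun x y => x ^ 2 / outer_form x y)); [apply bigO_outer_ratio |].
  apply bigO_minus; apply (bigO_scale (fun _ _ => _)); try apply bigO_const;
    [apply bigO_x5y | apply bigO_x2y2].
Qed.

Lemma outer_radial_decomposition (x y : R) : 0 < norm2 x y ->
  outer_radial a0 x y = outer_form x y * (y ^ 2 + a0 * x ^ 4) + outer_form x y * outer_remainder
    x y.
Proof.
  intros hn. pose proof (outer_form_gt0 x y hn) as h.
  unfold outer_remainder, outer_radial, field_x, field_y, outer_form in *. field. lra.
Qed.

Local Notation bigO_y2_inner0 := (bigO_y2_inner a0 Delta0 Delta0_gt0 Delta0_sq).
Local Notation bigO_x6_inner0 := (bigO_x6_inner a0 Delta0 Delta0_gt0 Delta0_sq).
Local Notation bigO_x3y_inner0 := (bigO_x3y_inner a0 Delta0 Delta0_gt0 Delta0_sq).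

(* At [a0] the two leading terms of [outer_rate (1 / 2)] vanish; the monomial
   [x^3 y] is the only one of order lower than [z2] that is left. *)
Lemma outer_rate_half_expansion :
  bigO (fun x y => outer_rate a0 Delta0 (1 / 2) x y - (1 + 3 * a0) / 4 * (x ^ 3 * y)) z2.
Proof.
  apply bigO_ext with (fun x y =>
    outer_remainder x y
    + x ^ 2 / outer_form x y * (-2 * x ^ 6)
    + x ^ 2 / outer_form x y * (- (1 + a0) / 4 * (x * y ^ 3))
    + y ^ 2 / inner_form a0 x y * (-3 * a0 * (x ^ 2 * y ^ 2))
    + y ^ 2 / inner_form a0 x y * (2 * a0 * (1 + 3 * a0) / 4 * x ^ 6)
    + x ^ 3 * y / inner_form a0 x y * (- a0 * x ^ 6)).
  - exists 1. split; [lra |]. intros x y [hn _].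
    pose proof (outer_form_gt0 x y hn) as ho. pose proof (inner_form0_gt0 x y hn) as hi.
    unfold outer_rate, inner_rate, outer_remainder, outer_radial, rot, field_x, field_y,
      outer_form, inner_form in *. field. split; lra.
  - bigO_linear.
    + apply bigO_outer_remainder.
    + apply (bigO_scale (fun x y => x ^ 2 / outer_form x y)); [apply bigO_outer_ratio |].
      apply (bigO_scale (fun _ _ => _)); [apply bigO_const | apply bigO_x6].
    + apply (bigO_scale (fun x y => x ^ 2 / outer_form x y)); [apply bigO_outer_ratio |].
      apply (bigO_scale (fun _ _ => _)); [apply bigO_const | apply bigO_xy3].
    + apply (bigO_scale (fun x y => y ^ 2 / inner_form a0 x y)); [apply bigO_y2_inner0 |].
      apply (bigO_scale (fun _ _ => _)); [apply bigO_const | apply bigO_x2y2].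
    + apply (bigO_scale (fun x y => y ^ 2 / inner_form a0 x y)); [apply bigO_y2_inner0 |].
      apply (bigO_scale (fun _ _ => _)); [apply bigO_const | apply bigO_x6].
    + apply (bigO_scale (fun x y => x ^ 3 * y / inner_form a0 x y)); [apply bigO_x3y_inner0 |].
      apply (bigO_scale (fun _ _ => _)); [apply bigO_const | apply bigO_x6].
Qed.

Lemma bigO_outer_form : bigO outer_form norm2.
Proof.
  apply bigO_global with 4; [lra |]. intros x y _. pose proof (outer_form_bounds x y).
  pose proof (norm2_ge0 x y). rewrite Rabs_right; lra.
Qed.

Lemma bigO_x4 : bigO (fun x y => x ^ 4) energy.
Proof. apply bigO_global with 1; [lra |]. intros x y _. rewrite Rmult_1_l. apply abs_le_energy.
  Qed.

Lemma bigO_y2 : bigO (fun x y => y ^ 2) energy.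
Proof. apply bigO_global with 1; [lra |]. intros x y _. rewrite Rmult_1_l. apply abs_le_energy.
  Qed.

(** Away from the x-axis the inner form is about [4 y^2], and [y' ~ 4 x y^2] gives it the
    logarithmic derivative [8 x y]. This is the only term that [energy] does not control: for
    [y ~ x^2] it is of order [x^3]. *)
Lemma inner_form'_expansion :
  bigO (fun x y => inner_form' x y / inner_form a0 x y - 8 * (x * y)) energy.
Proof.
  set (b := 1 + 3 * a0).
  apply bigO_ext with (fun x y =>
    y ^ 2 / inner_form a0 x y *
      ((-8 + 4 * b) * x ^ 4 + 8 * y ^ 2 + 3 * b * (x * (x * y ^ 2)) + 12 * (x * (x * x ^ 4)))
    + x ^ 3 * y / inner_form a0 x y *
      (-4 * b * y ^ 2 + (b - 3 * a0 * b) * x ^ 4 + -12 * (x * (x * y ^ 2)))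
    + x ^ 6 / inner_form a0 x y * ((12 * a0 - 2 * b) * x ^ 4)).
  - exists 1. split; [lra |]. intros x y [hn _]. pose proof (inner_form0_gt0 x y hn) as hi.
    unfold inner_form', field_x, field_y, inner_form, b in *. field. lra.
  - assert (hxx : forall u, bigO u energy -> bigO (fun x y => x * (x * u x y)) energy).
    { intros u hu. do 2 (apply (bigO_scale (fun x y => x)); [apply bigO_fst_1 |]). exact hu. }
    apply bigO_plus; [apply bigO_plus |].
    + apply (bigO_scale (fun x y => y ^ 2 / inner_form a0 x y)); [apply bigO_y2_inner0 |].
      bigO_linear; apply (bigO_scale (fun _ _ => _)); try apply bigO_const;
        [apply bigO_x4 | apply bigO_y2 | apply (hxx (fun x y => y ^ 2)), bigO_y2
         | apply (hxx (fun x y => x ^ 4)), bigO_x4].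
    + apply (bigO_scale (fun x y => x ^ 3 * y / inner_form a0 x y)); [apply bigO_x3y_inner0 |].
      bigO_linear; apply (bigO_scale (fun _ _ => _)); try apply bigO_const;
        [apply bigO_y2 | apply bigO_x4 | apply (hxx (fun x y => y ^ 2)), bigO_y2].
    + apply (bigO_scale (fun x y => x ^ 6 / inner_form a0 x y)); [apply bigO_x6_inner0 |].
      apply (bigO_scale (fun _ _ => _)); [apply bigO_const | apply bigO_x4].
Qed.

Lemma bigO_outer_form_1 : bigO outer_form (fun _ _ => 1).
Proof.
  apply bigO_le with 1. exists (1 / 4). split; [lra |]. intros x y hn.
  pose proof (outer_form_bounds x y). rewrite Rabs_right; lra.
Qed.

(** The product of [8 x y] with [4 x^2], taken from the outer form, is the monomial [32 x^3 y]; its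
    other half [8 x y^3] is already of order [z2]. *)
Lemma log_ratio'_expansion :
  bigO (fun x y => outer_form x y * log_ratio' x y - 32 * (x ^ 3 * y)) z2.
Proof.
  apply bigO_ext with (fun x y =>
    outer_form x y * (inner_form' x y / inner_form a0 x y - 8 * (x * y) + -4 * y ^ 2 + -4 * a0 *
      x ^ 4)
    + (8 * (x * y ^ 3) + -4 * (outer_form x y * outer_remainder x y))).
  - exists 1. split; [lra |]. intros x y [hn _]. pose proof (inner_form0_gt0 x y hn) as hi.
    pose proof (outer_form_gt0 x y hn) as ho.
    unfold log_ratio'. rewrite (outer_radial_decomposition x y hn).
    set (r := outer_remainder x y). set (s := inner_form' x y / inner_form a0 x y).
    unfold outer_form in *. field. lra.
  - apply bigO_plus.
    + apply bigO_mult; [apply bigO_outer_form |].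
      apply bigO_plus; [apply bigO_plus; [apply inner_form'_expansion |] |];
        apply (bigO_scale (fun _ _ => _)); try apply bigO_const; [apply bigO_y2 | apply bigO_x4].
    + apply bigO_plus; apply (bigO_scale (fun _ _ => _)); try apply bigO_const.
      * apply bigO_xy3.
      * apply bigO_scale; [apply bigO_outer_form_1 | apply bigO_outer_remainder].
Qed.

(** The order of the quantifiers matters: [K] will be chosen in terms of [C], so [C] and [C'] must
    not depend on it. Only the neighbourhood does, and there the error [K C' z3] of the transit term
    can be made small. The coefficient 17/400 is twice 17/800, because
    [outer_form' = 2 outer_radial]. *)
Lemma second_rate_expansion : exists C C', 0 <= C /\ 0 <= C' /\ forall K, 0 <= K -> near_origin
  (fun x y =>
  17 / 400 * (outer_form x y * (log_ratio x y * (y ^ 2 + a0 * x ^ 4)))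
    + K * (4 * (x ^ 8 * y ^ 2 / sqrt (energy x y) ^ 3)) - C * z2 x y - K * C' * z3 x y
  <= second_rate K x y).
Proof.
  assert (h1 : bigO (fun x y => second_rate 0 x y
      - 17 / 400 * (outer_form x y * (log_ratio x y * (y ^ 2 + a0 * x ^ 4)))) z2).
  { apply bigO_ext with (fun x y =>
      (outer_rate a0 Delta0 (1 / 2) x y - (1 + 3 * a0) / 4 * (x ^ 3 * y))
      + 17 / 800 * (outer_form x y * log_ratio' x y - 32 * (x ^ 3 * y))
      + 17 / 400 * (outer_form x y * log_ratio x y * outer_remainder x y)).
    - exists 1. split; [lra |]. intros x y [hn _]. unfold second_rate.
      rewrite (outer_radial_decomposition x y hn). field.
    - apply bigO_plus; [apply bigO_plus; [apply outer_rate_half_expansion |] |].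
      + apply (bigO_scale (fun _ _ => _)); [apply bigO_const | apply log_ratio'_expansion].
      + apply (bigO_scale (fun _ _ => _)); [apply bigO_const |].
        apply (bigO_scale (fun x y => outer_form x y * log_ratio x y));
          [apply bigO_outer_log_ratio | apply bigO_outer_remainder]. }
  destruct h1 as (C & hC & h1). destruct transit_expansion as (C' & hC' & h2).
  exists C, C'. split; [exact hC |]. split; [exact hC' |]. intros K hK.
  apply near_impl with (2 := near_and _ _ h1 h2). intros x y _ [e1 e2].
  apply Rabs_le_between in e1. apply Rabs_le_between in e2.
  assert (hs : second_rate K x y = second_rate 0 x y + K * transit' x y)
    by (unfold second_rate; ring).
  pose proof (Rmult_le_compat_l K _ _ hK (proj1 e2)). lra.
Qed.

(* The logarithm dominates away from the curves [y^2 = - a0 x^4], where its factor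
   vanishes; close to them the transit term takes over. *)
Lemma log_term_dominates (C : R) : 0 <= C -> exists K, 0 <= K /\ near_origin (fun x y =>
  C * z2 x y <= 17 / 400 * (outer_form x y * (log_ratio x y * (y ^ 2 + a0 * x ^ 4)))
    + K * (4 * (x ^ 8 * y ^ 2 / sqrt (energy x y) ^ 3))).
Proof.
  intros hC. set (m := 1600 / 17 * C + 1). assert (hm : 1 <= m) by (unfold m; lra).
  (* The value of [m] makes [17/400 * m/4 >= C], which is what the two sectors far from the curves
     require. *)
  set (em := exp m). assert (hem : 2 <= em) by (unfold em; pose proof (exp_ineq1_le m); lra).
  (* With [q] the outer and [S] the inner form, [em q^2 <= em (32 x^4 + 2 y^4)] and [3 y^2 <= S]
     give [log_ratio >= m] as soon as [V x^4 <= y^2]. If instead [y^2 <= v x^4], then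
     [em S <= 10 x^4 <= q^2] gives [log_ratio <= - m]. *)
  set (V := 32 * em). set (v := / em).
  assert (hv : 0 < v <= 1 / 2).
  { unfold v. split; [apply Rinv_0_lt_compat; lra |].
    replace (1 / 2) with (/ 2) by field. apply Rinv_le_contravar; lra. }
  assert (hvem : em * v = 1) by (unfold v; field; lra).
  (* A bound for [|log_ratio|] in the middle sector, where the inner form lies between [3 v x^4] and
     [(6 V + 4) x^4] and the squared outer form between [16 x^4] and [25 x^4]. *)
  set (M0 := Rabs (ln ((6 * V + 4) / 16)) + Rabs (ln (3 * v / 25))).
  assert (hM0 : 0 <= M0) by (apply Rplus_le_le_0_compat; apply Rabs_pos).
  (* In the middle sector the transit quotient is at least [v / (1+V)^3 * x^6], while
     [outer_form * energy] is at most [5 (1+V) x^6]. This [K] makes [4 K] times the former equal to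
     [M0 + C] times the latter. *)
  set (K := (1 + V) ^ 4 * (5 * (M0 + C)) / (4 * v)).
  assert (hV : 64 <= V) by (unfold V; lra).
  assert (hK : 0 <= K).
  { unfold K. apply Rmult_le_pos; [apply Rmult_le_pos; [apply pow_le |]; lra |].
    left; apply Rinv_0_lt_compat; lra. }
  exists K. split; [exact hK |].
  exists (1 / V). split; [apply Rdiv_lt_0_compat; lra |]. intros x y [hn hnV].
  pose proof (outer_form_bounds x y) as [hq1 _]. pose proof (outer_form_gt0 x y hn) as hq.
  pose proof (inner_form0_gt0 x y hn) as hS.
  destruct (inner_form0_bounds x y) as [[s1 s2] _].
  pose proof (energy_ge0 x y) as hE. pose proof (sqrt_energy_gt0 x y hn) as hw.
  assert (hVn : V * norm2 x y < 1).
  { apply (Rmult_lt_compat_l V) in hnV; [| lra]. replace (V * (1 / V)) with 1 in hnV by (field;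
      lra). exact hnV. }
  assert (hx2 : 0 <= x ^ 2) by apply pow2_ge_0. assert (hy2 : 0 <= y ^ 2) by apply pow2_ge_0.
  assert (hVx : V * x ^ 2 <= 1).
  { unfold norm2 in hVn. nra. }
  assert (hVy : V * y ^ 2 <= 1).
  { unfold norm2 in hVn. nra. }
  assert (hx4 : 0 <= x ^ 4) by apply pow4_ge0.
  assert (hx6 : x ^ 6 = x ^ 2 * x ^ 4) by ring.
  assert (hq2 : 0 < outer_form x y ^ 2) by (apply pow_lt; exact hq).
  assert (hqe : outer_form x y ^ 2 <= 2 * (16 * x ^ 4 + y ^ 2 * y ^ 2)).
  { unfold outer_form. pose proof (pow2_ge_0 (4 * x ^ 2 - y ^ 2)). nra. }
  assert (hqe' : 16 * x ^ 4 <= outer_form x y ^ 2).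
  { unfold outer_form. assert (0 <= x ^ 2 * y ^ 2) by (apply Rmult_le_pos; assumption).
    pose proof (pow4_ge0 y). nra. }
  assert (hlr : log_ratio x y = ln (inner_form a0 x y) - ln (outer_form x y ^ 2)).
  { unfold log_ratio. rewrite ln_pow by exact hq. simpl INR. ring. }
  assert (htr : 0 <= x ^ 8 * y ^ 2 / sqrt (energy x y) ^ 3).
  { apply Rmult_le_pos; [apply Rmult_le_pos; [| exact hy2] |].
    - replace (x ^ 8) with (x ^ 4 * x ^ 4) by ring. apply Rmult_le_pos; assumption.
    - left. apply Rinv_0_lt_compat, pow_lt; exact hw. }
  assert (hKtr : 0 <= K * (4 * (x ^ 8 * y ^ 2 / sqrt (energy x y) ^ 3))) by (apply Rmult_le_pos;
    lra).
  assert (hz2 : z2 x y <= outer_form x y * energy x y).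
  { unfold z2. apply Rmult_le_compat_r; assumption. }
  assert (hz2C : C * z2 x y <= C * (outer_form x y * energy x y)) by (apply Rmult_le_compat_l;
    lra).
  (* The transit term is nonnegative, so in the two outer sectors the logarithm alone has to do the
     work. *)
  assert (far : m / 4 * energy x y <= log_ratio x y * (y ^ 2 + a0 * x ^ 4) ->
    C * z2 x y <= 17 / 400 * (outer_form x y * (log_ratio x y * (y ^ 2 + a0 * x ^ 4)))
      + K * (4 * (x ^ 8 * y ^ 2 / sqrt (energy x y) ^ 3))).
  { intros h. apply (Rmult_le_compat_l (outer_form x y)) in h; [| lra].
    assert (0 <= outer_form x y * energy x y) by (apply Rmult_le_pos; lra).
    unfold m in h. nra. }
  destruct (Rle_dec (V * x ^ 4) (y ^ 2)) as [hi | hi]; [| destruct (Rle_dec (y ^ 2) (v * x ^ 4))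
    as [hii | hii]].
  - apply far.
    assert (hl : m <= log_ratio x y).
    { rewrite hlr. assert (em * outer_form x y ^ 2 <= inner_form a0 x y).
      { apply Rle_trans with (2 := s1). apply Rle_trans with (em * (2 * (16 * x ^ 4 + y ^ 2 * y
          ^ 2))).
        - apply Rmult_le_compat_l; lra.
        - unfold V in hi, hVy. assert (em * y ^ 2 * y ^ 2 <= 1 * y ^ 2).
          { apply Rmult_le_compat_r; lra. }
          lra. }
      apply ln_le in H; [| apply Rmult_lt_0_compat; lra].
      rewrite ln_mult in H by lra. unfold em in H. rewrite ln_exp in H. lra. }
    assert (hp : y ^ 2 / 2 <= y ^ 2 + a0 * x ^ 4).
    { assert (64 * x ^ 4 <= V * x ^ 4) by (apply Rmult_le_compat_r; lra). lra. }
    assert (he : energy x y <= 2 * y ^ 2).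
    { unfold energy. assert (64 * x ^ 4 <= V * x ^ 4) by (apply Rmult_le_compat_r; lra). lra. }
    apply Rle_trans with (m * (y ^ 2 / 2)).
    + replace (m * (y ^ 2 / 2)) with (m / 4 * (2 * y ^ 2)) by field. apply Rmult_le_compat_l; lra.
    + apply Rmult_le_compat; lra.
  - apply far.
    assert (hl : log_ratio x y <= - m).
    { rewrite hlr. assert (em * inner_form a0 x y <= outer_form x y ^ 2).
      { apply Rle_trans with (2 := hqe'). apply Rle_trans with (em * (6 * (v * x ^ 4) + 4 * x ^
          6)).
        - apply Rmult_le_compat_l; lra.
        - replace (em * (6 * (v * x ^ 4) + 4 * x ^ 6)) with
            (6 * (em * v) * x ^ 4 + 4 * (em * x ^ 2) * x ^ 4) by ring.
          rewrite hvem. unfold V in hVx.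
          assert (em * x ^ 2 * x ^ 4 <= 1 * x ^ 4) by (apply Rmult_le_compat_r; lra). lra. }
      apply ln_le in H; [| apply Rmult_lt_0_compat; lra].
      rewrite ln_mult in H by lra. unfold em in H. rewrite ln_exp in H. lra. }
    assert (hvx : v * x ^ 4 <= 1 / 2 * x ^ 4) by (apply Rmult_le_compat_r; lra).
    assert (he : energy x y <= 3 / 2 * x ^ 4) by (unfold energy; lra).
    (* The constant is [31/25 - 1/2], since [y^2 <= x^4 / 2] in this sector. *)
    apply Rle_trans with (m * (74 / 100 * x ^ 4)).
    + replace (m / 4 * energy x y) with (m * (energy x y / 4)) by field.
      apply Rmult_le_compat_l; lra.
    + replace (log_ratio x y * (y ^ 2 + a0 * x ^ 4)) with
        ((- log_ratio x y) * (- (y ^ 2 + a0 * x ^ 4))) by ring.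
      apply Rmult_le_compat; lra.
  - assert (hx0 : 0 < x ^ 4).
    { destruct hx4 as [h | h]; [exact h |]. rewrite <- h in hi. lra. }
    assert (hx20 : 0 < x ^ 2).
    { destruct hx2 as [h | h]; [exact h |]. exfalso.
      replace (x ^ 4) with (x ^ 2 * x ^ 2) in hx0 by ring. rewrite <- h in hx0. lra. }
    assert (hql : outer_form x y <= 5 * x ^ 2).
    { unfold outer_form. replace (x ^ 4) with (x ^ 2 * x ^ 2) in hi by ring.
      assert (V * x ^ 2 * x ^ 2 <= 1 * x ^ 2) by (apply Rmult_le_compat_r; lra). lra. }
    assert (hqs : outer_form x y ^ 2 <= 25 * x ^ 4).
    { replace (25 * x ^ 4) with ((5 * x ^ 2) ^ 2) by ring. apply pow_incr; lra. }
    assert (hlog : Rabs (log_ratio x y) <= M0).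
    { assert (hup : log_ratio x y <= ln ((6 * V + 4) / 16)).
      { rewrite hlr. assert (h : inner_form a0 x y <= (6 * V + 4) / 16 * outer_form x y ^ 2).
        { apply Rle_trans with ((6 * V + 4) / 16 * (16 * x ^ 4)); [| apply Rmult_le_compat_l;
            lra].
          assert (x ^ 2 * x ^ 4 <= 1 * x ^ 4) by (apply Rmult_le_compat_r; nra). lra. }
        apply ln_le in h; [| exact hS]. rewrite ln_mult in h by lra. lra. }
      assert (hdn : ln (3 * v / 25) <= log_ratio x y).
      { rewrite hlr. assert (h : 3 * v / 25 * outer_form x y ^ 2 <= inner_form a0 x y).
        { apply Rle_trans with (3 * v / 25 * (25 * x ^ 4)); [apply Rmult_le_compat_l; lra |
            lra]. }
        apply ln_le in h; [| apply Rmult_lt_0_compat; lra]. rewrite ln_mult in h by lra. lra. }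
      unfold M0. pose proof (Rle_abs (ln ((6 * V + 4) / 16))).
      pose proof (Rle_abs (- ln (3 * v / 25))) as h. rewrite Rabs_Ropp in h.
      pose proof (Rabs_pos (ln ((6 * V + 4) / 16))). pose proof (Rabs_pos (ln (3 * v / 25))).
      apply Rabs_le. lra. }
    assert (hfac : Rabs (y ^ 2 + a0 * x ^ 4) <= 2 * energy x y).
    { unfold energy. apply Rabs_le. lra. }
    assert (hprod : - (M0 * (2 * energy x y)) <= log_ratio x y * (y ^ 2 + a0 * x ^ 4)).
    { assert (h : Rabs (log_ratio x y * (y ^ 2 + a0 * x ^ 4)) <= M0 * (2 * energy x y)).
      { rewrite Rabs_mult. apply Rmult_le_compat; auto using Rabs_pos. }
      apply Rabs_le_between in h. lra. }
    apply (Rmult_le_compat_l (outer_form x y)) in hprod; [| lra].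
    assert (hwle : sqrt (energy x y) <= (1 + V) * x ^ 2).
    { rewrite <- (sqrt_pow2 ((1 + V) * x ^ 2)) by (apply Rmult_le_pos; lra).
      apply sqrt_le_1_alt. unfold energy.
      replace (((1 + V) * x ^ 2) ^ 2) with ((1 + V) ^ 2 * x ^ 4) by ring.
      apply Rle_trans with ((1 + V) * x ^ 4); [lra |]. apply Rmult_le_compat_r; nra. }
    assert (hw3 : sqrt (energy x y) ^ 3 <= (1 + V) ^ 3 * x ^ 6).
    { replace ((1 + V) ^ 3 * x ^ 6) with (((1 + V) * x ^ 2) ^ 3) by ring. apply pow_incr; lra. }
    assert (hV3 : 0 < (1 + V) ^ 3) by (apply pow_lt; lra).
    assert (hx60 : 0 < x ^ 6) by (rewrite hx6; apply Rmult_lt_0_compat; assumption).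
    assert (htl : v / (1 + V) ^ 3 * x ^ 6 <= x ^ 8 * y ^ 2 / sqrt (energy x y) ^ 3).
    { assert (hw30 : 0 < sqrt (energy x y) ^ 3) by (apply pow_lt; exact hw).
      apply Rmult_le_reg_r with (sqrt (energy x y) ^ 3); [exact hw30 |].
      replace (x ^ 8 * y ^ 2 / sqrt (energy x y) ^ 3 * sqrt (energy x y) ^ 3) with (x ^ 8 * y ^ 2)
        by (field; lra).
      apply Rle_trans with (v / (1 + V) ^ 3 * x ^ 6 * ((1 + V) ^ 3 * x ^ 6)).
      - apply Rmult_le_compat_l; [| exact hw3].
        apply Rmult_le_pos; [| lra]. apply Rlt_le, Rdiv_lt_0_compat; lra.
      - replace (v / (1 + V) ^ 3 * x ^ 6 * ((1 + V) ^ 3 * x ^ 6)) with (x ^ 8 * (v * x ^ 4)) by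
          (field; lra).
        apply Rmult_le_compat_l; [| lra]. replace (x ^ 8) with (x ^ 4 * x ^ 4) by ring.
        apply Rmult_le_pos; lra. }
    apply (Rmult_le_compat_l (4 * K)) in htl; [| lra].
    replace (4 * K * (v / (1 + V) ^ 3 * x ^ 6)) with ((M0 + C) * (5 * x ^ 2 * ((1 + V) * x ^
      4))) in htl
      by (unfold K; field; lra).
    assert (hqE : outer_form x y * energy x y <= 5 * x ^ 2 * ((1 + V) * x ^ 4)).
    { apply Rmult_le_compat; try lra. unfold energy. lra. }
    assert (hMC : (M0 + C) * (outer_form x y * energy x y) <= (M0 + C) * (5 * x ^ 2 * ((1 + V) *
      x ^ 4))).
    { apply Rmult_le_compat_l; lra. }
    assert (0 <= M0 * (outer_form x y * energy x y)).
    { apply Rmult_le_pos; [exact hM0 | apply Rmult_le_pos; lra]. }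
    lra.
Qed.

Lemma focus_degenerate : is_focus (field_x a0) field_y.
Proof.
  destruct second_rate_expansion as (C & C' & hC & hC' & hrate).
  (* Of the two additional [z2], one absorbs [K C' z3] on a disc that depends on [K], and the other
     is the final lower bound for the rate. *)
  destruct (log_term_dominates (C + 2)) as (K & hK & hdom); [lra |].
  apply (focus_criterion a0 Delta0 Delta0_gt0 Delta0_sq (second_lyapunov K) (second_rate K) 1 (1
    / 4)).
  - auto.
  - lra.
  - apply second_lyapunov_orbital.
  - apply second_lyapunov_bounded.
  - assert (hKC : 0 <= K * C') by (apply Rmult_le_pos; lra).
    assert (hk : 0 < / (K * C' + 1)) by (apply Rinv_0_lt_compat; lra).
    pose proof (near_radius 1 Rlt_0_1) as h1.
    apply near_impl with (2 := near_and _ _ (near_and _ _ (hrate K hK) hdom)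
      (near_and _ _ (near_radius _ hk) h1)).
    intros x y hn [[e1 e2] [e3 e4]].
    assert (hr : K * C' * radius x y <= 1).
    { apply Rle_trans with ((K * C' + 1) * / (K * C' + 1)); [| right; field; lra].
      pose proof (radius_ge0 x y). apply Rmult_le_compat; lra. }
    pose proof (z2_ge0 x y) as hz.
    assert (hz3 : K * C' * z3 x y <= z2 x y).
    { unfold z3. rewrite <- Rmult_assoc. apply Rle_trans with (1 * z2 x y); [| lra].
      apply Rmult_le_compat_r; assumption. }
    assert (hn1 : norm2 x y < 1).
    { rewrite <- radius_sq. pose proof (radius_ge0 x y). nra. }
    assert (hz2 : norm2 x y ^ 3 <= 2 * z2 x y).
    { unfold z2. replace (norm2 x y ^ 3) with (norm2 x y * norm2 x y ^ 2) by ring.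
      replace (2 * (norm2 x y * energy x y)) with (norm2 x y * (2 * energy x y)) by ring.
      apply Rmult_le_compat_l; [lra | apply norm2_sq_le_energy; exact hn1]. }
    lra.
Qed.

Theorem proposition12 (a : R) (ha : 32 - (1 + 3 * a) ^ 2 > 0) :
  is_focus (fun x y : R => x * y ^ 2 - y ^ 3 + a * x ^ 5)
           (fun x y : R => 2 * x ^ 7 - x ^ 4 * y + 4 * x * y ^ 2 + y ^ 3).
Proof.
  set (Delta := sqrt (32 - (1 + 3 * a) ^ 2)).
  assert (hD : 0 < Delta) by (apply sqrt_lt_R0; lra).
  assert (hD2 : Delta ^ 2 = 32 - (1 + 3 * a) ^ 2) by (apply pow2_sqrt; lra).
  destruct (Req_dec (a + Delta / 4) 0) as [e | hne].
  - assert (hDa : Delta = -4 * a) by lra. rewrite hDa in hD2.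
    (* Inserting [Delta = -4 a] in [Delta^2 = 32 - (1+3a)^2] gives [25 a^2 + 6 a - 31 = 0]. The root
       1 is excluded because [Delta > 0] forces [a < 0]. *)
    assert (ha0 : (a - 1) * (25 * a + 31) = 0) by lra.
    apply Rmult_integral in ha0. destruct ha0 as [h | h]; [lra |].
    replace a with (-31 / 25) by lra. exact focus_degenerate.
  - exact (focus_nondegenerate a Delta hD hD2 hne).
Qed.
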